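(* Let $n\ge1$. The linear map $\Phi:M_n\otimes M_n\to cb(M_n,M_n)$ defined by $\Phi(x\otimes y)(a)=xay$ establishes an isometric isomorphism between $M_n\otimes_{oh}M_n$ and the complex interpolation space $$\big(cb(M_n,M_n),\;cb(\overline{M_n^*},\overline{M_n^*})\big)_{1/2}.$$
   Context: All spaces are complex. An operator space is a Banach space $E$ given with an isometric embedding as a closed subspace of some $B(H)$, $H$ a Hilbert space; $M_k(E)$ is normed as a subspace of $M_k(B(H))=B(H\oplus\cdots\oplus H)$. $M_n=B(\ell_2^n)$ is the algebra of complex $n\times n$ matrices with operator norm. For linear $u:E\to F$, $\|u\|_{cb}=\sup_k\|(a_{ij})\mapsto(u(a_{ij}))\|_{M_k(E)\to M_k(F)}$, and $cb(E,F)$ is the space of maps with $\|u\|_{cb}<\infty$, with this norm. The dual $E^*$ is an operator space with $M_k(E^* )=cb(E,M_k)$. The complex conjugate $\overline{E}$ is the same Banach space with scalar multiplication $\lambda\cdot x=\overline{\lambda}x$, with operator space structure induced by $\overline{E}\subset\overline{B(H)}=B(\overline H)$; $\overline x$ is $x\in E$ viewed in $\overline E$. $E\otimes_{\min}F$ is the completion of $E\otimes F$ for the norm induced by $B(H\otimes K)$ when $E\subset B(H)$, $F\subset B(K)$. For $u\in E\otimes F$ set $$oh(u)=\inf\Big\{\Big\|\sum_{i=1}^m x_i\otimes\overline{x_i}\Big\|^{1/2}_{E\otimes_{\min}\overline E}\Big\|\sum_{i=1}^m y_i\otimes\overline{y_i}\Big\|^{1/2}_{F\otimes_{\min}\overline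 F}\Big\},$$ the infimum over all representations $u=\sum_{i=1}^mx_i\otimes y_i$, $x_i\in E$, $y_i\in F$. This is a norm, and $E\otimes_{oh}F$ is the completion of $E\otimes F$ for it. $M_n$ and $\overline{M_n^*}$ are identified as vector spaces by the linear isomorphism $i:M_n\to\overline{M_n^*}$, $i(x)(y)=\mathrm{tr}(xy^* )$ (elements of $\overline{M_n^*}$ being viewed as antilinear functionals on $M_n$). Accordingly a linear map $T$ on $M_n$ is identified with the linear map $iTi^{-1}$ on $\overline{M_n^*}$, so $cb(M_n,M_n)$ and $cb(\overline{M_n^*},\overline{M_n^*})$ are the same vector space with two norms, and form a compatible couple. $(\cdot,\cdot)_{1/2}$ is Calderón's complex interpolation space with parameter $1/2$. *)

(* Defs.v *)
From HB Require Import structures.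
From mathcomp Require Import all_boot all_order all_algebra.
From mathcomp Require Import all_classical all_reals all_analysis.
From mathcomp.real_closed Require Export complex mxtens.

Set Implicit Arguments.
Unset Strict Implicit.
Unset Printing Implicit Defensive.

Import Order.TTheory GRing.Theory Num.Theory.
Import numFieldNormedType.Exports.
Import Normc.

Local Open Scope classical_set_scope.
Local Open Scope ring_scope.

(* Kept as a separate type because it carries another scalar multiplication;
   the element \overline{x} of [conjsp V] is represented by [x : V]. *)
Definition conjsp (K : numClosedFieldType) (V : lmodType K) : Type := V.

Section ConjugateSpace.
Context (K : numClosedFieldType) (V : lmodType K).

HB.instance Definition _ := GRing.Zmodule.on (conjsp V).

Definition conj_scale (a : K) (x : conjsp V) : conjsp V := a^* *: (x : V).

Lemma conj_scaleA a b x : conj_scale a (conj_scale b x) = conj_scale (a * b) x.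
Proof. by rewrite /conj_scale scalerA rmorphM. Qed.

Lemma conj_scale1 : left_id 1 conj_scale.
Proof. by move=> x; rewrite /conj_scale rmorph1 scale1r. Qed.

Lemma conj_scaleDr : right_distributive conj_scale +%R.
Proof. by move=> a x y; rewrite /conj_scale scalerDr. Qed.

Lemma conj_scaleDl x : {morph conj_scale^~ x : a b / a + b}.
Proof. by move=> a b; rewrite /conj_scale rmorphD scalerDl. Qed.

HB.instance Definition _ := GRing.Zmodule_isLmodule.Build K (conjsp V)
  conj_scaleA conj_scale1 conj_scaleDr conj_scaleDl.

End ConjugateSpace.

Section OperatorSpaces.
Context (R : realType).
Local Notation C := R[i].

Definition l2norm (n : nat) (v : 'cV[C]_n) : R :=
  Num.sqrt (\sum_i normc (v i 0) ^+ 2).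

Definition opnorm (p q : nat) (A : 'M[C]_(p, q)) : R :=
  sup [set l2norm (A *m v) | v in [set v | l2norm v <= 1]].

(* The family of norms of the spaces M_k(E); the value +oo is allowed so that
   unbounded suprema keep their meaning. *)
Definition mxnorms (E : lmodType C) := forall k : nat, 'M[E]_k -> \bar R.

Definition cbnorm (E F : lmodType C) (nE : mxnorms E) (nF : mxnorms F)
    (u : E -> F) : \bar R :=
  ereal_sup [set t | exists k (A : 'M[E]_k),
    [/\ (0 < k)%N, (nE k A <= 1)%E & t = nF k (map_mx u A)]].

(* M_k(M_n) = B(l_2^n (+) ... (+) l_2^n), acting by block matrices. *)
Definition Mn_norms (n : nat) : mxnorms 'M[C]_n :=
  fun k A => (opnorm (\mxblock_(i < k, j < k) A i j))%:E.

(* In finite dimension every linear functional is bounded. *)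
Definition dualsp (E : vectType C) := 'Hom(E, C^o).

(* M_k(E^* ) = cb(E, M_k). *)
Definition dual_norms (E : vectType C) (nE : mxnorms E) : mxnorms (dualsp E) :=
  fun k f => cbnorm nE (@Mn_norms k)
    (fun x => \matrix_(i, j) (f i j x : C)).

(* If E is a subspace of B(H), an element of M_k(\overline{E}) acts on
   \overline{H} (+) ... (+) \overline{H} by the same map, between the same
   normed sets, as the corresponding element of M_k(E) on H (+) ... (+) H. *)
Definition conj_norms (E : lmodType C) (nE : mxnorms E) : mxnorms (conjsp E) :=
  fun k A => nE k (A : 'M[E]_k).

(* In the orthonormal basis \overline{e_1}, ..., \overline{e_p} of
   \overline{l_2^p}, the operator \overline{x} has the entrywise conjugate of x
   as its matrix. Hence, in the basis e_i (x) \overline{e_j}, the operator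
   \sum_i x_i (x) \overline{x_i} on l_2^p (x) \overline{l_2^p} is the
   following sum of Kronecker products. *)
Definition min_conj_norm (p m : nat) (x : 'I_m -> 'M[C]_p) : R :=
  opnorm (\sum_(i < m) x i *t map_mx Num.conj (x i)).

(* M_p (x) M_q is modelled by 'M_(p * q), with Kronecker products as pure
   tensors (see tens_lift_tens and tens_lift_uniq for the universal
   property). Being finite dimensional it is complete for the norm oh. *)
Definition oh (p q : nat) (u : 'M[C]_(p * q)) : \bar R :=
  ereal_inf [set t | exists m (x : 'I_m -> 'M[C]_p) (y : 'I_m -> 'M[C]_q),
    u = \sum_(i < m) x i *t y i /\
    t = (Num.sqrt (min_conj_norm x) * Num.sqrt (min_conj_norm y))%:E].

End OperatorSpaces.

Arguments Mn_norms R n k A : clear implicits.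

Section TensorProduct.
Context (K : comNzRingType) (p q : nat) (V : lmodType K).

(* The linear map on M_p (x) M_q induced by a bilinear map. *)
Definition tens_lift (b : 'M[K]_p -> 'M[K]_q -> V) (u : 'M[K]_(p * q)) : V :=
  \sum_i \sum_j \sum_k \sum_l
    u (mxtens_index (i, k)) (mxtens_index (j, l)) *:
      b (delta_mx i j) (delta_mx k l).

Lemma tens_lift_linear b : linear (tens_lift b).
Proof.
move=> a u v; rewrite /tens_lift scaler_sumr -big_split; apply: eq_bigr => i _.
rewrite scaler_sumr -big_split; apply: eq_bigr => j _.
rewrite scaler_sumr -big_split; apply: eq_bigr => k _.
rewrite scaler_sumr -big_split; apply: eq_bigr => l _.
by rewrite !mxE scalerDl scalerA.
Qed.

Lemma tens_lift_tens (b : 'M[K]_p -> 'M[K]_q -> V) :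
  (forall x, linear (b x)) -> (forall y, linear (b^~ y)) ->
  forall x y, tens_lift b (x *t y) = b x y.
Proof.
move=> br bl x y.
pose blA y0 := GRing.isLinear.Build _ _ _ _ (b^~ y0) (bl y0).
pose brA x0 := GRing.isLinear.Build _ _ _ _ (b x0) (br x0).
pose L y0 : {linear 'M[K]_p -> V} := HB.pack (b^~ y0) (blA y0).
pose Q x0 : {linear 'M[K]_q -> V} := HB.pack (b x0) (brA x0).
rewrite -[RHS]/(L y x) [in RHS](matrix_sum_delta x) linear_sum.
apply: eq_bigr => i _; rewrite linear_sum; apply: eq_bigr => j _.
rewrite linearZ_LR -[L y _ in RHS]/(Q (delta_mx i j) y).
rewrite [in RHS](matrix_sum_delta y) linear_sum scaler_sumr.
apply: eq_bigr => k _; rewrite linear_sum scaler_sumr; apply: eq_bigr => l _.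
by rewrite linearZ_LR tensmxE scalerA.
Qed.

Lemma tens_delta (i j : 'I_p) (k l : 'I_q) :
  delta_mx i j *t delta_mx k l =
  delta_mx (mxtens_index (i, k)) (mxtens_index (j, l)) :> 'M[K]_(p * q).
Proof.
apply/matrixP => a c.
rewrite -(mxtens_unindexK a) -(mxtens_unindexK c).
case: (mxtens_unindex a) => a1 a2; case: (mxtens_unindex c) => c1 c2.
rewrite tensmxE !mxE !(can_eq (@mxtens_indexK _ _)) !xpair_eqE -natrM mulnb.
by congr (nat_of_bool _)%:R; do 4!case: eqP => //=.
Qed.

Lemma tens_span (u : 'M[K]_(p * q)) :
  u = \sum_i \sum_j \sum_k \sum_l
    u (mxtens_index (i, k)) (mxtens_index (j, l)) *:
      (delta_mx i j *t delta_mx k l).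
Proof.
have reidx (W : nmodType) (F : 'I_(p * q) -> W) :
    \sum_a F a = \sum_i \sum_k F (mxtens_index (i, k)).
  rewrite pair_bigA /= (reindex (@mxtens_index p q)) /=.
    by apply: eq_bigr => -[].
  by exists (@mxtens_unindex p q) => ? _; rewrite ?mxtens_indexK ?mxtens_unindexK.
rewrite {1}(matrix_sum_delta u) reidx; apply: eq_bigr => i _.
rewrite exchange_big reidx /= exchange_big /=.
rewrite exchange_big /=; apply: eq_bigr => j _.
rewrite exchange_big /=; apply: eq_bigr => k _; apply: eq_bigr => l _.
by rewrite tens_delta.
Qed.

Lemma tens_lift_uniq (f g : {linear 'M[K]_(p * q) -> V}) :
  (forall x y, f (x *t y) = g (x *t y)) -> f =1 g.
Proof.
move=> fg u; rewrite (tens_span u) !linear_sum; apply: eq_bigr => i _.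
rewrite !linear_sum; apply: eq_bigr => j _.
rewrite !linear_sum; apply: eq_bigr => k _.
by rewrite !linear_sum; apply: eq_bigr => l _; rewrite !linearZ /= fg.
Qed.

End TensorProduct.

Section Phi.
Context (R : realType) (n : nat).
Local Notation C := R[i].

Definition sandwich (x y : 'M[C]_n) : 'End('M[C]_n) :=
  linfun (mulmxr y \o mulmx x).

Lemma sandwichE x y a : sandwich x y a = x *m a *m y.
Proof. by rewrite lfunE. Qed.

Definition Phi : 'M[C]_(n * n) -> 'End('M[C]_n) := tens_lift sandwich.

HB.instance Definition _ := GRing.isLinear.Build C 'M[C]_(n * n) 'End('M[C]_n)
  *:%R Phi (tens_lift_linear sandwich).

Lemma Phi_tens x y a : Phi (x *t y) a = x *m a *m y.
Proof.
rewrite /Phi tens_lift_tens; first exact: sandwichE.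
  move=> z c u v; apply/lfunP => w.
  by rewrite add_lfunE scale_lfunE !sandwichE mulmxDr -scalemxAr.
move=> z c u v; apply/lfunP => w.
by rewrite add_lfunE scale_lfunE !sandwichE !mulmxDl -!scalemxAl.
Qed.

(* An element \overline{f} of \overline{M_n^*} is viewed as the antilinear
   functional y |-> (f y)^*. *)
Definition antilinear_form (f : conjsp (dualsp 'M[C]_n)) (y : 'M[C]_n) : C :=
  ((f : dualsp 'M[C]_n) y : C)^*.

Definition iota_form (x y : 'M[C]_n) : C^o :=
  (\tr (x *m (map_mx Num.conj y)^T))^*.

Lemma iota_form_linear x : linear (iota_form x).
Proof.
move=> a u v; rewrite /iota_form map_mxD map_mxZ linearD linearZ /= mulmxDr.
rewrite -scalemxAr mxtraceD mxtraceZ rmorphD rmorphM.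
by congr (_ * _ + _); apply: conjCK.
Qed.

HB.instance Definition _ x := GRing.isLinear.Build C 'M[C]_n C^o *:%R
  (iota_form x) (iota_form_linear x).

(* The map i : M_n -> \overline{M_n^*}; see iotaE. *)
Definition iota (x : 'M[C]_n) : conjsp (dualsp 'M[C]_n) :=
  linfun (iota_form x).

Lemma iotaE x y :
  antilinear_form (iota x) y = \tr (x *m (map_mx Num.conj y)^T).
Proof. by rewrite /antilinear_form lfunE /= conjCK. Qed.

Lemma iota_linear : linear iota.
Proof.
move=> a u v; apply/lfunP => y.
rewrite add_lfunE scale_lfunE !lfunE /= /iota_form mulmxDl -scalemxAl.
by rewrite mxtraceD mxtraceZ rmorphD rmorphM.
Qed.

HB.instance Definition _ := GRing.isLinear.Build C 'M[C]_n
  (conjsp (dualsp 'M[C]_n)) *:%R iota iota_linear.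

Definition iota_inv (f : conjsp (dualsp 'M[C]_n)) : 'M[C]_n :=
  \matrix_(j, k) antilinear_form f (delta_mx j k).

Lemma iotaK : cancel iota iota_inv.
Proof.
move=> x; apply/matrixP => j k; rewrite mxE iotaE map_delta_mx trmx_delta.
rewrite /mxtrace (bigD1 j) //= big1 => [|i ij]; rewrite !mxE.
  rewrite (bigD1 k) //= big1 => [|l lk]; rewrite !mxE ?eqxx ?mulr1 ?addr0 //.
  by rewrite (negbTE lk) mulr0.
by rewrite big1 // => l _; rewrite mxE (negbTE ij) andbF mulr0.
Qed.

Lemma iota_invK : cancel iota_inv iota.
Proof.
move=> f; apply/lfunP => y; rewrite lfunE /= /iota_form.
rewrite [in RHS](matrix_sum_delta y) linear_sum /mxtrace rmorph_sum.
apply: eq_bigr => j _; rewrite linear_sum mxE rmorph_sum.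
apply: eq_bigr => k _; rewrite linearZ_LR !mxE rmorphM mulrC.
by congr (_ * _); apply: conjCK.
Qed.

Definition norm_cbMn (T : 'End('M[C]_n)) : \bar R :=
  cbnorm (Mn_norms R n) (Mn_norms R n) T.

Definition norm_cbconj (T : 'End('M[C]_n)) : \bar R :=
  let N := conj_norms (dual_norms (Mn_norms R n)) in
  cbnorm N N (iota \o T \o iota_inv).

End Phi.

(* A compatible couple is given by a vector space V and two functions N0, N1,
   with X_j = {v | N_j v < +oo} normed by N_j. *)
Section ComplexInterpolation.
Context (R : realType) (V : lmodType R[i]) (N0 N1 : V -> \bar R).
Local Notation C := R[i].

(* The norm of X_0 + X_1. *)
Definition sumnorm (v : V) : \bar R :=
  ereal_inf [set (N0 a + N1 (v - a)%R)%E | a in [set: V]].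

Definition strip : set C := [set z | 0 <= complex.Re z <= 1].

Definition open_strip : set C := [set z | 0 < complex.Re z < 1].

Definition vline (s t : R) : C := Complex s t.

Definition boundary_cond (N : V -> \bar R) (s : R) (f : C -> V) : Prop :=
  [/\ forall t, (N (f (vline s t)) < +oo)%E,
      forall t, N (f (vline s t') - f (vline s t)) @[t' --> t] --> 0%E,
      N (f (vline s t)) @[t --> +oo] --> 0%E &
      N (f (vline s t)) @[t --> -oo] --> 0%E].

Definition calderon_space : set (C -> V) := [set f |
  [/\ exists M : R, forall z, strip z -> (sumnorm (f z) <= M%:E)%E,
      forall z, strip z ->
        sumnorm (f w - f z) @[w --> within strip (nbhs (z : C^o))] --> 0%E,
      forall z, open_strip z -> exists l : V,
        sumnorm (h^-1 *: (f (z + h) - f z) - l) @[h --> (0 : C^o)^'] --> 0%E,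
      boundary_cond N0 0 f &
      boundary_cond N1 1 f]].

Definition calderon_norm (f : C -> V) : \bar R :=
  maxe (ereal_sup [set N0 (f (vline 0 t)) | t in [set: R]])
       (ereal_sup [set N1 (f (vline 1 t)) | t in [set: R]]).

Definition interp_space (theta : R) : set V :=
  [set f theta%:C%C | f in calderon_space].

Definition interp_norm (theta : R) (v : V) : \bar R :=
  ereal_inf [set calderon_norm f | f in
    calderon_space `&` [set f | f theta%:C%C = v]].

End ComplexInterpolation.

(* Main.v *)
(* Write P_x b = sum_i x_i b x_i^H. The norm of sum_i x_i (x) conj x_i is the norm
   of P_x on Hilbert-Schmidt matrices, and when it is < 1 there are A, B >= 1
   with A = 1 + P_x B and B = 1 + P_x^H A; let A', B' be the same for y.

   If u = sum_i x_i (x) y_i with |P_x|, |P_y| < 1, then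
   F(z) = sum_i A^(z-1/2) x_i B^(1/2-z) (x) A'^(1/2-z) y_i B'^(z-1/2)
   takes the value u at 1/2 and has norm <= 1 on both boundary lines, hence the
   interpolation norm is at most oh.

   Conversely, for l > oh(u) choose among the representations
   u / l = sum_i x_i (x) y_i of a fixed length one that minimises
   tr (A + B + A' + B'). Stationarity gives
   tr (A x_i B x_j^H) = tr (A' y_j B' y_i^H), and hence a contractive bilinear
   form b on Hilbert-Schmidt matrices with
   b (A^(1/2) x_i B^(1/2)) (A'^(1/2) y_i B'^(1/2)) = |A^(1/2) x_i B^(1/2)|^2.
   The three lines theorem applied to the functionals
   x (x) y |-> b (A^(1-z) x B^z) (A'^z y B'^(1-z)) bounds the interpolation norm
   from below by l (1 - sqrt n / a), where a is the largest Hilbert-Schmidt norm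
   among A, B, A', B'. A Schur test gives oh(u) <= l (1 - 1/a), so the
   interpolation norm is at least l - sqrt n (l - oh(u)); let l tend to oh(u). *)

From HB Require Import structures.
From mathcomp Require Import all_boot all_order all_algebra.
From mathcomp Require Import all_classical all_reals all_analysis.
From mathcomp Require Import ring lra.
Require Import Defs.

Set Implicit Arguments.
Unset Strict Implicit.
Unset Printing Implicit Defensive.

Import Order.TTheory GRing.Theory Num.Theory.
Import numFieldNormedType.Exports.
Import Normc.

Local Open Scope classical_set_scope.
Local Open Scope ring_scope.

(** * Goursat's lemma, maximum modulus and the three lines theorem *)

(** A lower bound for the interpolation norm needs a functional controlled at both endpoints.
    Instead of a minimax argument for [oh], the infimum is smoothed. The pair (A, B) solves (1 -
    M_x)(A, B) = (1, 1) for the selfadjoint positive map M_x (a, b) = (P_x b, P_x^H a), and tr (A +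
    B) is a barrier for the constraint |P_x| < 1. Since M_x is selfadjoint, the same pair also
    solves the adjoint equation, which makes the first variation of the barrier explicit. For l
    close to oh(u) the number a must be large: the Schur test puts |P_x| and |P_y| below 1 - 1/a, so
    a small a would improve the representation. Thus A / a and B / a play the role of approximate
    Perron eigenvectors. The relative error sqrt n / a comes from tr A <= sqrt n |A|, and l / a <= l
    - oh(u) makes it disappear in the limit. Two obstacles remain. The function F does not vanish at
    infinity, as Calderon's space demands, so it is multiplied by a scalar factor equal to 1 at 1/2.
    The norm on the conjugate dual is removed once and for all: the second norm of Phi u is the
    first norm of Phi u^H. *)

Section SegmentIntegral.
Context {R : realType}.
Implicit Types (f g F : R -> R) (a b c x : R).

Lemma continuous_integrable_itv f a b : continuous f ->
  lebesgue_measure.-integrable `[a, b] (EFin \o f).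
Proof.
move=> cf; apply: continuous_compact_integrable; first exact: segment_compact.
exact: continuous_subspaceT.
Qed.

(** The signed integral from 0 is written as a difference of two integrals, one of which always
    vanishes. Near [x0] it agrees with [J a x - J a 0], where [a] lies to the left of both 0 and
    [x0], and there the one-sided fundamental theorem applies. *)
Lemma continuous_antiderivative f : continuous f ->
  exists F, forall x, is_derive x (1 : R) F (f x).
Proof.
move=> cf; pose J a b : R := (\int[lebesgue_measure]_(t in `[a, b]) f t)%R.
have J_cat a b c : a <= b -> b <= c -> J a c - J a b = J b c.
  move=> ab bc; have If u v := @continuous_integrable_itv f u v cf.
  rewrite /J (@Rintegral_itvB R f (BLeft a) (BRight c) b) //.
  apply: Rintegral_itv_obnd_cbnd; apply: integrableS (If b c) => //=.
  by apply: subset_itvr; rewrite bnd_simp.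
have J_pt a b : b <= a -> J a b = 0.
  rewrite /J le_eqVlt => /predU1P[->|ba]; first by rewrite set_itv1 Rintegral_set1.
  by rewrite set_itv_ge ?Rintegral_set0 // bnd_simp -ltNge.
exists (fun x => J 0 x - J x 0) => x0.
pose a := - (`|x0| + 1).
have a0 : a < 0 by rewrite oppr_lt0 ltr_wpDl.
have ax : a < x0.
  by rewrite /a ltrNl (le_lt_trans (ler_norm _)) // normrN ltrDl.
have GF x : a < x -> J a x - J a 0 = J 0 x - J x 0.
  move=> /ltW ax'; have [x0'|x0'] := leP 0 x.
    by rewrite (J_cat _ _ _ (ltW a0) x0') (J_pt x 0) // subr0.
  by rewrite (J_pt 0 x (ltW x0')) sub0r -(J_cat _ _ _ ax' (ltW x0')) opprB.
apply: (@near_eq_is_derive _ _ _ (fun x => J a x - J a 0)).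
  near=> x; apply: GF; near: x; exact: lt_nbhsr.
have -> : f x0 = f x0 - 0 by rewrite subr0.
apply: is_deriveB.
have [dF dFE] := @continuous_FTC1_closed R f a x0 (x0 + 1) ltac:(by rewrite ltrDl)
  (@continuous_integrable_itv f a (x0 + 1) cf) ax (cf x0).
by rewrite -dFE derive1E; apply: derivableP.
Unshelve. all: by end_near. Qed.

Definition primitive f : R -> R :=
  xget (fun=> 0) [set F | forall x, is_derive x (1 : R) F (f x)].

(** Integration through a chosen antiderivative makes additivity over intervals hold without any
    condition of continuity or on the order of the endpoints; contour decompositions then become
    algebra. *)
Definition segint f a b : R := primitive f b - primitive f a.

Lemma is_derive_primitive f : continuous f ->
  forall x, is_derive x (1 : R) (primitive f) (f x).
Proof.
move=> /continuous_antiderivative[F dF].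
by rewrite /primitive; case: xgetP => [G _ //|/(_ F)].
Qed.

Lemma segintE f F a b : (forall x, is_derive x (1 : R) F (f x)) ->
  segint f a b = F b - F a.
Proof.
move=> dF; rewrite /segint /primitive; case: xgetP => [G _ dG|/(_ F)//].
suff: (G - F) b = (G - F) a by rewrite !fctE; lra.
apply: is_derive_0_is_cst => x.
by have := is_deriveB (dG x) (dF x); rewrite subrr.
Qed.

Lemma segint_cat f a b c : segint f a b + segint f b c = segint f a c.
Proof. rewrite /segint; lra. Qed.

Lemma segintD f g a b : continuous f -> continuous g ->
  segint (fun x => f x + g x) a b = segint f a b + segint g a b.
Proof.
move=> cf cg; have dF x :=
  is_deriveD (is_derive_primitive cf x) (is_derive_primitive cg x).
by rewrite (segintE _ _ dF) /segint !fctE; lra.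
Qed.

Lemma segintN f a b : continuous f ->
  segint (fun x => - f x) a b = - segint f a b.
Proof.
move=> cf; have dF x := is_deriveN (is_derive_primitive cf x).
by rewrite (segintE _ _ dF) /segint !fctE; lra.
Qed.

Lemma segintZ k f a b : continuous f ->
  segint (fun x => k * f x) a b = k * segint f a b.
Proof.
move=> cf; have dF x := is_deriveZ k (is_derive_primitive cf x).
exact: etrans (segintE _ _ dF) (esym (mulrBr _ _ _)).
Qed.

Lemma segint_cst k a b : segint (fun=> k) a b = k * (b - a).
Proof.
have dF x : is_derive x (1 : R) (k *: id) k.
  by have := is_deriveZ k (is_derive_id x (1:R)); rewrite /GRing.scale /= mulr1.
by rewrite (segintE _ _ dF) ?fctE /GRing.scale /=; lra.
Qed.

Lemma segint_id a b : segint id a b = (b ^+ 2 - a ^+ 2) / 2.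
Proof.
have dF x : is_derive x (1 : R) (fun y : R => 2^-1 * (y * y)) x.
  have h := is_derive_id x (1 : R).
  apply: (is_derive_eq (is_deriveZ 2^-1 (is_deriveM h h))).
  by rewrite /GRing.scale /=; lra.
by rewrite (segintE _ _ dF); ring.
Qed.

Lemma segint_ge0 f a b : continuous f -> a <= b ->
  (forall x, a <= x <= b -> 0 <= f x) -> 0 <= segint f a b.
Proof.
move=> cf ab f0.
rewrite /segint; have [|c cab ->] := @MVT_segment R (primitive f) f a b ab
  (fun x _ => is_derive_primitive cf x).
  apply: continuous_subspaceT => x; apply: differentiable_continuous.
  apply/derivable1_diffP; by have [] := is_derive_primitive cf x.
by rewrite mulr_ge0 ?subr_ge0 // f0 //; move: cab; rewrite in_itv.
Qed.

Lemma le_segint f g a b : continuous f -> continuous g -> a <= b ->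
  (forall x, a <= x <= b -> f x <= g x) -> segint f a b <= segint g a b.
Proof.
move=> cf cg ab fg; rewrite -subr_ge0.
have cNf : continuous (fun x => - f x) by move=> x; apply: cvgN; exact: cf.
rewrite -segintN // -segintD //; apply: segint_ge0 => //.
  by move=> x; apply: cvgD; [exact: cg|exact: cNf].
by move=> x xab; rewrite subr_ge0 fg.
Qed.

Lemma norm_segint_le f (M a b : R) : continuous f -> a <= b ->
  (forall x, a <= x <= b -> `|f x| <= M) -> `|segint f a b| <= M * (b - a).
Proof.
move=> cf ab fM; have cc k : continuous (fun _ : R => k) := @cst_continuous R R k.
rewrite ler_norml -mulNr -!segint_cst; apply/andP; split.
  by apply: le_segint => // x /fM; rewrite ler_norml => /andP[].
by apply: le_segint => // x /fM; rewrite ler_norml => /andP[].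
Qed.

End SegmentIntegral.

Section ComplexNorm.
Context {R : realType}.
Local Notation C := R[i].
Implicit Types (z w : C) (x y : R).

Lemma normCE z : `|z| = (normc z)%:C%C.
Proof. by rewrite normc_def; case: z. Qed.

Lemma normc_real x : normc x%:C%C = `|x|.
Proof. by rewrite /normc /= expr0n addr0 sqrtr_sqr. Qed.

Lemma normc_ge0 z : 0 <= normc z.
Proof. by case: z => a b; rewrite sqrtr_ge0. Qed.

Lemma normcD_le z w : normc (z + w) <= normc z + normc w.
Proof. exact: (@le_normcD R z w). Qed.

Lemma normc_opp z : normc (- z) = normc z.
Proof. exact: (@normcN R z). Qed.

Lemma normcX z n : normc (z ^+ n) = normc z ^+ n.
Proof.
by elim: n => [|n IHn]; rewrite ?expr0 ?normc1 // !exprS normcM IHn.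
Qed.

Lemma normc_sum (I : Type) (r : seq I) (P : pred I) (F : I -> C) :
  normc (\sum_(i <- r | P i) F i) <= \sum_(i <- r | P i) normc (F i).
Proof.
elim/big_ind2: _ => //; first by rewrite normc0.
by move=> a b c d h1 h2; apply: le_trans (normcD_le _ _) (lerD h1 h2).
Qed.

Lemma normc_sq z : normc z ^+ 2 = complex.Re z ^+ 2 + complex.Im z ^+ 2.
Proof. by case: z => a b; rewrite sqr_sqrtr // addr_ge0 // sqr_ge0. Qed.

Lemma Re_le_normc z : `|complex.Re z| <= normc z.
Proof.
rewrite -sqrtr_sqr; case: z => a b /=.
by rewrite ler_wsqrtr // lerDl sqr_ge0.
Qed.

Lemma Im_le_normc z : `|complex.Im z| <= normc z.
Proof.
rewrite -sqrtr_sqr; case: z => a b /=.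
by rewrite ler_wsqrtr // lerDr sqr_ge0.
Qed.

Lemma normc_le_ReIm z : normc z <= `|complex.Re z| + `|complex.Im z|.
Proof.
rewrite -ler_sqr ?nnegrE ?normc_ge0 ?addr_ge0 // normc_sq.
rewrite sqrrD !real_normK ?num_real //.
have : 0 <= `|complex.Re z| * `|complex.Im z| by rewrite mulr_ge0.
lra.
Qed.

Lemma normc_conj z : normc z^*%C = normc z.
Proof. by case: z => a b; rewrite /normc /= sqrrN. Qed.

Lemma posc_real (e : C) : 0 < e -> 0 < complex.Re e /\ e = (complex.Re e)%:C%C.
Proof. by case: e => a b; rewrite ltcE /= => /andP[/eqP -> ->]. Qed.

(** The norm of [C] as a normed module is complex valued; this lemma passes to the real valued
    [normc] and real tolerances. *)
Lemma cvgc_normP (T : Type) (F : set_system T) (FF : Filter F) (f : T -> C) (l : C) :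
  (f @ F --> (l : C^o)) <->
  (forall e : R, 0 < e -> \forall x \near F, normc (f x - l) < e).
Proof.
split=> [/(@cvgrPdist_lt C C^o) h e e0|h].
  have := h e%:C%C; rewrite ltcR => /(_ e0).
  by apply: filterS => x; rewrite normCE ltcR -normc_opp opprB.
apply/(@cvgrPdist_lt C C^o) => e /posc_real[e0 ->].
by apply: filterS (h _ e0) => x; rewrite normCE ltcR -normc_opp opprB.
Qed.

Lemma nbhsc_normP (z : C) (P : set C) :
  nbhs (z : C^o) P <->
  exists2 d : R, 0 < d & forall w, normc (w - z) < d -> P w.
Proof.
split=> [/nbhs_ballP[e /= /posc_real[e0 eE] h]|[d d0 h]].
  exists (complex.Re e) => // w wz; apply: h.
  by rewrite -ball_normE /= normCE eE ltcR -normc_opp opprB.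
apply/nbhs_ballP; exists d%:C%C; first by rewrite /= ltcR.
by move=> w; rewrite -ball_normE /= normCE ltcR -normc_opp opprB => /h.
Qed.

Lemma Re_continuous : continuous (fun z : C^o => complex.Re (z : C) : R).
Proof.
move=> z; apply/(@cvgrPdist_lt R R^o C^o (nbhs (z : C^o)) (nbhs_filter (z : C^o))) => e e0.
apply/nbhsc_normP; exists e => // w wz.
rewrite distrC; apply: le_lt_trans wz; have := Re_le_normc (w - z).
by rewrite raddfB.
Qed.

Lemma Im_continuous : continuous (fun z : C^o => complex.Im (z : C) : R).
Proof.
move=> z; apply/(@cvgrPdist_lt R R^o C^o (nbhs (z : C^o)) (nbhs_filter (z : C^o))) => e e0.
apply/nbhsc_normP; exists e => // w wz.
rewrite distrC; apply: le_lt_trans wz; have := Im_le_normc (w - z).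
by rewrite raddfB.
Qed.

Lemma Complex_cvg (T : Type) (F : set_system T) (FF : Filter F) (f g : T -> R) (a b : R) :
  f @ F --> a -> g @ F --> b -> (fun t => Complex (f t) (g t) : C^o) @ F --> (Complex a b : C^o).
Proof.
move=> /(@cvgrPdist_lt R R^o) fa /(@cvgrPdist_lt R R^o) gb; apply/cvgc_normP => e e0.
have e2 : 0 < e / 2 by lra.
near=> t; apply: le_lt_trans (normc_le_ReIm _) _; rewrite /= -[- a](opprK) !opprK.
have h1 : `|a - f t| < e / 2 by near: t; exact: fa.
have h2 : `|b - g t| < e / 2 by near: t; exact: gb.
by rewrite distrC in h1; rewrite distrC in h2; lra.
Unshelve. all: by end_near. Qed.

End ComplexNorm.

(** * Contour integrals over rectangles *)

Section RectangleIntegral.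
Context {R : realType}.
Local Notation C := R[i].
Implicit Types (g : C -> C) (h : R -> C) (z w k : C).

Lemma Re_cvg (T : Type) (F : set_system T) (FF : Filter F) (f : T -> C) (l : C) :
  (f @ F --> (l : C^o)) -> (fun t => complex.Re (f t)) @ F --> complex.Re l.
Proof.
move=> fl; apply: (@cvg_comp _ _ _ f (fun z : C^o => complex.Re z : R) F (nbhs (l : C^o)) _ fl).
exact: Re_continuous. Qed.

Lemma Im_cvg (T : Type) (F : set_system T) (FF : Filter F) (f : T -> C) (l : C) :
  (f @ F --> (l : C^o)) -> (fun t => complex.Im (f t)) @ F --> complex.Im l.
Proof.
move=> fl; apply: (@cvg_comp _ _ _ f (fun z : C^o => complex.Im z : R) F (nbhs (l : C^o)) _ fl).
exact: Im_continuous. Qed.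

Definition cint h a b : C :=
  Complex (segint (fun x => complex.Re (h x)) a b)
          (segint (fun x => complex.Im (h x)) a b).

Definition ccont h := continuous (h : R -> C^o).

Lemma Re_ccont h : ccont h -> continuous (fun x => complex.Re (h x)).
Proof. by move=> ch x; apply: Re_cvg; exact: ch. Qed.

Lemma Im_ccont h : ccont h -> continuous (fun x => complex.Im (h x)).
Proof. by move=> ch x; apply: Im_cvg; exact: ch. Qed.

Lemma cint_cat h a b c : cint h a b + cint h b c = cint h a c.
Proof. by apply/eqP; rewrite eq_complex /= !segint_cat !eqxx. Qed.

Lemma cintD h1 h2 a b : ccont h1 -> ccont h2 ->
  cint (fun x => h1 x + h2 x) a b = cint h1 a b + cint h2 a b.
Proof.
move=> c1 c2; apply/eqP; rewrite eq_complex /=.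
have [R1 R2 I1 I2] := And4 (Re_ccont c1) (Re_ccont c2) (Im_ccont c1) (Im_ccont c2).
rewrite -!segintD //.
by apply/andP; split; apply/eqP; congr segint; apply/funext => x;
  case: (h1 x) (h2 x) => ? ? [].
Qed.

Lemma cintZ k h a b : ccont h ->
  cint (fun x => k * h x) a b = k * cint h a b.
Proof.
move=> c1; have [R1 I1] := conj (Re_ccont c1) (Im_ccont c1).
case: k => u v; apply/eqP; rewrite eq_complex /=.
have cZ (s : R) (f : R -> R) : continuous f -> continuous (fun x => s * f x).
  by move=> cf x; apply: cvgM; [exact: cvg_cst|exact: cf].
rewrite -!segintZ // -segintN ?segintD //; last by apply: cZ.
rewrite -!segintD; try exact: cZ; last first.
  by move=> x; apply: cvgN; exact: cZ.
by apply/andP; split; apply/eqP; congr segint; apply/funext => x; case: (h x).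
Qed.

(** The factor 2 comes from bounding real and imaginary parts separately. It is harmless: constants
    are removed later by taking powers. *)
Lemma norm_cint_le h (M a b : R) : ccont h -> a <= b ->
  (forall x, a <= x <= b -> normc (h x) <= M) ->
  normc (cint h a b) <= 2 * M * (b - a).
Proof.
move=> ch ab hM; apply: le_trans (normc_le_ReIm _) _ => /=.
have h1 : `|segint (fun x => complex.Re (h x)) a b| <= M * (b - a).
  apply: norm_segint_le => //; first exact: Re_ccont.
  by move=> x xab; apply: le_trans (Re_le_normc _) (hM x xab).
have h2 : `|segint (fun x => complex.Im (h x)) a b| <= M * (b - a).
  apply: norm_segint_le => //; first exact: Im_ccont.
  by move=> x xab; apply: le_trans (Im_le_normc _) (hM x xab).
lra.
Qed.

(** Integral of g dz along the counterclockwise boundary: dz is dx on the bottom and top sides and i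
    dy on the right and left ones. *)
Definition rectint g (x0 x1 y0 y1 : R) : C :=
  cint (fun x => g (Complex x y0)) x0 x1 - cint (fun x => g (Complex x y1)) x0 x1
  + 'i%C * (cint (fun y => g (Complex x1 y)) y0 y1 - cint (fun y => g (Complex x0 y)) y0 y1).

Definition gcont g := continuous (g : C^o -> C^o).

Lemma hline_ccont g y : gcont g -> ccont (fun x => g (Complex x y)).
Proof.
move=> cg x; apply: (@cvg_comp _ _ _ _ (g : C^o -> C^o) _ (nbhs (Complex x y : C^o))); last exact: cg.
by apply: Complex_cvg; [exact: cvg_id|exact: cvg_cst].
Qed.

Lemma vline_ccont g x : gcont g -> ccont (fun y => g (Complex x y)).
Proof.
move=> cg y; apply: (@cvg_comp _ _ _ _ (g : C^o -> C^o) _ (nbhs (Complex x y : C^o))); last exact: cg.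
by apply: Complex_cvg; [exact: cvg_cst|exact: cvg_id].
Qed.

Lemma rectint_catx g x0 x1 x2 y0 y1 :
  rectint g x0 x1 y0 y1 + rectint g x1 x2 y0 y1 = rectint g x0 x2 y0 y1.
Proof.
rewrite /rectint -(cint_cat (fun x => g (Complex x y0)) x0 x1 x2).
rewrite -(cint_cat (fun x => g (Complex x y1)) x0 x1 x2); ring.
Qed.

Lemma rectint_caty g x0 x1 y0 y1 y2 :
  rectint g x0 x1 y0 y1 + rectint g x0 x1 y1 y2 = rectint g x0 x1 y0 y2.
Proof.
rewrite /rectint -(cint_cat (fun y => g (Complex x0 y)) y0 y1 y2).
rewrite -(cint_cat (fun y => g (Complex x1 y)) y0 y1 y2); ring.
Qed.

Lemma rectintD g1 g2 x0 x1 y0 y1 : gcont g1 -> gcont g2 ->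
  rectint (fun z => g1 z + g2 z) x0 x1 y0 y1
  = rectint g1 x0 x1 y0 y1 + rectint g2 x0 x1 y0 y1.
Proof.
move=> c1 c2; rewrite /rectint !cintD; try exact: hline_ccont; try exact: vline_ccont.
ring.
Qed.

Lemma rectintZ k g x0 x1 y0 y1 : gcont g ->
  rectint (fun z => k * g z) x0 x1 y0 y1 = k * rectint g x0 x1 y0 y1.
Proof.
move=> c1; rewrite /rectint !cintZ; try exact: hline_ccont; try exact: vline_ccont.
ring.
Qed.

Definition rect_boundary (x0 x1 y0 y1 : R) z :=
  [/\ x0 <= complex.Re z <= x1, y0 <= complex.Im z <= y1 &
   [\/ complex.Re z = x0, complex.Re z = x1, complex.Im z = y0 | complex.Im z = y1]].

Lemma norm_rectint_le g (M x0 x1 y0 y1 : R) : gcont g -> x0 <= x1 -> y0 <= y1 ->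
  (forall z, rect_boundary x0 x1 y0 y1 z -> normc (g z) <= M) ->
  normc (rectint g x0 x1 y0 y1) <= 4 * M * ((x1 - x0) + (y1 - y0)).
Proof.
move=> cg xx yy gM.
have h1 y : y = y0 \/ y = y1 ->
    normc (cint (fun x => g (Complex x y)) x0 x1) <= 2 * M * (x1 - x0).
  move=> hy; apply: norm_cint_le => //; first exact: hline_ccont.
  move=> x xx'; apply: gM; split => //=.
    by case: hy => ->; rewrite lexx yy.
  by case: hy => ->; [apply: Or43|apply: Or44].
have h2 x : x = x0 \/ x = x1 ->
    normc (cint (fun y => g (Complex x y)) y0 y1) <= 2 * M * (y1 - y0).
  move=> hx; apply: norm_cint_le => //; first exact: vline_ccont.
  move=> y yy'; apply: gM; split => //=.
    by case: hx => ->; rewrite lexx xx.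
  by case: hx => ->; [apply: Or41|apply: Or42].
have ni : normc ('i%C : C) = 1.
  by rewrite /normc /= expr0n expr1n add0r sqrtr1.
rewrite /rectint; apply: le_trans (normcD_le _ _) _.
rewrite normcM ni mul1r.
have t1 : normc (cint (fun x => g (Complex x y0)) x0 x1 -
   cint (fun x => g (Complex x y1)) x0 x1) <= 4 * M * (x1 - x0).
  apply: le_trans (normcD_le _ _) _; rewrite normc_opp.
  by have := h1 y0 (or_introl erefl); have := h1 y1 (or_intror erefl); lra.
have t2 : normc (cint (fun y => g (Complex x1 y)) y0 y1 -
   cint (fun y => g (Complex x0 y)) y0 y1) <= 4 * M * (y1 - y0).
  apply: le_trans (normcD_le _ _) _; rewrite normc_opp.
  by have := h2 x0 (or_introl erefl); have := h2 x1 (or_intror erefl); lra.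
by apply: le_trans (lerD t1 t2) _; lra.
Qed.

(** This disposes of the linear part of a function at the limit point of Goursat's bisection. *)
Lemma rectint_affine k l x0 x1 y0 y1 :
  rectint (fun z => k + l * z) x0 x1 y0 y1 = 0.
Proof.
have ccst : gcont (fun=> k) by exact: (@cst_continuous C^o C^o).
have cid : gcont id by move=> z; exact: cvg_id.
have cl : gcont (fun z => l * z).
  exact: (@mulrl_continuous C l).
rewrite rectintD // rectintZ //.
have hid y : cint (fun x => id (Complex x y)) x0 x1 =
    Complex ((x1 ^+ 2 - x0 ^+ 2) / 2) (y * (x1 - x0)).
  by rewrite /cint /= (segint_id x0 x1) segint_cst.
have vid x : cint (fun y => id (Complex x y)) y0 y1 =
    Complex (x * (y1 - y0)) ((y1 ^+ 2 - y0 ^+ 2) / 2).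
  by rewrite /cint /= (segint_id y0 y1) segint_cst.
rewrite /rectint !hid !vid !subrr mulr0 !add0r.
by apply/eqP; rewrite mulf_eq0; apply/orP; right; apply/eqP/eqP; rewrite eq_complex /=;
  apply/andP; split; apply/eqP; simpc; ring.
Qed.

End RectangleIntegral.

(** * Goursat's lemma by bisection *)

Section Goursat.
Context {R : realType}.
Local Notation C := R[i].
Implicit Types (g : C -> C) (z w : C).

Lemma gcont_cst (k : C) : gcont (fun=> k).
Proof. exact: (@cst_continuous C^o C^o). Qed.

Lemma gcont_id : gcont (@id C).
Proof. by move=> z; exact: cvg_id. Qed.

Lemma gcontD g1 g2 : gcont g1 -> gcont g2 -> gcont (fun z => g1 z + g2 z).
Proof. by move=> c1 c2 z; exact: (cvgD (c1 z) (c2 z)). Qed.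

Lemma gcontN g : gcont g -> gcont (fun z => - g z).
Proof. by move=> c1 z; exact: (cvgN (c1 z)). Qed.

Lemma gcontM g1 g2 : gcont g1 -> gcont g2 -> gcont (fun z => g1 z * g2 z).
Proof. by move=> c1 c2 z; exact: (cvgM (c1 z) (c2 z)). Qed.

Lemma derivable_approx g z : derivable (g : C^o -> C^o) z 1 ->
  exists l : C, forall e : R, 0 < e -> exists2 d : R, 0 < d &
    forall w, normc (w - z) < d ->
      normc (g w - (g z + l * (w - z))) <= e * normc (w - z).
Proof.
move=> /cvg_ex[/= l].
move=> /(@cvgc_normP R C^o _ (dnbhs_filter (0 : C^o))) gl; exists l => e e0.
have /nbhsc_normP[d d0 h] := gl e e0.
exists d => // w wd.
have [->|wz] := eqVneq w z; first by rewrite subrr mulr0 addr0 subrr normc0 mulr0.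
have wz0 : w - z != 0 by rewrite subr_eq0.
have := h (w - z); rewrite subr0 => /(_ wd wz0).
rewrite /GRing.scale /= mulr1 subrK => hh.
have -> : g w - (g z + l * (w - z)) = ((w - z)^-1 * (g w - g z) - l) * (w - z).
  by field.
by rewrite normcM ler_wpM2r ?normc_ge0 // ltW.
Qed.

Lemma rectint_bisect g (x y a b : R) :
  rectint g x (x + a) y (y + b) =
    rectint g x (x + a / 2) y (y + b / 2) +
    rectint g (x + a / 2) (x + a) y (y + b / 2) +
    (rectint g x (x + a / 2) (y + b / 2) (y + b) +
     rectint g (x + a / 2) (x + a) (y + b / 2) (y + b)).
Proof. by rewrite !rectint_catx rectint_caty. Qed.

Lemma nested_intervals (x s : nat -> R) :
  (forall k, x k <= x k.+1) -> (forall k, x k.+1 + s k.+1 <= x k + s k) ->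
  (forall k, 0 <= s k) ->
  exists l, forall k, x k <= l <= x k + s k.
Proof.
move=> hx hs s0.
have mx k j : (k <= j)%N -> x k <= x j.
  move=> /subnKC <-; elim: (j - k)%N => [|i IH]; rewrite ?addn0 // addnS.
  exact: le_trans IH (hx _).
have ms k j : (k <= j)%N -> x j + s j <= x k + s k.
  move=> /subnKC <-; elim: (j - k)%N => [|i IH]; rewrite ?addn0 // addnS.
  exact: le_trans (hs _) IH.
have hle k j : x k <= x j + s j.
  have [kj|jk] := leqP k j.
    by apply: le_trans (mx _ _ kj) _; rewrite lerDl.
  by apply: le_trans _ (ms _ _ (ltnW jk)); rewrite lerDl.
exists (sup (range x)) => k; apply/andP; split.
  apply: ub_le_sup; last by exists k.
  by exists (x 0%N + s 0%N) => _ [j _ <-].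
apply: ge_sup; first by exists (x 0%N); exists 0%N.
by move=> _ [j _ <-].
Qed.

(** One of the four quarters carries at least a quarter of the modulus of the integral. Repeated
    halving leads to a point common to all chosen rectangles. The affine approximation there
    integrates to 0, and the remainder is of smaller order than the area, against the lower bound
    4^-k. *)
Lemma goursat_rect g (x0 y0 a b : R) : 0 < a -> 0 < b -> gcont g ->
  (forall z, x0 <= complex.Re z <= x0 + a -> y0 <= complex.Im z <= y0 + b ->
     derivable (g : C^o -> C^o) z 1) ->
  rectint g x0 (x0 + a) y0 (y0 + b) = 0.
Proof.
move=> a0 b0 cg dg.
(* A triple [(x, y, s)] stands for the rectangle with lower left corner (x, y) and sides s a and s
   b. *)
pose L (p : R * R * R) :=
  rectint g p.1.1 (p.1.1 + p.2 * a) p.1.2 (p.1.2 + p.2 * b).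
have step (p : R * R * R) : exists q : R * R * R,
    [/\ q.2 = p.2 / 2, q.1.1 = p.1.1 \/ q.1.1 = p.1.1 + p.2 * a / 2,
      q.1.2 = p.1.2 \/ q.1.2 = p.1.2 + p.2 * b / 2 &
      normc (L p) <= 4 * normc (L q)].
  case: p => -[x y] s.
  have LE : L (x, y, s) = L (x, y, s / 2) + L (x + s * a / 2, y, s / 2) +
      (L (x, y + s * b / 2, s / 2) + L (x + s * a / 2, y + s * b / 2, s / 2)).
    rewrite /L /= rectint_bisect.
    have e1 : x + s * a / 2 + s / 2 * a = x + s * a by lra.
    have e2 : y + s * b / 2 + s / 2 * b = y + s * b by lra.
    have e3 : s / 2 * a = s * a / 2 by lra.
    have e4 : s / 2 * b = s * b / 2 by lra.
    by rewrite e1 e2 e3 e4.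
  have LB : normc (L (x, y, s)) <= normc (L (x, y, s / 2)) + normc (L (x + s * a / 2, y, s / 2)) +
      (normc (L (x, y + s * b / 2, s / 2)) + normc (L (x + s * a / 2, y + s * b / 2, s / 2))).
    by rewrite LE; apply: le_trans (normcD_le _ _) _; apply: lerD; exact: normcD_le.
  clear LE; clearbody L.
  have [h|h1] := leP (normc (L (x, y, s))) (4 * normc (L (x, y, s / 2))).
    by exists (x, y, s / 2) => /=; split; auto.
  have [h|h2] := leP (normc (L (x, y, s))) (4 * normc (L (x + s * a / 2, y, s / 2))).
    by exists (x + s * a / 2, y, s / 2) => /=; split; auto.
  have [h|h3] := leP (normc (L (x, y, s))) (4 * normc (L (x, y + s * b / 2, s / 2))).
    by exists (x, y + s * b / 2, s / 2) => /=; split; auto.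
  exists (x + s * a / 2, y + s * b / 2, s / 2) => /=; split; auto.
  lra.
have [nxt nxtP] := choice step.
pose P k := iter k nxt (x0, y0, 1).
have PS k : P k.+1 = nxt (P k) by [].
have s2 k : (P k).2 = 2^-1 ^+ k.
  by elim: k => [|k IH]; rewrite ?expr0 // PS; have [-> _ _ _] := nxtP (P k); rewrite IH exprSr.
have s0 k : 0 < (P k).2 by rewrite s2 exprn_gt0.
have LP k : normc (L (P 0%N)) <= 4 ^+ k * normc (L (P k)).
  elim: k => [|k IH]; first by rewrite expr0 mul1r.
  apply: le_trans IH _; rewrite exprSr -mulrA ler_pM2l ?exprn_gt0 //.
  by rewrite PS; have [_ _ _] := nxtP (P k).
have [x xP] : exists l, forall k, (P k).1.1 <= l <= (P k).1.1 + (P k).2 * a.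
  apply: (@nested_intervals (fun k => (P k).1.1) (fun k => (P k).2 * a)) => k.
  - rewrite PS; have [_ h _ _] := nxtP (P k); have := s0 k.
    by case: h => ->; nra.
  - rewrite PS; have [-> h _ _] := nxtP (P k); have := s0 k.
    by case: h => ->; nra.
  - by rewrite mulr_ge0 ?ltW.
have [y yP] : exists l, forall k, (P k).1.2 <= l <= (P k).1.2 + (P k).2 * b.
  apply: (@nested_intervals (fun k => (P k).1.2) (fun k => (P k).2 * b)) => k.
  - rewrite PS; have [_ _ h _] := nxtP (P k); have := s0 k.
    by case: h => ->; nra.
  - rewrite PS; have [-> _ h _] := nxtP (P k); have := s0 k.
    by case: h => ->; nra.
  - by rewrite mulr_ge0 ?ltW.
have /derivable_approx[l lP] : derivable (g : C^o -> C^o) (Complex x y) 1.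
  apply: dg => /=; first by have := xP 0%N; rewrite /= mul1r.
  by have := yP 0%N; rewrite /= mul1r.
have -> : rectint g x0 (x0 + a) y0 (y0 + b) = L (P 0%N) by rewrite /L /= !mul1r.
apply/eqP/contraT => LN; exfalso.
have L0 : 0 < normc (L (P 0%N)).
  by rewrite lt_neqAle normc_ge0 andbT eq_sym; apply: contra LN => /eqP/eq0_normc ->.
set N := normc (L (P 0%N)) in L0.
have ab0 : 0 < a + b by rewrite addr_gt0.
(* The remainder contributes at most 4 e (s (a + b))^2 at scale s = 2^-k. Multiplied by 4^k this is
   4 e (a + b)^2 = N / 4, which is less than N. *)
pose e := N / (16 * (a + b) ^+ 2).
have e0 : 0 < e by rewrite divr_gt0 // mulr_gt0 // exprn_gt0.
have [d d0 hd] := lP e e0.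
have [k kP] : exists k, (P k).2 * (a + b) < d.
  have [k _ /(_ k (leqnn k)) hk] : \forall k \near \oo, (2^-1 : R) ^+ k < d / (a + b).
    have := @cvg_expr R (2^-1) ltac:(by rewrite ger0_norm; lra).
    move=> /(@cvgrPdist_lt R R^o) /(_ (d / (a + b)) ltac:(by rewrite divr_gt0)).
    apply: filterS => k; rewrite sub0r normrN ger0_norm // exprn_ge0 //; lra.
  by exists k; rewrite s2 -ltr_pdivlMr.
set s := (P k).2 in kP.
have sk0 : 0 < s := s0 k.
pose r w := g w - (g (Complex x y) + l * (w - Complex x y)).
have cl : gcont (fun z => (g (Complex x y) - l * Complex x y) + l * z).
  apply: gcontD; first exact: gcont_cst.
  by apply: gcontM; [exact: gcont_cst|exact: gcont_id].
have cr : gcont r.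
  apply: gcontD cg _; apply: gcontN; apply: gcontD; first exact: gcont_cst.
  apply: gcontM; first exact: gcont_cst.
  by apply: gcontD; [exact: gcont_id|exact: gcont_cst].
have LkE : L (P k) = rectint r (P k).1.1 ((P k).1.1 + s * a) (P k).1.2 ((P k).1.2 + s * b).
  have -> : L (P k) = rectint (fun w => r w + ((g (Complex x y) - l * Complex x y) + l * w))
     (P k).1.1 ((P k).1.1 + s * a) (P k).1.2 ((P k).1.2 + s * b).
    by rewrite /L; congr rectint; apply/funext => w; rewrite /r; ring.
  by rewrite rectintD // rectint_affine addr0.
have Lk : normc (L (P k)) <= 4 * (e * (s * (a + b))) * (s * (a + b)).
  have -> : s * (a + b) = (((P k).1.1 + s * a) - (P k).1.1) + (((P k).1.2 + s * b) - (P k).1.2).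
    lra.
  rewrite LkE; apply: norm_rectint_le => //; try by rewrite lerDl mulr_ge0 ?ltW.
  move=> z [zx zy _].
  have zz : normc (z - Complex x y) <= s * (a + b).
    apply: le_trans (normc_le_ReIm _) _.
    have := xP k; have := yP k; rewrite -/s.
    move: zx zy; case: z => u v /= zx zy yk xk.
    have h1 : `|u - x| <= s * a by rewrite ler_norml; apply/andP; split; lra.
    have h2 : `|v - y| <= s * b by rewrite ler_norml; apply/andP; split; lra.
    lra.
  apply: le_trans (hd z _) _; first exact: le_lt_trans zz kP.
  rewrite ler_pM2l //; lra.
have := LP k; rewrite -/N => NL.
have s4 : 4 ^+ k * s ^+ 2 = 1.
  by rewrite /s s2 -exprM mulnC exprM -exprMn (_ : 4 * (2^-1) ^+ 2 = 1) ?expr1n //; field.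
have : N <= 4 ^+ k * (4 * (e * (s * (a + b))) * (s * (a + b))).
  by apply: le_trans NL _; rewrite ler_pM2l ?exprn_gt0.
have -> : 4 ^+ k * (4 * (e * (s * (a + b))) * (s * (a + b)))
   = 4 * (4 ^+ k * s ^+ 2) * (e * (a + b) ^+ 2) by ring.
rewrite s4.
have -> : e * (a + b) ^+ 2 = N / 16 by rewrite /e; field; rewrite gt_eqF.
clear -L0; clearbody N; lra.
Qed.

End Goursat.

(** * A continuous Cauchy kernel *)

Section CauchyBound.
Context {R : realType}.
Local Notation C := R[i].
Implicit Types (g : C -> C) (z w : C).

(** This is the maximum of |z|^2 and d^2, written with an absolute value so that its continuity
    follows from that of the norm. *)
Definition trunc_sq (d : R) z : R :=
  (normc z ^+ 2 + d ^+ 2 + `|normc z ^+ 2 - d ^+ 2|) / 2.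

(* A globally continuous function equal to 1/z for |z| >= d. *)
Definition trunc_inv (d : R) z : C := z^*%C * ((trunc_sq d z)^-1)%:C%C.

Lemma trunc_sq_gt0 d z : 0 < d -> 0 < trunc_sq d z.
Proof.
move=> d0; rewrite /trunc_sq.
have := ler_norm (d ^+ 2 - normc z ^+ 2); rewrite distrC.
have : 0 < d ^+ 2 by rewrite exprn_gt0.
lra.
Qed.

Lemma trunc_invE d z : 0 < d -> d <= normc z -> trunc_inv d z = z^-1.
Proof.
move=> d0 dz; rewrite /trunc_inv /trunc_sq ger0_norm; last first.
  by rewrite subr_ge0 ler_sqr ?nnegrE ?normc_ge0 // ltW.
have -> : (normc z ^+ 2 + d ^+ 2 + (normc z ^+ 2 - d ^+ 2)) / 2 = normc z ^+ 2 by field.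
have z0 : z != 0 by apply: contraTneq dz => ->; rewrite normc0 -ltNge.
have nz : normc z ^+ 2 != 0 by rewrite expf_neq0 // gt_eqF // (lt_le_trans d0).
apply: (mulfI z0); rewrite divff // mulrA.
have -> : z * z^*%C = (normc z ^+ 2)%:C%C.
  by rewrite normc_sq; case: (z) => a b; simpc; congr Complex; ring.
by rewrite -rmorphM /= divff.
Qed.

Lemma conj_gcont : gcont (fun z : C => z^*%C).
Proof.
move=> z; apply/(@cvgc_normP R C^o (nbhs (z : C^o)) (nbhs_filter (z : C^o))) => e e0.
by apply/nbhsc_normP; exists e => // w; rewrite -rmorphB normc_conj.
Qed.

Lemma real_gcont (r : C -> R) : continuous (r : C^o -> R) -> gcont (fun z => (r z)%:C%C).
Proof. by move=> cr z; exact: (Complex_cvg (nbhs_filter (z : C^o)) (cr z) (cvg_cst _)). Qed.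

Lemma normc_sq_continuous : continuous ((fun z : C => normc z ^+ 2) : C^o -> R).
Proof.
have -> : (fun z : C => normc z ^+ 2) =
    fun z => complex.Re z * complex.Re z + complex.Im z * complex.Im z.
  by apply/funext => z; rewrite normc_sq !expr2.
move=> z; exact: (cvgD (cvgM (@Re_continuous R z) (@Re_continuous R z))
  (cvgM (@Im_continuous R z) (@Im_continuous R z))).
Qed.

Lemma trunc_inv_gcont d : 0 < d -> gcont (trunc_inv d).
Proof.
move=> d0; apply: gcontM; first exact: conj_gcont.
apply: real_gcont => z.
have c2 := @normc_sq_continuous z.
have cd : (fun=> d ^+ 2 : R) @ nbhs (z : C^o) --> d ^+ 2 by exact: cvg_cst.
have ch : (fun=> 2^-1 : R) @ nbhs (z : C^o) --> (2^-1 : R) by exact: cvg_cst.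
have ct := cvgM (cvgD (cvgD c2 cd) (cvg_norm (cvgB c2 cd))) ch.
have FF := nbhs_filter (z : C^o).
have ct' := cvgV (lt0r_neq0 (trunc_sq_gt0 z d0)) (ct FF FF FF FF FF).
exact: (ct' FF).
Qed.

End CauchyBound.

Section MaxModulus.
Context {R : realType}.
Local Notation C := R[i].
Implicit Types (f g : C -> C) (z w : C).

Definition cdif g z := derivable (g : C^o -> C^o) z 1.

Lemma cdif_cst (k : C) z : cdif (fun=> k) z.
Proof. exact: (@derivable_cst C C^o C^o k z 1). Qed.

Lemma cdif_id z : cdif id z.
Proof. exact: (@derivable_id C C^o z 1). Qed.

Lemma cdifD f g z : cdif f z -> cdif g z -> cdif (fun w => f w + g w) z.
Proof. exact: (@derivableD C C^o C^o f g z 1). Qed.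

Lemma cdifN f z : cdif f z -> cdif (fun w => - f w) z.
Proof. exact: (@derivableN C C^o C^o f z 1). Qed.

Lemma cdifM f g z : cdif f z -> cdif g z -> cdif (fun w => f w * g w) z.
Proof. exact: (@derivableM C C^o f g z 1). Qed.

Lemma cdifV f z : f z != 0 -> cdif f z -> cdif (fun w => (f w)^-1) z.
Proof. exact: (@derivableV C C^o f z 1). Qed.

Lemma cdifX f n z : cdif f z -> cdif (fun w => f w ^+ n) z.
Proof.
move=> df; elim: n => [|n IH]; first exact: cdif_cst.
have -> : (fun w => f w ^+ n.+1) = (fun w => f w * f w ^+ n).
  by apply/funext => w; rewrite exprS.
exact: cdifM.
Qed.

Lemma cdif_near f g z : (exists2 d : R, 0 < d & forall w, normc (w - z) < d -> f w = g w) ->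
  cdif f z -> cdif g z.
Proof.
by move=> fg; apply: near_eq_derivable; apply/nbhsc_normP.
Qed.

Lemma cdif_trunc_inv (d : R) z : 0 < d -> d < normc z -> cdif (trunc_inv d) z.
Proof.
move=> d0 dz; have z0 : z != 0.
  by apply: contraTneq dz => ->; rewrite normc0 -leNgt ltW.
apply: (@cdif_near (fun w => w^-1)); last by apply: cdifV => //; exact: cdif_id.
exists (normc z - d); first by rewrite subr_gt0.
move=> w wz; rewrite trunc_invE // ?ltW //.
have := normcD_le w (z - w); rewrite addrCA subrr addr0 -(normc_opp (z - w)) opprB.
lra.
Qed.

(* The integral is 2 pi i; only a lower bound for it is needed. *)
Lemma rectint_trunc_inv (d r : R) : 0 < d -> d < r ->
  4 <= normc (rectint (trunc_inv d) (- r) r (- r) r).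
Proof.
move=> d0 dr; have r0 : 0 < r by lra.
apply: le_trans _ (Im_le_normc _); apply: le_trans _ (ler_norm _).
pose k z : C := trunc_inv d z.
have ck := @trunc_inv_gcont R d d0.
have ImE h1 h2 h3 h4 a b c e : complex.Im (cint h1 a b - cint h2 a b + 'i%C * (cint h3 c e - cint h4 c e))
   = segint (fun x => complex.Im (h1 x)) a b - segint (fun x => complex.Im (h2 x)) a b
     + (segint (fun x => complex.Re (h3 x)) c e - segint (fun x => complex.Re (h4 x)) c e) :> R.
  by rewrite /=; ring.
rewrite /rectint ImE.
have kE x y : r <= `|x| \/ r <= `|y| -> k (Complex x y) =
    Complex (x / (x ^+ 2 + y ^+ 2)) (- y / (x ^+ 2 + y ^+ 2)).
  move=> rxy; rewrite /k trunc_invE //.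
    by rewrite /GRing.inv /=; congr Complex; rewrite mulNr.
  case: rxy => h.
    by have := Re_le_normc (Complex x y); rewrite /= => h'; lra.
  by have := Im_le_normc (Complex x y); rewrite /= => h'; lra.
have nr : `|r| = r by rewrite gtr0_norm.
have nnr : `|- r| = r by rewrite normrN.
(* On each side the relevant component of 1/z is, up to sign, r / (x^2 + r^2). As a side has length
   2 r, it contributes at least 1, and the four sides give 4. *)
have key x : - r <= x <= r -> 1 / (2 * r) <= r / (x ^+ 2 + r ^+ 2).
  move=> xr; rewrite ler_pdivrMr ?mulr_gt0 //.
  rewrite mulrAC ler_pdivlMr ?mul1r; last by rewrite ltr_wpDl ?sqr_ge0 ?exprn_gt0.
  have : x ^+ 2 <= r ^+ 2.
    by rewrite -(real_normK (num_real x)) ler_sqr ?nnegrE //; [rewrite ler_norml|exact: ltW].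
  rewrite !expr2; lra.
have cseg (c a b : R) : c * (b - a) = segint (fun=> c) a b by rewrite segint_cst.
have cc (c : R) : continuous (fun _ : R => c) by exact: cst_continuous.
have rr : - r <= r by lra.
have one : 1 = 1 / (2 * r) * (r - - r) by field; rewrite gt_eqF.
have b1 : 1 <= segint (fun x => complex.Im (k (Complex x (- r)))) (- r) r.
  rewrite {1}one cseg; apply: le_segint => //; first by apply: Im_ccont; exact: hline_ccont.
  move=> x /key; rewrite kE /=; last by right; rewrite nnr.
  by rewrite opprK sqrrN.
have b2 : segint (fun x => complex.Im (k (Complex x r))) (- r) r <= - 1.
  rewrite {1}one -mulNr cseg; apply: le_segint => //; first by apply: Im_ccont; exact: hline_ccont.
  move=> x /key; rewrite kE /=; last by right; rewrite nr.
  by rewrite mulNr; lra.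
have b3 : 1 <= segint (fun y => complex.Re (k (Complex r y))) (- r) r.
  rewrite {1}one cseg; apply: le_segint => //; first by apply: Re_ccont; exact: vline_ccont.
  move=> x /key; rewrite kE /=; last by left; rewrite nr.
  by rewrite addrC.
have b4 : segint (fun y => complex.Re (k (Complex (- r) y))) (- r) r <= - 1.
  rewrite {1}one -mulNr cseg; apply: le_segint => //; first by apply: Re_ccont; exact: vline_ccont.
  move=> x /key; rewrite kE /=; last by left; rewrite nnr.
  by rewrite mulNr sqrrN addrC; lra.
rewrite -/(k _); lra.
Qed.

End MaxModulus.

(** * Cauchy's estimate and the maximum modulus principle *)

Section CauchyEstimate.
Context {R : realType}.
Local Notation C := R[i].
Implicit Types (f g : C -> C) (z w : C).

(** Goursat's lemma on the four rectangles around a small square moves the integral of f(z)/z from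
    the large boundary to the small one. There f is nearly f(0), and the kernel alone integrates to
    something of modulus at least 4. The number [m] bounds from below the distance of 0 to the large
    boundary. *)
Lemma cauchy_bound f (h T m M : R) : 0 < m -> m <= h -> m <= T -> gcont f ->
  (forall z, - h <= complex.Re z <= h -> - T <= complex.Im z <= T -> cdif f z) ->
  (forall z, rect_boundary (- h) h (- T) T z -> normc (f z) <= M) ->
  normc (f 0) <= (2 * h + 2 * T) / m * M.
Proof.
move=> m0 mh mT cf df fM.
have M0 : 0 <= M.
  apply: le_trans (normc_ge0 _) (fM (Complex h 0) _).
  by split=> /=; [apply/andP; split; lra|apply/andP; split; lra|exact: Or42].
apply/ler_addgt0Pr => e e0.
have [d1 d10 fd1] : exists2 d1 : R, 0 < d1 &
    forall w, normc w < d1 -> normc (f w - f 0) < e / 4.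
  have := cf (0 : C); move=> /(@cvgc_normP R C^o _ (nbhs_filter (0 : C^o))).
  move=> /(_ (e / 4) ltac:(lra)) /nbhsc_normP[d1 d10 fd1].
  by exists d1 => // w wd; apply: fd1; rewrite subr0.
(* The bound m / 2 keeps the small square inside the rectangle, and d1 / 4 keeps it where f differs
   from f(0) by less than e / 4. The kernel is truncated at r / 2, hence equals 1/z on and outside
   the square. *)
pose r := Num.min (m / 2) (d1 / 4).
have [r0 rm rd] : [/\ 0 < r, r < m & 2 * r < d1].
  by rewrite /r; case: (leP (m / 2) (d1 / 4)) => ?; split; lra.
pose d := r / 2; have [d0 dr] : 0 < d /\ d < r by rewrite /d; split; lra.
pose k : C -> C := trunc_inv d.
have ck : gcont k by exact: trunc_inv_gcont.
pose g z := f z * k z; have cg : gcont g by exact: gcontM.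
have Z x0 x1 y0 y1 : - h <= x0 -> x0 < x1 -> x1 <= h -> - T <= y0 -> y0 < y1 -> y1 <= T ->
    (forall z, x0 <= complex.Re z <= x1 -> y0 <= complex.Im z <= y1 -> r <= normc z) ->
    rectint g x0 x1 y0 y1 = 0.
  move=> hx0 hx1 hx2 hy0 hy1 hy2 zr.
  rewrite -{1}(subrKC x0 x1) -{1}(subrKC y0 y1); apply: goursat_rect; rewrite ?subr_gt0 //.
  move=> z; rewrite !subrKC => zx zy; apply: cdifM.
    by apply: df; apply/andP; split; lra.
  by apply: cdif_trunc_inv => //; apply: lt_le_trans dr (zr z zx zy).
have Re_r z : complex.Re z <= - r \/ r <= complex.Re z -> r <= normc z.
  move=> hz; apply: le_trans (Re_le_normc z); case: hz => hz.
    by rewrite -normrN; apply: le_trans (ler_norm _); lra.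
  by apply: le_trans (ler_norm _).
have Im_r z : complex.Im z <= - r \/ r <= complex.Im z -> r <= normc z.
  move=> hz; apply: le_trans (Im_le_normc z); case: hz => hz.
    by rewrite -normrN; apply: le_trans (ler_norm _); lra.
  by apply: le_trans (ler_norm _).
have IE : rectint g (- h) h (- T) T = rectint g (- r) r (- r) r.
  rewrite -(rectint_catx g (- h) (- r) h) -(rectint_catx g (- r) r h).
  rewrite -(rectint_caty g (- r) r (- T) (- r) T) -(rectint_caty g (- r) r (- r) r T).
  have Z1 : rectint g (- h) (- r) (- T) T = 0.
    by apply: Z; try lra; move=> z zx zy; apply: Re_r; lra.
  have Z2 : rectint g r h (- T) T = 0.
    by apply: Z; try lra; move=> z zx zy; apply: Re_r; lra.
  have Z3 : rectint g (- r) r (- T) (- r) = 0.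
    by apply: Z; try lra; move=> z zx zy; apply: Im_r; lra.
  have Z4 : rectint g (- r) r r T = 0.
    by apply: Z; try lra; move=> z zx zy; apply: Im_r; lra.
  by rewrite Z1 Z2 Z3 Z4 !add0r !addr0.
have out : normc (rectint g (- h) h (- T) T) <= 4 * (M / m) * (2 * h + 2 * T).
  have -> : 2 * h + 2 * T = (h - - h) + (T - - T) by lra.
  apply: norm_rectint_le => //; [lra|lra|move=> z zb].
  have mz : m <= normc z.
    case: (zb) => _ _; case=> E.
    - apply: le_trans (Re_le_normc z); rewrite E -normrN opprK.
      by apply: le_trans (ler_norm _).
    - by apply: le_trans (Re_le_normc z); rewrite E; apply: le_trans (ler_norm _).
    - apply: le_trans (Im_le_normc z); rewrite E -normrN opprK.
      by apply: le_trans (ler_norm _).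
    - by apply: le_trans (Im_le_normc z); rewrite E; apply: le_trans (ler_norm _).
  rewrite /g normcM /k trunc_invE //; last lra.
  apply: ler_pM; rewrite ?normc_ge0 //; first exact: fM.
  by rewrite normcV lef_pV2 // posrE; lra.
have cfk : gcont (fun z => (f z + - f 0) * k z).
  exact: (gcontM (gcontD cf (@gcont_cst R (- f 0))) ck).
have gE : rectint g (- r) r (- r) r = rectint (fun z => (f z + - f 0) * k z) (- r) r (- r) r
    + f 0 * rectint k (- r) r (- r) r.
  rewrite -rectintZ // -(rectintD _ _ _ _ cfk (gcontM (@gcont_cst R (f 0)) ck)).
  have -> // : g = (fun z => (f z + - f 0) * k z + f 0 * k z).
  by apply/funext => z; rewrite mulrDl mulNr subrK.
have inn : normc (rectint (fun z => (f z + - f 0) * k z) (- r) r (- r) r) <= 4 * (e / 4 * r^-1) * (4 * r).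
  have -> : 4 * r = (r - - r) + (r - - r) by lra.
  apply: norm_rectint_le; [exact: cfk|lra|lra|move=> z zb].
  have rz : r <= normc z.
    by case: (zb) => _ _; case=> E; first [by apply: Re_r; lra | by apply: Im_r; lra].
  rewrite normcM /k trunc_invE //; last lra.
  apply: ler_pM; rewrite ?normc_ge0 //.
    apply/ltW/fd1; case: zb => zx zy _; apply: le_lt_trans (normc_le_ReIm _) _.
    apply: le_lt_trans rd.
    have -> : 2 * r = r + r by lra.
    by apply: lerD; rewrite ler_norml.
  by rewrite normcV lef_pV2 // posrE; lra.
have innE : 4 * (e / 4 * r^-1) * (4 * r) = 4 * e by field; rewrite gt_eqF.
rewrite innE in inn.
have ker := rectint_trunc_inv d0 dr; rewrite -/k in ker.
have : 4 * normc (f 0) <= normc (f 0 * rectint k (- r) r (- r) r).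
  by rewrite normcM mulrC ler_wpM2l // normc_ge0.
have := normcD_le (rectint g (- r) r (- r) r) (- rectint (fun z => (f z + - f 0) * k z) (- r) r (- r) r).
rewrite {1}gE [X in normc (X - _)]addrC addrK normc_opp -IE => tri k4.
have -> : (2 * h + 2 * T) / m * M = (M / m) * (2 * h + 2 * T) by ring.
lra.
Qed.

(* Applying cauchy_bound to f^k and taking k-th roots removes the constant. *)
Lemma maximum_modulus_rect f (h T m : R) (M : R) : 0 < m -> m <= h -> m <= T -> gcont f ->
  0 <= M ->
  (forall z, - h <= complex.Re z <= h -> - T <= complex.Im z <= T -> cdif f z) ->
  (forall z, rect_boundary (- h) h (- T) T z -> normc (f z) <= M) ->
  normc (f 0) <= M.
Proof.
move=> m0 mh mT cf M0 df fM; rewrite leNgt; apply/negP => Mf.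
have fk k : normc (f 0) ^+ k <= (2 * h + 2 * T) / m * M ^+ k.
  rewrite -normcX; have := @cauchy_bound (fun z => f z ^+ k) h T m (M ^+ k) m0 mh mT.
  apply.
  - elim: k => [|k IH]; first exact: gcont_cst.
    have -> : (fun w => f w ^+ k.+1) = (fun w => f w * f w ^+ k).
      by apply/funext => w; rewrite exprS.
    exact: gcontM.
  - by move=> z zx zy; apply: cdifX; exact: df.
  - by move=> z zb; rewrite normcX lerXn2r ?nnegrE ?normc_ge0 // fM.
set K := (2 * h + 2 * T) / m in fk.
have K0 : 0 < K by rewrite divr_gt0 //; lra.
have f0 : 0 < normc (f 0) by apply: le_lt_trans M0 Mf.
pose q := M / normc (f 0).
have q0 : 0 <= q by rewrite divr_ge0 ?normc_ge0.
have q1 : q < 1 by rewrite ltr_pdivrMr ?mul1r.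
have [k _ /(_ k (leqnn k)) hk] : \forall k \near \oo, q ^+ k < K^-1.
  have := @cvg_expr R q ltac:(by rewrite ger0_norm).
  move=> /(@cvgrPdist_lt R R^o) /(_ K^-1 ltac:(by rewrite invr_gt0)).
  by apply: filterS => k; rewrite sub0r normrN ger0_norm // exprn_ge0.
have := fk k; rewrite leNgt => /negP; apply.
rewrite /q expr_div_n ltr_pdivrMr ?exprn_gt0 // in hk.
by rewrite -ltr_pdivlMl.
Qed.

End CauchyEstimate.

(** * The three lines theorem for decaying functions *)

Section ThreeLines.
Context {R : realType}.
Local Notation C := R[i].
Implicit Types (f g : C -> C) (z w : C).

(** Scalar counterpart of the regularity on the strip required by [calderon_space]. It is stable
    under sums and products, so products and tensor products of matrices inherit it entry by
    entry. *)
Record holstrip f : Prop := HolStrip {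
  holstrip_bounded : exists M : R, forall z, @strip R z -> normc (f z) <= M;
  holstrip_continuous : forall z, @strip R z -> forall e : R, 0 < e ->
    exists2 d : R, 0 < d & forall w, @strip R w -> normc (w - z) < d -> normc (f w - f z) < e;
  holstrip_cdif : forall z, @open_strip R z -> cdif f z }.

Lemma holstrip_cst k : holstrip (fun=> k).
Proof.
split; first by exists (normc k).
  by move=> z _ e e0; exists 1 => // w _ _; rewrite subrr normc0.
by move=> z _; exact: cdif_cst.
Qed.

Lemma holstripD f g : holstrip f -> holstrip g -> holstrip (fun z => f z + g z).
Proof.
move=> [[M fM] cf df] [[N gN] cg dg]; split.
- exists (M + N) => z hz; apply: le_trans (normcD_le _ _) _.
  by apply: lerD; [exact: fM|exact: gN].
- move=> z hz e e0; have e2 : 0 < e / 2 by lra.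
  have [d1 d10 h1] := cf z hz _ e2; have [d2 d20 h2] := cg z hz _ e2.
  exists (Num.min d1 d2); first by rewrite lt_min d10 d20.
  move=> w hw; rewrite lt_min => /andP[w1 w2].
  rewrite opprD addrACA; apply: le_lt_trans (normcD_le _ _) _.
  by have := h1 w hw w1; have := h2 w hw w2; lra.
- by move=> z hz; apply: cdifD; [exact: df|exact: dg].
Qed.

Lemma holstripM f g : holstrip f -> holstrip g -> holstrip (fun z => f z * g z).
Proof.
move=> [[M fM] cf df] [[N gN] cg dg]; split.
- exists (M * N) => z hz; rewrite normcM; apply: ler_pM; rewrite ?normc_ge0 //.
    exact: fM.
  exact: gN.
- move=> z hz e e0.
  have M0 : 0 <= M by apply: le_trans (normc_ge0 _) (fM z hz).
  have N0 : 0 <= N by apply: le_trans (normc_ge0 _) (gN z hz).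
  have eN : 0 < e / (2 * (N + 1)) by rewrite divr_gt0 //; lra.
  have eM : 0 < e / (2 * (M + 1)) by rewrite divr_gt0 //; lra.
  have [d1 d10 h1] := cf z hz _ eN; have [d2 d20 h2] := cg z hz _ eM.
  exists (Num.min d1 d2); first by rewrite lt_min d10 d20.
  move=> w hw; rewrite lt_min => /andP[w1 w2].
  have -> : f w * g w - f z * g z = (f w - f z) * g w + f z * (g w - g z) by ring.
  apply: le_lt_trans (normcD_le _ _) _; rewrite !normcM.
  have t1 : normc (f w - f z) * normc (g w) <= e / (2 * (N + 1)) * N.
    by apply: ler_pM; rewrite ?normc_ge0 ?gN //; exact/ltW/h1.
  have t2 : normc (f z) * normc (g w - g z) <= M * (e / (2 * (M + 1))).
    by apply: ler_pM; rewrite ?normc_ge0 ?fM //; exact/ltW/h2.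
  have t3 : e / (2 * (N + 1)) * N < e / 2.
    by rewrite mulrAC ltr_pdivrMr; [nra|lra].
  have t4 : M * (e / (2 * (M + 1))) < e / 2.
    by rewrite mulrA ltr_pdivrMr; [nra|lra].
  lra.
- by move=> z hz; apply: cdifM; [exact: df|exact: dg].
Qed.

Lemma holstrip_sum (I : Type) (r : seq I) (P : pred I) (F : I -> C -> C) :
  (forall i, P i -> holstrip (F i)) -> holstrip (fun z => \sum_(i <- r | P i) F i z).
Proof.
move=> hF; elim: r => [|i r IH].
  have -> : (fun z => \sum_(i <- [::] | P i) F i z) = fun=> 0.
    by apply/funext => z; rewrite big_nil.
  exact: holstrip_cst.
have [Pi|nPi] := boolP (P i); last first.
  have -> // : (fun z => \sum_(j <- i :: r | P j) F j z) = fun z => \sum_(j <- r | P j) F j z.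
  by apply/funext => z; rewrite big_cons (negbTE nPi).
have -> : (fun z => \sum_(j <- i :: r | P j) F j z) = fun z => F i z + \sum_(j <- r | P j) F j z.
  by apply/funext => z; rewrite big_cons Pi.
by apply: holstripD => //; exact: hF.
Qed.

Definition clamp01 (s : R) : R := Num.max 0 (Num.min 1 s).

Lemma clamp01_itv s : 0 <= clamp01 s <= 1.
Proof. by rewrite /clamp01 le_max lexx ge_max ler01 ge_min lexx. Qed.

Lemma clamp01_id s : 0 <= s <= 1 -> clamp01 s = s.
Proof. by move=> /andP[s0 s1]; rewrite /clamp01 min_r // max_r. Qed.

Lemma clamp01_lip s t : `|clamp01 s - clamp01 t| <= `|s - t|.
Proof.
have := ler_norm (s - t); have := ler_norm (t - s); rewrite (distrC t s) => n1 n2.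
have E u : [\/ u <= 0 /\ clamp01 u = 0, 0 <= u <= 1 /\ clamp01 u = u | 1 <= u /\ clamp01 u = 1].
  rewrite /clamp01; case/orP: (le_total u 0) => h.
    by apply: Or31; rewrite (min_r (le_trans h ler01)) (max_l h).
  case/orP: (le_total u 1) => k; first by apply: Or32; rewrite (min_r k) (max_r h) h.
  by apply: Or33; rewrite (min_l k) (max_r ler01).
by case: (E s) => -[? ->]; case: (E t) => -[? ->]; rewrite ler_norml; apply/andP; split; lra.
Qed.

(* Extends f to a continuous function on the whole plane, translating 1/2 to 0. *)
Definition strip_ext f z : C :=
  f (Complex (clamp01 (complex.Re z + 2^-1)) (complex.Im z)).

Lemma strip_ext_gcont f : holstrip f -> gcont (strip_ext f).
Proof.
move=> [_ cf _] z; apply/(@cvgc_normP R C^o _ (nbhs_filter (z : C^o))) => e e0.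
have hs s t : @strip R (Complex (clamp01 s) t) by exact: clamp01_itv.
have [d d0 hd] := cf _ (hs (complex.Re z + 2^-1) (complex.Im z)) e e0.
apply/nbhsc_normP; exists (d / 2); first by lra.
move=> w wz; apply: hd => //; apply: le_lt_trans (normc_le_ReIm _) _ => /=.
have h1 : `|complex.Re w - complex.Re z| <= normc (w - z).
  by rewrite -raddfB; exact: Re_le_normc.
have h2 : `|complex.Im w - complex.Im z| <= normc (w - z).
  by rewrite -raddfB; exact: Im_le_normc.
have := clamp01_lip (complex.Re w + 2^-1) (complex.Re z + 2^-1).
have -> : complex.Re w + 2^-1 - (complex.Re z + 2^-1) = complex.Re w - complex.Re z by ring.
lra.
Qed.

Lemma strip_extE f z : - 2^-1 <= complex.Re z <= 2^-1 ->
  strip_ext f z = f (z + (2^-1)%:C%C).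
Proof.
case: z => a b /= ab; rewrite /strip_ext /= clamp01_id; last by apply/andP; split; lra.
by congr f; simpc.
Qed.

Lemma cdif_strip_ext f z : holstrip f -> - 2^-1 < complex.Re z < 2^-1 ->
  cdif (strip_ext f) z.
Proof.
move=> [_ _ df] zz.
apply: (@cdif_near _ (fun w => f (w + (2^-1)%:C%C))).
  exists (Num.min (complex.Re z + 2^-1) (2^-1 - complex.Re z)).
    by rewrite lt_min; apply/andP; split; lra.
  move=> w; rewrite lt_min => /andP[w1 w2]; rewrite strip_extE //.
  have := Re_le_normc (w - z); rewrite raddfB /= ler_norml => /andP[h1 h2].
  by apply/andP; split; lra.
have : cdif f (z + (2^-1)%:C%C).
  by apply: df; move: zz; case: z => a b /= zz; rewrite /open_strip /=; apply/andP; split; lra.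
have E : (fun h : C => h^-1 *: (((f : C^o -> C^o) \o shift (z + (2^-1)%:C%C)) (h *: (1 : C^o)) - f (z + (2^-1)%:C%C)))
    = (fun h : C => h^-1 *: (((fun w => f (w + (2^-1)%:C%C)) \o shift z) (h *: (1 : C^o)) - f (z + (2^-1)%:C%C))).
  by apply/funext => h /=; rewrite addrA.
by rewrite /cdif /derivable; move: E => /= ->.
Qed.

(** [maximum_modulus_rect] wants differentiability up to the boundary of the rectangle, which fails
    on the two lines. It is therefore applied to a slightly narrower rectangle, whose vertical sides
    are controlled by continuity and whose horizontal sides by the decay. *)
Lemma three_lines_decay f (c : R) : holstrip f ->
  (forall t, normc (f (Complex 0 t)) <= c) -> (forall t, normc (f (Complex 1 t)) <= c) ->
  (forall e : R, 0 < e -> exists T : R, forall z, @strip R z -> T <= `|complex.Im z| -> normc (f z) <= e) ->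
  normc (f (2^-1)%:C%C) <= c.
Proof.
move=> hf f0 f1 fT.
have c0 : 0 <= c by apply: le_trans (normc_ge0 _) (f0 0).
apply/ler_addgt0Pr => e e0.
have [T0 hT0] := fT (c + e) ltac:(lra).
pose T := Num.max T0 1.
have T1 : 1 <= T by rewrite le_max lexx orbT.
have T0T : T0 <= T by rewrite le_max lexx.
have cg := strip_ext_gcont hf.
(* Compactness of [-T, T] makes the width of the neighbourhood of the line independent of the
   height. *)
have edge s : (forall t, normc (strip_ext f (Complex s t)) <= c) ->
    exists2 d : R, 0 < d & forall a t, `|a - s| < d -> `|t| <= T -> normc (strip_ext f (Complex a t)) <= c + e.
  move=> hs.
  have /compact_near_coveringP/(_ R (nbhs s) (fun a t => normc (strip_ext f (Complex a t)) <= c + e)) :=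
    @segment_compact R (- T) T.
  case.
    move=> t _; have := cg (Complex s t).
    move=> /(@cvgc_normP R C^o _ (nbhs_filter (Complex s t : C^o))) /(_ e e0) /nbhsc_normP[d d0 hd].
    exists (ball t (d / 2), ball s (d / 2)); first by split; apply: nbhsx_ballx; lra.
    move=> [t' a] [/=]; rewrite -!ball_normE /= => ht ha.
    have := hd (Complex a t'); have := hs t.
    have nn : normc (Complex a t' - Complex s t) < d.
      apply: le_lt_trans (normc_le_ReIm _) _ => /=.
      by rewrite (distrC a) (distrC t'); lra.
    move=> h1 /(_ nn) h2.
    have := normcD_le (strip_ext f (Complex a t') - strip_ext f (Complex s t)) (strip_ext f (Complex s t)).
    by rewrite subrK; lra.
  move=> d /= d0 hd; exists d => // a t ha hat; apply: hd => /=.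
    by rewrite /ball_ /= distrC.
  by rewrite in_itv /= -ler_norml.
have [|d1 d10 h1] := edge (- 2^-1).
  move=> t; rewrite strip_extE /=; last by apply/andP; split; lra.
  have -> : Complex (- 2^-1) t + (2^-1)%:C%C = Complex 0 t by simpc; rewrite addNr.
  exact: f0.
have [|d2 d20 h2] := edge (2^-1).
  move=> t; rewrite strip_extE /=; last by apply/andP; split; lra.
  have -> : Complex (2^-1) t + (2^-1)%:C%C = Complex 1 t.
    by simpc; congr Complex; lra.
  exact: f1.
(* The bound 1/4 keeps the half-width 1/2 - d at least 1/4, which serves as the distance [m] from
   the centre to the boundary. *)
pose d := Num.min (Num.min (d1 / 2) (d2 / 2)) (4^-1).
have [dd0 dd1 dd2 dd3] : [/\ 0 < d, d < d1, d < d2 & d <= 4^-1].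
  have a1 : d <= d1 / 2 by rewrite /d !ge_min lexx.
  have a2 : d <= d2 / 2 by rewrite /d !ge_min lexx orbT.
  have a3 : d <= 4^-1 by rewrite /d !ge_min lexx orbT.
  have a0 : 0 < d by rewrite /d !lt_min !divr_gt0 //= invr_gt0.
  by split; lra.
have := @maximum_modulus_rect R (strip_ext f) (2^-1 - d) T (4^-1) (c + e).
rewrite strip_extE /=; last by apply/andP; split; lra.
rewrite add0r; apply=> //; try lra.
- by move=> z zx _; apply: cdif_strip_ext => //; apply/andP; split; lra.
- move=> z [zx zy]; case: z zx zy => a b /= zx zy.
  have zs : @strip R (Complex a b + (2^-1)%:C%C).
    by rewrite /strip /=; apply/andP; split; lra.
  case=> E.
  + by apply: h1; rewrite ?ler_norml // E ltr_norml; apply/andP; split; lra.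
  + by apply: h2; rewrite ?ler_norml // E ltr_norml; apply/andP; split; lra.
  + rewrite strip_extE /=; last by apply/andP; split; lra.
    apply: hT0 => //=; rewrite addr0 E normrN ger0_norm //; lra.
  + rewrite strip_extE /=; last by apply/andP; split; lra.
    apply: hT0 => //=; rewrite addr0 E ger0_norm //; lra.
Qed.

End ThreeLines.

(** * Damping at infinity and the general three lines theorem *)

Section Damping.
Context {R : realType}.
Local Notation C := R[i].
Implicit Types (f g : C -> C) (z w : C).

Lemma holstrip_intro f (M : R) : (forall z, @strip R z -> normc (f z) <= M) ->
  (forall z, @strip R z -> {for z, continuous (f : C^o -> C^o)}) ->
  (forall z, @open_strip R z -> cdif f z) -> holstrip f.
Proof.
move=> fM cf df; split=> //; first by exists M.
move=> z /cf /(@cvgc_normP R C^o _ (nbhs_filter (z : C^o))) h e /h.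
by move=> /nbhsc_normP[d d0 hd]; exists d => // w _; exact: hd.
Qed.

(** A rational substitute for the usual Gaussian factor. On the strip its real part is at least 1 -
    d/4 + d (Im z)^2, so its inverse decays along the strip, exceeds 1 by little, and equals 1 at
    the point 1/2 of interest. *)
Definition dampden (d : R) z : C := 1 - d%:C%C * ((z - (2^-1)%:C%C) * (z - (2^-1)%:C%C)).

Definition damp d z : C := (dampden d z)^-1.

Lemma dampden_ge d z : 0 <= d -> @strip R z ->
  1 - d / 4 + d * complex.Im z ^+ 2 <= normc (dampden d z).
Proof.
move=> d0 hz; apply: le_trans _ (Re_le_normc _); apply: le_trans _ (ler_norm _).
move: hz; case: z => a b; rewrite /strip /dampden /= => hz.
have : (a - 2^-1) * (a - 2^-1) <= 4^-1.
  have : 0 <= a * (1 - a) by apply: mulr_ge0; lra.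
  lra.
move=> /(ler_wpM2l d0); rewrite expr2; lra.
Qed.

Lemma normc_damp_le d z : 0 <= d <= 1 -> @strip R z ->
  normc (damp d z) <= (1 - d / 4 + d * complex.Im z ^+ 2)^-1.
Proof.
move=> /andP[d0 d1] hz; rewrite normcV lef_pV2 ?dampden_ge // posrE.
  by apply: lt_le_trans (dampden_ge d0 hz); have := mulr_ge0 d0 (sqr_ge0 (complex.Im z)); lra.
by have := mulr_ge0 d0 (sqr_ge0 (complex.Im z)); lra.
Qed.

Lemma normc_damp_le_cst d z : 0 <= d <= 1 -> @strip R z ->
  normc (damp d z) <= (1 - d / 4)^-1.
Proof.
move=> d01 hz; apply: le_trans (normc_damp_le d01 hz) _; case/andP: d01 => d0 d1.
by have h := mulr_ge0 d0 (sqr_ge0 (complex.Im z)); rewrite lef_pV2 ?posrE; lra.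
Qed.

Lemma damp_half d : damp d (2^-1)%:C%C = 1.
Proof. by rewrite /damp /dampden subrr mulr0 mulr0 subr0 invr1. Qed.

Lemma dampden_gcont d : gcont (dampden d).
Proof.
have c1 : gcont (fun z : C => z - (2^-1)%:C%C).
  by apply: gcontD; [exact: gcont_id|exact: gcont_cst].
have c2 := gcontM (@gcont_cst R d%:C%C) (gcontM c1 c1).
exact: (gcontD (@gcont_cst R 1) (gcontN c2)).
Qed.

Lemma cdif_dampden d z : cdif (dampden d) z.
Proof.
have c1 : cdif (fun z : C => z - (2^-1)%:C%C) z.
  by apply: cdifD; [exact: cdif_id|exact: cdif_cst].
have c2 := cdifM (@cdif_cst R d%:C%C z) (cdifM c1 c1).
exact: (cdifD (@cdif_cst R 1 z) (cdifN c2)).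
Qed.

Lemma dampden_neq0 d z : 0 <= d <= 1 -> @strip R z -> dampden d z != 0.
Proof.
move=> /andP[d0 d1] hz; apply/eqP => E; have := dampden_ge d0 hz.
by rewrite E normc0; have := mulr_ge0 d0 (sqr_ge0 (complex.Im z)); lra.
Qed.

Lemma holstrip_damp d : 0 <= d <= 1 -> holstrip (damp d).
Proof.
move=> d01; apply: (@holstrip_intro _ (1 - d / 4)^-1).
- by move=> z hz; exact: normc_damp_le_cst.
- move=> z hz; have FF := nbhs_filter (z : C^o).
  exact: (@cvgV C C^o _ FF (dampden d) (dampden d z) (dampden_neq0 d01 hz) (@dampden_gcont d z)).
- move=> z hz; apply: cdifV; last exact: cdif_dampden.
  apply: dampden_neq0 => //; move: hz; rewrite /open_strip /strip /=.
  by move=> /andP[h1 h2]; rewrite !ltW.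
Qed.

Theorem three_lines f (c : R) : holstrip f ->
  (forall t, normc (f (Complex 0 t)) <= c) -> (forall t, normc (f (Complex 1 t)) <= c) ->
  normc (f (2^-1)%:C%C) <= c.
Proof.
move=> hf f0 f1; apply/ler_addgt0Pr => e e0.
have c0 : 0 <= c by apply: le_trans (normc_ge0 _) (f0 0).
have [[M0 fM0] _ _] := hf.
pose M := Num.max M0 0; have fM z : @strip R z -> normc (f z) <= M.
  by move=> hz; apply: le_trans (fM0 z hz) _; rewrite le_max lexx.
have MM : 0 <= M by rewrite le_max lexx orbT.
(* This is small enough for c / (1 - d/4) <= c + e. *)
pose d := Num.min 1 (e / (c + 1)).
have d0 : 0 < d by rewrite lt_min ltr01 /= divr_gt0 //; lra.
have d1 : d <= 1 by rewrite ge_min lexx.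
have d01 : 0 <= d <= 1 by rewrite ltW.
have de : d * (c + 1) <= e by rewrite -ler_pdivlMr ?ge_min ?lexx ?orbT //; lra.
have hF := holstripM hf (holstrip_damp d01).
have sv s t : 0 <= s <= 1 -> @strip R (Complex s t) by [].
have ce : c / (1 - d / 4) <= c + e.
  rewrite ler_pdivrMr; last lra.
  have : 0 <= d * c by rewrite mulr_ge0 // ltW.
  have : d * e <= e by rewrite ger_pMl.
  lra.
have edge z : @strip R z -> normc (f z) <= c -> normc (f z * damp d z) <= c + e.
  move=> hz fc; rewrite normcM; apply: le_trans ce; apply: ler_pM; rewrite ?normc_ge0 //.
  exact: normc_damp_le_cst.
have := @three_lines_decay R _ (c + e) hF; rewrite damp_half mulr1; apply.
- by move=> t; apply: edge => //; apply: sv; rewrite lexx ler01.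
- by move=> t; apply: edge => //; apply: sv; rewrite lexx ler01.
(* Beyond height T the damping factor is at most 1 / (d T), because T >= 1 gives T <= T^2; and M /
   (d T) <= e'. *)
- move=> e' e'0; pose T := 1 + M / (d * e').
  have de' : 0 < d * e' by rewrite mulr_gt0.
  have T1 : 1 <= T by rewrite lerDl divr_ge0 // ltW.
  exists T => z hz Tz.
  rewrite normcM; apply: (@le_trans _ _ (M * (d * T)^-1)).
    apply: ler_pM; rewrite ?normc_ge0 ?fM //; apply: le_trans (normc_damp_le d01 hz) _.
    have Tsq : T <= complex.Im z ^+ 2.
      by rewrite -real_normK ?num_real // expr2; nra.
    have : d * T <= d * complex.Im z ^+ 2 by rewrite ler_pM2l.
    have : 0 < d * T by rewrite mulr_gt0 //; lra.
    by move=> *; rewrite lef_pV2 ?posrE; lra.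
  rewrite ler_pdivrMr ?mulr_gt0 //; last lra.
  have -> : e' * (d * T) = d * e' + M by rewrite /T; field; rewrite !gt_eqF.
  lra.
Qed.

End Damping.

(** * The complex exponential and complex powers of positive numbers *)

Section ComplexPower.
Context {R : realType}.
Local Notation C := R[i].
Implicit Types (f g : C -> C) (z w : C) (a x y : R).

Lemma is_derive_approx (f : R -> R) a (df : R) : is_derive a (1 : R) f df ->
  forall e : R, 0 < e -> exists2 d : R, 0 < d &
    forall h, `|h| < d -> `|f (a + h) - f a - df * h| <= e * `|h|.
Proof.
move=> [dfa <-] e e0.
have : (fun h : R => h^-1 *: ((f \o shift a) (h *: (1 : R)) - f a)) @ (0 : R)^' --> 'D_1 f a.
  exact: dfa.
move=> /(@cvgrPdist_lt R R^o _ _ (dnbhs_filter (0 : R))) /(_ e e0) /nbhs_ballP[d /= d0 hd].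
exists d => // h hd'.
have [->|h0] := eqVneq h 0; first by rewrite addr0 subrr mulr0 subr0 normr0 mulr0.
have := hd h; rewrite -ball_normE /= sub0r normrN => /(_ hd' h0).
rewrite /GRing.scale /= mulr1 => hh.
have -> : f (a + h) - f a - 'D_1 f a * h = - (('D_1 f a - h^-1 * (f (h + a) - f a)) * h).
  by rewrite [h + a]addrC; field.
by rewrite normrN normrM ler_wpM2r ?normr_ge0 // ltW.
Qed.

Lemma cdif_of_approx g z (l : C) :
  (forall e : R, 0 < e -> exists2 d : R, 0 < d &
    forall w, normc (w - z) < d -> normc (g w - (g z + l * (w - z))) <= e * normc (w - z)) ->
  cdif g z.
Proof.
move=> gl; apply/cvg_ex; exists l => /=.
apply/(@cvgc_normP R C^o _ (dnbhs_filter (0 : C^o))) => e e0.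
have [d d0 hd] := gl (e / 2) ltac:(lra).
apply/nbhsc_normP; exists d => // h; rewrite subr0 => hd' h0.
have := hd (h + z); rewrite addrK => /(_ hd') hh.
have h0' : 0 < normc h.
  by rewrite lt_neqAle normc_ge0 andbT eq_sym; apply: contra h0 => /eqP/eq0_normc ->.
have -> : h^-1 *: (g (h *: (1 : C^o) + z) - g z) - l = (g (h + z) - (g z + l * h)) / h.
  by rewrite /GRing.scale /= mulr1; field.
rewrite normcM normcV ltr_pdivrMr //; nra.
Qed.

Definition cexp z : C :=
  (expR (complex.Re z))%:C%C * Complex (cos (complex.Im z)) (sin (complex.Im z)).

Lemma cexpD z w : cexp (z + w) = cexp z * cexp w.
Proof.
rewrite /cexp !raddfD /= expRD sinD cosD; simpc.
by apply/eqP; rewrite eq_complex /=; apply/andP; split; apply/eqP; ring.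
Qed.

Lemma cexp0 : cexp 0 = 1.
Proof. by rewrite /cexp /= expR0 cos0 sin0 mulr1. Qed.

Lemma normc_cexp z : normc (cexp z) = expR (complex.Re z).
Proof.
by rewrite /cexp normcM normc_real ger0_norm ?expR_ge0 // /normc cos2Dsin2 sqrtr1 mulr1.
Qed.

(** The derivative at 0 is assembled from those of [expR], [cos] and [sin]; by [cexpD]
    differentiability at this one point spreads to the whole plane. *)
Lemma cexp_approx0 (e : R) : 0 < e -> exists2 d : R, 0 < d &
  forall u : C, normc u < d -> normc (cexp u - (1 + u)) <= e * normc u.
Proof.
(* The real and the imaginary part each cost 3 e1 |u|, in total at most 6/8 of the allowance. *)
move=> e0; pose e1 := Num.min (e / 8) 1.
have e10 : 0 < e1 by rewrite lt_min; apply/andP; split; lra.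
have e1e : e1 <= e / 8 by rewrite ge_min lexx.
have e11 : e1 <= 1 by rewrite ge_min lexx orbT.
have [d1 d10 h1] := is_derive_approx (is_derive_expR (0 : R)) e10.
have [d2 d20 h2] := is_derive_approx (is_derive_sin (0 : R)) e10.
have [d3 d30 h3] := is_derive_approx (is_derive_cos (0 : R)) e10.
pose d := Num.min (Num.min d1 d2) (Num.min d3 (e1 / 2)).
have [a1 a2 a3 a4] : [/\ d <= d1, d <= d2, d <= d3 & d <= e1 / 2].
  by rewrite /d !ge_min !lexx ?orbT.
exists d; first by rewrite !lt_min d10 d20 d30 /=; lra.
move=> u ud; apply: le_trans (normc_le_ReIm _) _.
have := Re_le_normc u; have := Im_le_normc u; move: ud (normc_ge0 u); move: (normc u) => N.
rewrite /cexp; case: u => x y /= ud N0 hy hx.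
have {}h1 := h1 x ltac:(lra); have {}h2 := h2 y ltac:(lra); have {}h3 := h3 y ltac:(lra).
move: h1 h2 h3; rewrite !add0r expR0 sin0 cos0 oppr0 mul0r subr0 mul1r => h1 h2 h3.
rewrite addr0 mul1r in h2.
have c1 : `|cos y| <= 1 by rewrite ler_norml cos_geN1 cos_le1.
have E1 : expR x * cos y - 0 * sin y - (1 + x) = (expR x - 1 - x) * cos y + (1 + x) * (cos y - 1).
  by ring.
have E2 : expR x * sin y + 0 * cos y - y = ((expR x - 1 - x) + x) * sin y + (sin y - y).
  by ring.
have hxd : `|x| <= e1 / 2 by lra.
have hs : `|sin y| <= 2 * `|y|.
  have := ler_normD (sin y - y) y; rewrite subrK => k.
  have : e1 * `|y| <= `|y| by rewrite ler_piMl // normr_ge0.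
  lra.
have b1 : `|expR x * cos y - 0 * sin y - (1 + x)| <= e1 * N + 2 * (e1 * N).
  rewrite E1; apply: le_trans (ler_normD _ _) _; rewrite !normrM; apply: lerD.
    apply: le_trans (_ : e1 * `|x| * 1 <= _); first by apply: ler_pM.
    by rewrite mulr1 ler_pM2l.
  apply: ler_pM => //; last by apply: le_trans h3 _; rewrite ler_pM2l.
  by apply: le_trans (ler_normD _ _) _; rewrite normr1; lra.
have b2 : `|expR x * sin y + 0 * cos y - y| <= 2 * (e1 * N) + e1 * N.
  rewrite E2; apply: le_trans (ler_normD _ _) _; apply: lerD; last first.
    by apply: le_trans h2 _; rewrite ler_pM2l.
  rewrite normrM; apply: (@le_trans _ _ (e1 * (2 * N))); last by rewrite mulrCA.
  apply: ler_pM => //; last by lra.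
  apply: le_trans (ler_normD _ _) _.
  have : e1 * `|x| <= `|x| by rewrite ler_piMl // normr_ge0.
  lra.
have : e1 * N <= e / 8 * N by rewrite ler_wpM2r.
by have := mulr_ge0 (ltW e0) N0; lra.
Qed.

Lemma cdif_cexpM (k : C) z : cdif (fun w => cexp (k * w)) z.
Proof.
apply: (@cdif_of_approx _ _ (k * cexp (k * z))) => e e0.
pose A := normc (cexp (k * z)); pose K := normc k + 1.
have K0 : 0 < K by rewrite ltr_wpDl ?normc_ge0.
have A0 : 0 < A by rewrite /A normc_cexp expR_gt0.
have [d d0 hd] := @cexp_approx0 (e / (A * K)) ltac:(by rewrite divr_gt0 // mulr_gt0).
exists (d / K); first by rewrite divr_gt0.
move=> w wz.
have -> : cexp (k * w) - (cexp (k * z) + k * cexp (k * z) * (w - z)) =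
    cexp (k * z) * (cexp (k * (w - z)) - (1 + k * (w - z))).
  have {1}-> : k * w = k * z + k * (w - z) by ring.
  by rewrite cexpD; ring.
have nk : normc (k * (w - z)) <= K * normc (w - z).
  by rewrite normcM ler_wpM2r ?normc_ge0 // lerDl.
rewrite normcM -/A; have := hd (k * (w - z)).
have -> // : normc (k * (w - z)) < d.
  by apply: le_lt_trans nk _; rewrite mulrC -ltr_pdivlMr.
move=> /(_ isT) h; apply: (@le_trans _ _ (A * (e / (A * K) * (K * normc (w - z))))).
  by rewrite ler_pM2l //; apply: le_trans h _; rewrite ler_pM2l // divr_gt0 // mulr_gt0.
by rewrite le_eqVlt; apply/orP; left; apply/eqP; field; rewrite !gt_eqF.
Qed.

Lemma cdif_continuous g z : cdif g z -> {for z, continuous (g : C^o -> C^o)}.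
Proof. by move=> /derivable1_diffP; exact: differentiable_continuous. Qed.

Definition cpow a z : C := cexp ((ln a)%:C%C * z).

Lemma cpowD a z w : cpow a (z + w) = cpow a z * cpow a w.
Proof. by rewrite /cpow mulrDr cexpD. Qed.

Lemma cpow0 a : cpow a 0 = 1.
Proof. by rewrite /cpow mulr0 cexp0. Qed.

Lemma cpow1 a : 0 < a -> cpow a 1 = a%:C%C.
Proof.
by move=> a0; rewrite /cpow mulr1 /cexp /= lnK // cos0 sin0 mulr1.
Qed.

Lemma normc_cpow a z : normc (cpow a z) = expR (ln a * complex.Re z).
Proof. by rewrite /cpow normc_cexp; case: z => x y /=; rewrite mul0r subr0. Qed.

Lemma conj_cpow a z : (cpow a z)^*%C = cpow a z^*%C.
Proof.
rewrite /cpow /cexp; case: z => x y /=; rewrite !mul0r !subr0 !addr0 mulrN sinN cosN.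
by apply/eqP; rewrite eq_complex /=; apply/andP; split; apply/eqP; ring.
Qed.

Lemma holstrip_cpow a : holstrip (cpow a).
Proof.
apply: (@holstrip_intro _ _ (expR `|ln a|)).
- move=> z hz; rewrite normc_cpow ler_expR; case: z hz => x y; rewrite /strip /= => hx.
  apply: le_trans (ler_norm _) _; rewrite normrM ler_piMr ?normr_ge0 // ler_norml.
  by apply/andP; split; lra.
- by move=> z _; apply: cdif_continuous; exact: cdif_cexpM.
- by move=> z _; exact: cdif_cexpM.
Qed.

(** Stated separately, since composition with z -> 1 - z is not among the closure properties of
    [holstrip]; a^(1-z) is a constant times exp (- z ln a). *)
Lemma holstrip_cpow_onem a : holstrip (fun z => cpow a (1 - z)).
Proof.
have -> : (fun z => cpow a (1 - z)) = (fun z => cpow a 1 * cexp (- (ln a)%:C%C * z)).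
  by apply/funext => z; rewrite cpowD /cpow mulrN mulNr.
apply: holstripM; first exact: holstrip_cst.
apply: (@holstrip_intro _ _ (expR `|ln a|)).
- move=> z hz; rewrite normc_cexp ler_expR; case: z hz => x y; rewrite /strip /= => hx.
  rewrite oppr0 mul0r subr0.
  apply: le_trans (ler_norm _) _; rewrite normrM normrN ler_piMr ?normr_ge0 // ler_norml.
  by apply/andP; split; lra.
- by move=> z _; apply: cdif_continuous; exact: cdif_cexpM.
- by move=> z _; exact: cdif_cexpM.
Qed.

End ComplexPower.

Reserved Notation "A ^H" (at level 8, format "A ^H").

(** * Hilbert-Schmidt norms and completely bounded norms *)

Section HilbertSchmidt.
Context {R : realType}.
Local Notation C := R[i].
Local Notation "A ^H" := (map_mx Num.conj A^T).

(** Lagrange's identity: the difference of the two sides is half of the sum of the squares (a_i b_j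
    - a_j b_i)^2. *)
Lemma cauchy_real (I : finType) (a b : I -> R) :
  (\sum_i a i * b i) ^+ 2 <= (\sum_i a i ^+ 2) * (\sum_i b i ^+ 2).
Proof.
rewrite -subr_ge0.
have -> : (\sum_i a i ^+ 2) * (\sum_i b i ^+ 2) - (\sum_i a i * b i) ^+ 2 =
    \sum_i \sum_j (a i * b j - a j * b i) ^+ 2 / 2.
  pose f i j := a i ^+ 2 * b j ^+ 2 / 2.
  have -> : \sum_i \sum_j (a i * b j - a j * b i) ^+ 2 / 2 =
      \sum_i \sum_j (f i j + f j i) - \sum_i \sum_j (a i * b i) * (a j * b j).
    rewrite -sumrB; apply: eq_bigr => i _; rewrite -sumrB; apply: eq_bigr => j _.
    by rewrite /f; field.
  rewrite expr2 !big_distrlr /=; congr (_ - _).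
  have -> : \sum_i \sum_j (f i j + f j i) = \sum_i \sum_j f i j + \sum_i \sum_j f j i.
    by rewrite -big_split; apply: eq_bigr => i _; rewrite big_split.
  rewrite [X in _ = _ + X]exchange_big /= -big_split; apply: eq_bigr => i _.
  by rewrite -big_split; apply: eq_bigr => j _; rewrite /f /=; field.
by apply: sumr_ge0 => i _; apply: sumr_ge0 => j _; rewrite divr_ge0 ?sqr_ge0.
Qed.

Lemma cauchy_fin (I : finType) (a b : I -> C) :
  normc (\sum_i a i * b i) <=
  Num.sqrt (\sum_i normc (a i) ^+ 2) * Num.sqrt (\sum_i normc (b i) ^+ 2).
Proof.
apply: le_trans (normc_sum _ _ _) _; under eq_bigr => i _ do rewrite normcM.
rewrite -sqrtrM; last by apply: sumr_ge0 => i _; exact: sqr_ge0.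
rewrite -[X in X <= _]ger0_norm; last first.
  by apply: sumr_ge0 => i _; rewrite mulr_ge0 ?normc_ge0.
by rewrite -sqrtr_sqr ler_wsqrtr // cauchy_real.
Qed.

(** The squared Hilbert-Schmidt norm, with norm [hn] and inner product [hs], linear in the first
    argument. For columns these are the Euclidean notions, so one set of lemmas serves vectors and
    matrices. *)
Definition nsq p q (X : 'M[C]_(p, q)) : R := \sum_i \sum_j normc (X i j) ^+ 2.
Definition hn p q (X : 'M[C]_(p, q)) : R := Num.sqrt (nsq X).
Definition hs p q (X Y : 'M[C]_(p, q)) : C := \tr (X *m Y^H).

Lemma nsq_ge0 p q (X : 'M[C]_(p, q)) : 0 <= nsq X.
Proof. by apply: sumr_ge0 => i _; apply: sumr_ge0 => j _; exact: sqr_ge0. Qed.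

Lemma hn_ge0 p q (X : 'M[C]_(p, q)) : 0 <= hn X.
Proof. exact: sqrtr_ge0. Qed.

Lemma sqr_hn p q (X : 'M[C]_(p, q)) : hn X ^+ 2 = nsq X.
Proof. by rewrite sqr_sqrtr ?nsq_ge0. Qed.

Lemma hsE p q (X Y : 'M[C]_(p, q)) : hs X Y = \sum_i \sum_j X i j * (Y i j)^*.
Proof.
by rewrite /hs /mxtrace; apply: eq_bigr => i _; rewrite mxE; apply: eq_bigr => j _; rewrite !mxE.
Qed.

Lemma mulr_conj (z : C) : z * z^* = (normc z ^+ 2)%:C%C.
Proof. by rewrite normc_sq; case: z => a b; simpc; congr Complex; ring. Qed.

Lemma hs_nsq p q (X : 'M[C]_(p, q)) : hs X X = (nsq X)%:C%C.
Proof.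
rewrite hsE /nsq rmorph_sum; apply: eq_bigr => i _; rewrite rmorph_sum.
by apply: eq_bigr => j _; rewrite mulr_conj.
Qed.

Lemma normc_conjE (z : C) : normc z^* = normc z.
Proof. exact: normc_conj. Qed.

Lemma hs_cauchy p q (X Y : 'M[C]_(p, q)) : normc (hs X Y) <= hn X * hn Y.
Proof.
rewrite hsE pair_bigA /=; apply: le_trans (cauchy_fin _ _) _.
rewrite le_eqVlt; apply/orP; left; apply/eqP; congr (Num.sqrt _ * Num.sqrt _).
  by rewrite /nsq pair_bigA.
by rewrite /nsq pair_bigA /=; apply: eq_bigr => i _; rewrite normc_conjE.
Qed.

Lemma adjM p q r (A : 'M[C]_(p, q)) (B : 'M[C]_(q, r)) : (A *m B)^H = B^H *m A^H.
Proof. by rewrite trmx_mul map_mxM. Qed.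

Lemma adjK p q (A : 'M[C]_(p, q)) : (A^H)^H = A.
Proof. by apply/matrixP => i j; rewrite !mxE conjCK. Qed.

Lemma adjD p q (A B : 'M[C]_(p, q)) : (A + B)^H = A^H + B^H.
Proof. by rewrite linearD map_mxD. Qed.

Lemma adjN p q (A : 'M[C]_(p, q)) : (- A)^H = - A^H.
Proof. by rewrite linearN map_mxN. Qed.

Lemma adjZ p q (c : C) (A : 'M[C]_(p, q)) : (c *: A)^H = c^* *: A^H.
Proof. by rewrite linearZ map_mxZ. Qed.

Lemma adj0 p q : (0 : 'M[C]_(p, q))^H = 0.
Proof. by rewrite trmx0 map_mx0. Qed.

Lemma adj1 p : (1%:M : 'M[C]_p)^H = 1%:M.
Proof. by rewrite trmx1 map_mx1. Qed.

Lemma adj_sum p q (I : finType) (F : I -> 'M[C]_(p, q)) :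
  (\sum_i F i)^H = \sum_i (F i)^H.
Proof.
elim/big_ind2: _; first exact: adj0.
  by move=> x1 x2 y1 y2 <- <-; rewrite adjD.
by [].
Qed.

Lemma hsDl p q (X Y Z : 'M[C]_(p, q)) : hs (X + Y) Z = hs X Z + hs Y Z.
Proof. by rewrite /hs mulmxDl mxtraceD. Qed.

Lemma hsZl p q c (X Z : 'M[C]_(p, q)) : hs (c *: X) Z = c * hs X Z.
Proof. by rewrite /hs -scalemxAl mxtraceZ. Qed.

Lemma hsNl p q (X Z : 'M[C]_(p, q)) : hs (- X) Z = - hs X Z.
Proof. by rewrite -scaleN1r hsZl mulN1r. Qed.

Lemma hs0l p q (Z : 'M[C]_(p, q)) : hs 0 Z = 0.
Proof. by rewrite /hs mul0mx mxtrace0. Qed.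

Lemma hsC p q (X Y : 'M[C]_(p, q)) : hs X Y = (hs Y X)^*.
Proof.
rewrite !hsE rmorph_sum; apply: eq_bigr => i _; rewrite rmorph_sum.
by apply: eq_bigr => j _; rewrite /= rmorphM /= conjCK mulrC.
Qed.

Lemma hsDr p q (X Y Z : 'M[C]_(p, q)) : hs X (Y + Z) = hs X Y + hs X Z.
Proof. by rewrite hsC hsDl rmorphD /= -!hsC. Qed.

Lemma hsZr p q c (X Z : 'M[C]_(p, q)) : hs X (c *: Z) = c^* * hs X Z.
Proof. by rewrite hsC hsZl rmorphM /= -hsC. Qed.

Lemma hsNr p q (X Z : 'M[C]_(p, q)) : hs X (- Z) = - hs X Z.
Proof. by rewrite hsC hsNl rmorphN /= -hsC. Qed.

Lemma hs0r p q (Z : 'M[C]_(p, q)) : hs Z 0 = 0.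
Proof. by rewrite hsC hs0l; apply: rmorph0. Qed.

Lemma hs_suml p q (I : finType) (F : I -> 'M[C]_(p, q)) Z :
  hs (\sum_i F i) Z = \sum_i hs (F i) Z.
Proof.
by elim/big_ind2: _ => //; [rewrite hs0l|move=> x1 x2 y1 y2 <- <-; rewrite hsDl].
Qed.

Lemma hs_sumr p q (I : finType) (F : I -> 'M[C]_(p, q)) Z :
  hs Z (\sum_i F i) = \sum_i hs Z (F i).
Proof.
by elim/big_ind2: _ => //; [rewrite hs0r|move=> x1 x2 y1 y2 <- <-; rewrite hsDr].
Qed.

Lemma hs_mull p q r (A : 'M[C]_(p, r)) (X : 'M[C]_(r, q)) (Y : 'M[C]_(p, q)) :
  hs (A *m X) Y = hs X (A^H *m Y).
Proof. by rewrite /hs adjM adjK -mulmxA mxtrace_mulC mulmxA. Qed.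

Lemma hs_mulr p q r (A : 'M[C]_(r, q)) (X : 'M[C]_(p, r)) (Y : 'M[C]_(p, q)) :
  hs (X *m A) Y = hs X (Y *m A^H).
Proof. by rewrite /hs adjM adjK mulmxA. Qed.

Lemma hs_adj p q (X Y : 'M[C]_(p, q)) : hs X^H Y^H = hs Y X.
Proof. by rewrite /hs adjK mxtrace_mulC. Qed.

Lemma nsq_adj p q (X : 'M[C]_(p, q)) : nsq X^H = nsq X.
Proof. by apply: complexI; rewrite -!hs_nsq hs_adj. Qed.

Lemma hn_adj p q (X : 'M[C]_(p, q)) : hn X^H = hn X.
Proof. by rewrite /hn nsq_adj. Qed.

Lemma nsqZ p q c (X : 'M[C]_(p, q)) : nsq (c *: X) = normc c ^+ 2 * nsq X.
Proof.
by apply: complexI; rewrite [RHS]rmorphM /= -!hs_nsq hsZl hsZr mulrA mulr_conj.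
Qed.

Lemma hnZ p q c (X : 'M[C]_(p, q)) : hn (c *: X) = normc c * hn X.
Proof.
by rewrite /hn nsqZ sqrtrM ?sqr_ge0 // sqrtr_sqr ger0_norm // normc_ge0.
Qed.

Lemma hnN p q (X : 'M[C]_(p, q)) : hn (- X) = hn X.
Proof. by rewrite -scaleN1r hnZ normc_opp normc1 mul1r. Qed.

Lemma hn0 p q : hn (0 : 'M[C]_(p, q)) = 0.
Proof. by rewrite -(scale0r 0) hnZ normc0 mul0r. Qed.

Lemma nsq0 p q : nsq (0 : 'M[C]_(p, q)) = 0.
Proof. by rewrite -sqr_hn hn0 expr0n. Qed.

Lemma nsqD p q (X Y : 'M[C]_(p, q)) :
  nsq (X + Y) = nsq X + nsq Y + 2 * complex.Re (hs X Y).
Proof.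
apply: complexI; rewrite -hs_nsq hsDl !hsDr !hs_nsq (hsC Y X).
case: (hs X Y) => a b; rewrite /= /Num.conj /=.
by apply/eqP; rewrite eq_complex /=; apply/andP; split; apply/eqP; lra.
Qed.

Lemma hnD p q (X Y : 'M[C]_(p, q)) : hn (X + Y) <= hn X + hn Y.
Proof.
rewrite -ler_sqr ?nnegrE ?addr_ge0 ?hn_ge0 // sqrrD !sqr_hn nsqD.
have := hs_cauchy X Y; have := ler_norm (complex.Re (hs X Y)).
have := Re_le_normc (hs X Y); lra.
Qed.

Lemma hn_sum p q (I : finType) (F : I -> 'M[C]_(p, q)) :
  hn (\sum_i F i) <= \sum_i hn (F i).
Proof.
elim/big_ind2: _ => //; first by rewrite hn0.
by move=> x1 x2 y1 y2 h1 h2; apply: le_trans (hnD _ _) (lerD h1 h2).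
Qed.

Lemma normc_le_hn p q (X : 'M[C]_(p, q)) i j : normc (X i j) <= hn X.
Proof.
rewrite -ler_sqr ?nnegrE ?hn_ge0 ?normc_ge0 // sqr_hn /nsq.
rewrite (bigD1 i) //= (bigD1 j) //= -addrA lerDl addr_ge0 //.
  by apply: sumr_ge0 => k _; exact: sqr_ge0.
by apply: sumr_ge0 => k _; apply: sumr_ge0 => l _; exact: sqr_ge0.
Qed.

Lemma hn_eq0 p q (X : 'M[C]_(p, q)) : hn X = 0 -> X = 0.
Proof.
move=> X0; apply/matrixP => i j; rewrite mxE; apply: eq0_normc.
by apply/eqP; rewrite eq_le normc_ge0 -X0 normc_le_hn.
Qed.

Lemma hn_mulmx p q r (A : 'M[C]_(p, q)) (B : 'M[C]_(q, r)) :
  hn (A *m B) <= hn A * hn B.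
Proof.
rewrite -ler_sqr ?nnegrE ?mulr_ge0 ?hn_ge0 // exprMn !sqr_hn /nsq.
rewrite [X in _ <= _ * X]exchange_big /= big_distrlr /=.
apply: ler_sum => i _; apply: ler_sum => j _; rewrite mxE.
rewrite -[X in _ <= X]sqr_sqrtr; last first.
  by rewrite mulr_ge0 // sumr_ge0 // => k _; exact: sqr_ge0.
rewrite ler_sqr ?nnegrE ?normc_ge0 ?sqrtr_ge0 // sqrtrM; last first.
  by rewrite sumr_ge0 // => k _; exact: sqr_ge0.
exact: cauchy_fin.
Qed.

End HilbertSchmidt.

(** * Operator norms of matrices and block matrices *)

Section OperatorNorm.
Context {R : realType}.
Local Notation C := R[i].
Local Notation "A ^H" := (map_mx Num.conj A^T).

Lemma l2normE n (v : 'cV[C]_n) : l2norm v = hn v.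
Proof. by rewrite /l2norm /hn /nsq; congr Num.sqrt; apply: eq_bigr => i _; rewrite big_ord1. Qed.

Lemma opnorm_le p q (A : 'M[C]_(p, q)) (c : R) : 0 <= c ->
  (forall v : 'cV_q, hn (A *m v) <= c * hn v) -> opnorm A <= c.
Proof.
move=> c0 hA; apply: ge_sup.
  by exists (l2norm (A *m (0 : 'cV_q))); exists 0 => //=; rewrite l2normE hn0.
move=> _ [v /= hv <-]; rewrite !l2normE in hv *; apply: le_trans (hA v) _.
by rewrite ler_piMr.
Qed.

Lemma opnorm_has_ub p q (A : 'M[C]_(p, q)) :
  has_ubound [set l2norm (A *m v) | v in [set v | l2norm v <= 1]].
Proof.
exists (hn A) => _ [v /= hv <-]; rewrite !l2normE in hv *.
by apply: le_trans (hn_mulmx _ _) _; rewrite ler_piMr ?hn_ge0.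
Qed.

Lemma opnorm_ge0 p q (A : 'M[C]_(p, q)) : 0 <= opnorm A.
Proof.
apply: ub_le_sup; first exact: opnorm_has_ub.
by exists 0; rewrite /= ?mulmx0 l2normE hn0.
Qed.

Lemma opnorm_ge p q (A : 'M[C]_(p, q)) (v : 'cV_q) : hn (A *m v) <= opnorm A * hn v.
Proof.
have [v0|v0] := eqVneq (hn v) 0.
  by rewrite (hn_eq0 v0) mulmx0 !hn0 mulr0.
have vp : 0 < hn v by rewrite lt_neqAle eq_sym v0 hn_ge0.
rewrite -ler_pdivrMr //.
have -> : hn (A *m v) / hn v = l2norm (A *m (((hn v)^-1)%:C%C *: v)).
  rewrite l2normE -scalemxAr hnZ normc_real ger0_norm 1?mulrC //.
  by rewrite invr_ge0 hn_ge0.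
apply: ub_le_sup; first exact: opnorm_has_ub.
exists (((hn v)^-1)%:C%C *: v) => //=.
by rewrite l2normE hnZ normc_real ger0_norm ?invr_ge0 ?hn_ge0 // mulVf.
Qed.

Lemma opnorm_leP p q (A : 'M[C]_(p, q)) (c : R) : 0 <= c ->
  opnorm A <= c <-> (forall v : 'cV_q, nsq (A *m v) <= c ^+ 2 * nsq v).
Proof.
move=> c0; split=> [h v|h].
  rewrite -!sqr_hn -exprMn ler_sqr ?nnegrE ?mulr_ge0 ?hn_ge0 //.
  by apply: le_trans (opnorm_ge _ _) _; rewrite ler_wpM2r ?hn_ge0.
apply: opnorm_le => // v.
by rewrite -ler_sqr ?nnegrE ?mulr_ge0 ?hn_ge0 // exprMn !sqr_hn.
Qed.

Definition blk k p q (A : 'I_k -> 'I_k -> 'M[C]_(p, q)) : 'M[C]_(\sum_(i < k) p, \sum_(j < k) q) :=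
  \mxblock_(i < k, j < k) A i j.

Lemma nsq_mxcol k n (v : 'I_k -> 'cV[C]_n) : nsq (\mxcol_i v i) = \sum_i nsq (v i).
Proof.
have adjcol : (\mxcol_i v i)^H = \mxrow_i (v i)^H.
  by apply/matrixP => i j; rewrite !mxE.
apply: complexI; rewrite -hs_nsq -hs_adj /hs adjK adjcol mul_mxrow_mxcol.
rewrite raddf_sum rmorph_sum; apply: eq_bigr => i _ /=.
by rewrite -hs_nsq -hs_adj /hs adjK.
Qed.

Lemma opnorm_blkP k p q (A : 'I_k -> 'I_k -> 'M[C]_(p, q)) (c : R) : 0 <= c ->
  opnorm (blk A) <= c <->
  (forall v : 'I_k -> 'cV_q, \sum_s nsq (\sum_t A s t *m v t) <= c ^+ 2 * \sum_t nsq (v t)).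
Proof.
move=> c0; rewrite opnorm_leP //; split=> [h v|h w].
  by have := h (\mxcol_i v i); rewrite mul_mxblock_mxrow !nsq_mxcol.
by rewrite -(submxcolK w) mul_mxblock_mxrow !nsq_mxcol.
Qed.

Lemma opnorm_blkZ k p q (A : 'I_k -> 'I_k -> 'M[C]_(p, q)) (c : C) :
  opnorm (blk (fun i j => c *: A i j)) = normc c * opnorm (blk A).
Proof.
have Z (B : 'I_k -> 'I_k -> 'M[C]_(p, q)) (d : C) :
    opnorm (blk (fun i j => d *: B i j)) <= normc d * opnorm (blk B).
  apply/opnorm_blkP; first by rewrite mulr_ge0 ?normc_ge0 ?opnorm_ge0.
  move=> v; have /opnorm_blkP h := lexx (opnorm (blk B)).
  have {}h := h (opnorm_ge0 _) v.
  under eq_bigr => s _ do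
    (under eq_bigr => t _ do rewrite -scalemxAl; rewrite -scaler_sumr nsqZ).
  by rewrite -mulr_sumr exprMn -[X in _ <= X]mulrA ler_wpM2l ?sqr_ge0.
apply/eqP; rewrite eq_le Z /=.
have [->|c0] := eqVneq c 0; first by rewrite normc0 mul0r opnorm_ge0.
have nc : 0 < normc c.
  by rewrite lt_neqAle normc_ge0 andbT eq_sym; apply: contra c0 => /eqP/eq0_normc ->.
have := Z (fun i j => c *: A i j) c^-1.
have -> : (fun i j : 'I_k => c^-1 *: (c *: A i j)) = A.
  by apply/funext => i; apply/funext => j; rewrite scalerA mulVf // scale1r.
by rewrite normcV -ler_pdivrMl ?invr_gt0 // invrK.
Qed.

Lemma opnorm_blk1 p q (A : 'M[C]_(p, q)) : opnorm (blk (fun _ _ : 'I_1 => A)) = opnorm A.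
Proof.
have E c : 0 <= c -> opnorm (blk (fun _ _ : 'I_1 => A)) <= c <-> opnorm A <= c.
  move=> c0; rewrite opnorm_blkP // opnorm_leP //; split=> h v.
    by have := h (fun=> v); rewrite !big_ord1.
  by rewrite !big_ord1.
by apply/eqP; rewrite eq_le; apply/andP; split; apply/E; rewrite ?opnorm_ge0.
Qed.

Lemma normc_le_opnorm p q (A : 'M[C]_(p, q)) i j : normc (A i j) <= opnorm A.
Proof.
have := opnorm_ge A (delta_mx j 0).
have -> : hn (delta_mx j 0 : 'cV[C]_q) = 1.
  rewrite /hn /nsq (bigD1 j) //= big_ord1 mxE !eqxx normc1 expr1n.
  by rewrite big1 ?addr0 ?sqrtr1 // => k /negbTE kj; rewrite big_ord1 mxE kj normc0 expr0n.
rewrite mulr1 -colE => h; apply: le_trans h.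
by have := normc_le_hn (col j A) i 0; rewrite mxE.
Qed.

End OperatorNorm.

(** * Completely bounded norms of maps between matrix algebras *)

Section CompletelyBounded.
Context {R : realType}.
Local Notation C := R[i].

Lemma cbnorm_Mn_ge0 p q (u : 'M[C]_p -> 'M[C]_q) :
  (0 <= cbnorm (Mn_norms R p) (Mn_norms R q) u)%E.
Proof.
apply: (@le_trans _ _ (Mn_norms R q 1 (map_mx u (\matrix_(i, j) 0)))).
  by rewrite lee_fin opnorm_ge0.
apply: ereal_sup_ubound; exists 1%N, (\matrix_(i, j) 0); split => //.
rewrite lee_fin /Mn_norms -/(blk _) (@opnorm_blkP R) //.
move=> v; under eq_bigr => s _ do
  (under eq_bigr => t _ do rewrite mxE mul0mx; rewrite big1_eq nsq0).
rewrite big1_eq mulr_ge0 ?sqr_ge0 //; apply: sumr_ge0 => *; exact: nsq_ge0.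
Qed.

Lemma cbnorm_MnP p q (u : 'M[C]_p -> 'M[C]_q) (c : R) :
  (forall a x, u (a *: x) = a *: u x) -> 0 <= c ->
  (cbnorm (Mn_norms R p) (Mn_norms R q) u <= c%:E)%E <->
  (forall k (A : 'I_k -> 'I_k -> 'M[C]_p), (0 < k)%N ->
     opnorm (blk (fun i j => u (A i j))) <= c * opnorm (blk A)).
Proof.
move=> uZ c0; split=> [h k A k0|h]; last first.
  apply: ge_ereal_sup => _ [k [A [k0 A1 ->]]].
  rewrite lee_fin /Mn_norms.
  have -> : \mxblock_(i, j) (map_mx u A) i j = blk (fun i j => u (A i j)).
    by congr mxblock; apply/funext => i; apply/funext => j; rewrite mxE.
  apply: le_trans (h k _ k0) _; rewrite ler_piMr //.
apply/ler_addgt0Pr => e e0.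
(* Normalisation divides by N + d, as N may be 0; the price c d is at most e. *)
pose N := opnorm (blk A); pose d := e / (c + 1).
have d0 : 0 < d by rewrite divr_gt0 //; lra.
have N0 : 0 <= N := opnorm_ge0 _.
have Nd : 0 < N + d by lra.
have Ndi : 0 <= (N + d)^-1 by rewrite invr_ge0 ltW.
pose a : C := ((N + d)^-1)%:C%C.
have na : normc a = (N + d)^-1 by rewrite /a normc_real ger0_norm.
have : (Mn_norms R q k (map_mx u (\matrix_(i, j) (a *: A i j))) <= c%:E)%E.
  apply: le_trans h; apply: ereal_sup_ubound; exists k, (\matrix_(i, j) (a *: A i j)).
  split=> //; rewrite lee_fin /Mn_norms.
  have -> : \mxblock_(i, j) (\matrix_(i, j) (a *: A i j)) i j = blk (fun i j => a *: A i j).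
    by congr mxblock; apply/funext => i; apply/funext => j; rewrite mxE.
  by rewrite opnorm_blkZ na -/N mulrC ler_pdivrMr // mul1r; lra.
rewrite lee_fin /Mn_norms.
have -> : \mxblock_(i, j) (map_mx u (\matrix_(i, j) (a *: A i j))) i j =
    blk (fun i j => a *: u (A i j)).
  by congr mxblock; apply/funext => i; apply/funext => j; rewrite !mxE uZ.
rewrite opnorm_blkZ na mulrC ler_pdivrMr // => h1; apply: le_trans h1 _.
rewrite -/N mulrDr lerD2l /d mulrA ler_pdivrMr; last lra.
have : 0 <= c * e by rewrite mulr_ge0 // ltW.
lra.
Qed.

End CompletelyBounded.

(** * The maps a -> sum x_i a y_i *)

Section TensorMaps.
Context {R : realType}.
Local Notation C := R[i].
Local Notation "A ^H" := (map_mx Num.conj A^T).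

Definition bilin p q (V : lmodType C) (b : 'M[C]_p -> 'M[C]_q -> V) : Prop :=
  (forall x, linear (b x)) /\ (forall y, linear (b^~ y)).

Lemma tens_lift_sum p q (V : lmodType C) (b : 'M[C]_p -> 'M[C]_q -> V)
    (I : finType) (x : I -> 'M[C]_p) (y : I -> 'M[C]_q) : bilin b ->
  tens_lift b (\sum_i x i *t y i) = \sum_i b (x i) (y i).
Proof.
move=> [br bl].
have t0 : tens_lift b 0 = 0.
  by have := tens_lift_linear b (-1) 0 0; rewrite scaler0 addr0 scaleN1r addNr.
have tD u v : tens_lift b (u + v) = tens_lift b u + tens_lift b v.
  by have := tens_lift_linear b 1 u v; rewrite !scale1r.
have -> : tens_lift b (\sum_i x i *t y i) = \sum_i tens_lift b (x i *t y i).
  by elim/big_ind2: _ => // u1 u2 v1 v2 <- <-; rewrite tD.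
by apply: eq_bigr => i _; exact: tens_lift_tens.
Qed.

Lemma tens_rep p q (u : 'M[C]_(p * q)) :
  exists m (x : 'I_m -> 'M[C]_p) (y : 'I_m -> 'M[C]_q), u = \sum_(i < m) x i *t y i.
Proof.
pose T : finType := ('I_p * 'I_p * ('I_q * 'I_q))%type.
pose X (t : T) : 'M[C]_p := u (mxtens_index (t.1.1, t.2.1)) (mxtens_index (t.1.2, t.2.2)) *: delta_mx t.1.1 t.1.2.
pose Y (t : T) : 'M[C]_q := delta_mx t.2.1 t.2.2.
exists #|T|, (X \o enum_val), (Y \o enum_val).
have -> : \sum_(i < #|T|) (X \o enum_val) i *t (Y \o enum_val) i = \sum_t X t *t Y t.
  by rewrite [RHS](reindex (enum_val : 'I_#|T| -> T)) //=; apply/onW_bij/enum_val_bij.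
rewrite {1}(tens_span u).
under eq_bigr => i _ do under eq_bigr => j _ do rewrite pair_bigA /=.
rewrite pair_bigA /= pair_bigA /=; apply: eq_bigr => -[[i j] [k l]] _.
by apply/matrixP => a c; rewrite /X /Y /= !mxE mulrA.
Qed.

Lemma bilin_sandwich n : bilin (@sandwich R n).
Proof.
split=> [z c u v|z c u v]; apply/lfunP => w.
  by rewrite add_lfunE scale_lfunE !sandwichE mulmxDr -scalemxAr.
by rewrite add_lfunE scale_lfunE !sandwichE !mulmxDl -!scalemxAl.
Qed.

Lemma Phi_sumE n (I : finType) (x y : I -> 'M[C]_n) (a : 'M[C]_n) :
  Phi (\sum_i x i *t y i) a = \sum_i x i *m a *m y i.
Proof.
rewrite /Phi (tens_lift_sum _ _ (bilin_sandwich n)) sum_lfunE.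
by apply: eq_bigr => i _; rewrite sandwichE.
Qed.

(** The easy half of Haagerup's description of the cb norm: the hypotheses say sum x_i x_i^H <= a
    and sum y_i^H y_i <= b, and the map factors as a row times an amplification of the argument
    times a column. *)
Lemma norm_cbMn_Phi_le n m (x y : 'I_m -> 'M[C]_n) (a b : R) : 0 <= a -> 0 <= b ->
  (forall v : 'cV[C]_n, \sum_i nsq ((x i)^H *m v) <= a * nsq v) ->
  (forall v : 'cV[C]_n, \sum_i nsq (y i *m v) <= b * nsq v) ->
  (norm_cbMn (Phi (\sum_i x i *t y i)) <= (Num.sqrt (a * b))%:E)%E.
Proof.
move=> a0 b0 hx hy; apply/cbnorm_MnP; [by move=> c z; rewrite linearZ|exact: sqrtr_ge0|].
move=> k A k0.
have -> : blk (fun i j => Phi (\sum_i x i *t y i) (A i j)) =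
    blk (fun s t => \sum_i x i *m A s t *m y i).
  by congr mxblock; apply/funext => s; apply/funext => t; exact: Phi_sumE.
set N := opnorm (blk A); have N0 : 0 <= N := opnorm_ge0 _.
have /opnorm_blkP hA := lexx N; have {}hA := hA N0.
apply/opnorm_blkP; first by rewrite mulr_ge0 ?sqrtr_ge0.
(* With w the image vector and W its squared norm, moving x_i to the other side of <w, w> and
   applying Cauchy-Schwarz gives W^2 <= (N^2 b V)(a W); then W is cancelled. *)
move=> v; pose w s := \sum_t (\sum_i x i *m A s t *m y i) *m v t.
rewrite exprMn sqr_sqrtr ?mulr_ge0 //; set V := \sum_t nsq (v t).
set W := \sum_s _; have W0 : 0 <= W by apply: sumr_ge0 => *; exact: nsq_ge0.
pose X (p : 'I_m * 'I_k) := \sum_t A p.2 t *m (y p.1 *m v t).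
pose Y (p : 'I_m * 'I_k) := (x p.1)^H *m w p.2.
have WE : W%:C%C = \sum_p hs (X p) (Y p).
  rewrite -(pair_bigA _ (fun i s => hs (X (i, s)) (Y (i, s)))) /= exchange_big /=.
  rewrite /W rmorph_sum; apply: eq_bigr => s _ /=; rewrite -hs_nsq.
  have wE : w s = \sum_i x i *m X (i, s).
    rewrite /w /X /=.
    transitivity (\sum_t \sum_i x i *m A s t *m y i *m v t).
      by apply: eq_bigr => t _; rewrite mulmx_suml.
    rewrite exchange_big /=; apply: eq_bigr => i _; rewrite mulmx_sumr.
    by apply: eq_bigr => t _; rewrite !mulmxA.
  rewrite -[LHS]/(hs (w s) (w s)) {1}wE hs_suml; apply: eq_bigr => i _.
  by rewrite /Y /= -hs_mull.
have WX : W <= \sum_p hn (X p) * hn (Y p).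
  rewrite -[X in X <= _](ger0_norm W0) -normc_real WE.
  by apply: le_trans (normc_sum _ _ _) _; apply: ler_sum => p _; exact: hs_cauchy.
have sX : \sum_p hn (X p) ^+ 2 <= N ^+ 2 * (b * V).
  under eq_bigr => p _ do rewrite sqr_hn.
  rewrite -(pair_bigA _ (fun i s => nsq (X (i, s)))) /=.
  apply: (@le_trans _ _ (\sum_i N ^+ 2 * \sum_t nsq (y i *m v t))).
    by apply: ler_sum => i _; exact: (hA (fun t => y i *m v t)).
  rewrite -mulr_sumr exchange_big /= ler_wpM2l ?sqr_ge0 // /V mulr_sumr.
  by apply: ler_sum => t _; exact: hy.
have sY : \sum_p hn (Y p) ^+ 2 <= a * W.
  under eq_bigr => p _ do rewrite sqr_hn.
  rewrite -(pair_bigA _ (fun i s => nsq (Y (i, s)))) /= exchange_big /=.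
  by rewrite /W mulr_sumr; apply: ler_sum => s _; exact: (hx (w s)).
have W2 : W ^+ 2 <= (N ^+ 2 * (b * V)) * (a * W).
  apply: (@le_trans _ _ ((\sum_p hn (X p) * hn (Y p)) ^+ 2)).
    by rewrite ler_sqr ?nnegrE // (le_trans W0).
  apply: le_trans (cauchy_real _ _) _; apply: ler_pM => //.
    by apply: sumr_ge0 => *; exact: sqr_ge0.
  by apply: sumr_ge0 => *; exact: sqr_ge0.
have [->|Wn] := eqVneq W 0.
  rewrite !mulr_ge0 ?sqr_ge0 //.
  by apply: sumr_ge0 => *; exact: nsq_ge0.
have Wp : 0 < W by rewrite lt_neqAle eq_sym Wn.
rewrite -(ler_pM2r Wp) -expr2; apply: le_trans W2 _.
by rewrite le_eqVlt; apply/orP; left; apply/eqP; ring.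
Qed.

Lemma tens_adj n (I : finType) (x y : I -> 'M[C]_n) :
  (\sum_i x i *t y i)^H = \sum_i (x i)^H *t (y i)^H.
Proof. by rewrite adj_sum; apply: eq_bigr => i _; rewrite trmx_tens map_mxT. Qed.

(** The Hilbert-Schmidt adjoint of a -> sum x_i a y_i is b -> sum x_i^H b y_i^H, and the adjoint of
    a Kronecker product is the product of the adjoints. *)
Lemma hs_Phi_adj n (u : 'M[C]_(n * n)) (a b : 'M[C]_n) :
  hs (Phi u a) b = hs a (Phi (u^H) b).
Proof.
have [m [x [y uE]]] := tens_rep u.
have e1 : Phi u a = \sum_i x i *m a *m y i by rewrite uE; exact: Phi_sumE.
have e2 : Phi (u^H) b = \sum_i (x i)^H *m b *m (y i)^H.
  by rewrite uE tens_adj; exact: (Phi_sumE (fun i => (x i)^H)).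
rewrite e1 e2 hs_suml hs_sumr; apply: eq_bigr => i _.
by rewrite hs_mulr -mulmxA hs_mull mulmxA.
Qed.

End TensorMaps.

(** * The cb norm on the conjugate dual *)

Section DualNorm.
Context {R : realType}.
Local Notation C := R[i].
Local Notation "A ^H" := (map_mx Num.conj A^T).

Lemma iota_formE n (x y : 'M[C]_n) : iota_form x y = (hs x y)^*.
Proof. by rewrite /iota_form /hs map_trmx. Qed.

Lemma iota_conj_Phi n (u : 'M[C]_(n * n)) (f : dualsp 'M[C]_n) (y : 'M[C]_n) :
  ((@iota R n \o Phi u \o @iota_inv R n) f : dualsp 'M[C]_n) y = f (Phi (u^H) y).
Proof.
rewrite /= -{2}(iota_invK f); set X := iota_inv f.
have iE (a b : 'M[C]_n) : (@iota R n a : dualsp 'M[C]_n) b = (hs a b)^*.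
  by rewrite lfunE /= iota_formE.
by rewrite !iE hs_Phi_adj.
Qed.

Definition entry_form n (i j : 'I_n) (x : 'M[C]_n) : C^o := x i j.

Lemma entry_form_linear n (i j : 'I_n) : linear (entry_form i j).
Proof. by move=> a x y; rewrite /entry_form !mxE. Qed.

HB.instance Definition _ n (i j : 'I_n) := GRing.isLinear.Build C 'M[C]_n C^o *:%R
  (entry_form i j) (entry_form_linear i j).

(** Through [iota] the map becomes composition of functionals with S = Phi u^H, that is, a
    transposed map, and transposition preserves the cb norm. One inequality is submultiplicativity
    of cb norms; for the other the identity of M_n is used as a test element. *)
Lemma norm_cbconj_Phi n (u : 'M[C]_(n * n)) : (0 < n)%N ->
  norm_cbconj (Phi u) = norm_cbMn (Phi (u^H)).
Proof.
move=> n0; rewrite /norm_cbconj; set N := conj_norms _.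
set v := _ \o _ \o _; set S := Phi (u^H).
have vE k (A : 'M[conjsp (dualsp 'M[C]_n)]_k) : N k (map_mx v A) =
    cbnorm (Mn_norms R n) (Mn_norms R k)
      (fun x => \matrix_(i, j) ((A i j : dualsp 'M[C]_n) (S x) : C)).
  rewrite /N /conj_norms /dual_norms; congr cbnorm; apply/funext => x.
  by apply/matrixP => i j; rewrite !mxE iota_conj_Phi.
apply/eqP; rewrite eq_le; apply/andP; split; last first.
  (* The matrix of coordinate functionals is the identity of M_n, seen in M_n of the dual. Its norm
     is at most 1, and its image is S itself. *)
  pose A : 'M[conjsp (dualsp 'M[C]_n)]_n := \matrix_(i, j) (linfun (entry_form i j) : dualsp 'M[C]_n).
  have AE (x : 'M[C]_n) : \matrix_(i, j) ((A i j : dualsp 'M[C]_n) x : C) = x.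
    by apply/matrixP => i j; rewrite mxE mxE lfunE.
  have -> : norm_cbMn S = N n (map_mx v A).
    by rewrite vE; congr cbnorm; apply/funext => x; rewrite AE.
  apply: ereal_sup_ubound; exists n, A; split; [exact: n0| |reflexivity].
  rewrite /N /conj_norms /dual_norms.
  have -> : (fun x : 'M[C]_n => \matrix_(i, j) ((A i j : dualsp 'M[C]_n) x : C)) = id.
    by apply/funext => x; rewrite AE.
  by apply/cbnorm_MnP => // k B k0; rewrite mul1r.
have S0 : (0 <= norm_cbMn S)%E := cbnorm_Mn_ge0 _.
have [->|Sfin] := eqVneq (norm_cbMn S) +oo%E; first by rewrite leey.
have E : (fine (norm_cbMn S))%:E = norm_cbMn S.
  by apply: fineK; rewrite fin_numE Sfin andbT; apply: contraTneq S0 => ->.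
rewrite -E in S0 *; move: S0; rewrite lee_fin; set c := fine _ => c0; apply: ge_ereal_sup => _ [k [A [k0 A1 ->]]].
rewrite vE; apply/cbnorm_MnP => //.
  by move=> a x; rewrite linearZ; apply/matrixP => i j; rewrite !mxE linearZ.
move=> l B l0.
have gZ a (x : 'M[C]_n) : \matrix_(i, j) ((A i j : dualsp 'M[C]_n) (a *: x) : C) =
    a *: \matrix_(i, j) ((A i j : dualsp 'M[C]_n) x : C).
  by apply/matrixP => i j; rewrite !mxE linearZ.
have /cbnorm_MnP := A1; move=> /(_ gZ ler01) /(_ l (fun i j => S (B i j)) l0).
rewrite mul1r => h; apply: le_trans h _.
have : (norm_cbMn S <= c%:E)%E by rewrite /c E.
by move=> /cbnorm_MnP; apply => // a x; rewrite linearZ.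
Qed.

End DualNorm.

(** * Functionals dual to the two cb norms *)

Section ContractiveForms.
Context {R : realType}.
Local Notation C := R[i].
Local Notation "A ^H" := (map_mx Num.conj A^T).

Lemma bilin_suml p q (V : lmodType C) (b : 'M[C]_p -> 'M[C]_q -> V) (I : finType)
    (c : I -> C) (x : I -> 'M[C]_p) y : bilin b ->
  b (\sum_i c i *: x i) y = \sum_i c i *: b (x i) y.
Proof.
move=> [_ bl]; have b0 : b 0 y = 0.
  by have := bl y (-1) 0 0; rewrite scaler0 addr0 scaleN1r addNr.
have bD u v : b (u + v) y = b u y + b v y by have := bl y 1 u v; rewrite !scale1r.
rewrite (big_morph (b^~ y) bD b0); apply: eq_bigr => i _.
by have := bl y (c i) (x i) 0; rewrite !addr0 b0 addr0.
Qed.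

Lemma bilin_sumr p q (V : lmodType C) (b : 'M[C]_p -> 'M[C]_q -> V) (I : finType)
    (c : I -> C) x (y : I -> 'M[C]_q) : bilin b ->
  b x (\sum_i c i *: y i) = \sum_i c i *: b x (y i).
Proof.
move=> [br bl]; have : bilin (fun y x => b x y) by split.
exact: bilin_suml.
Qed.

Lemma matrix_sum_pair p q (X : 'M[C]_(p, q)) :
  X = \sum_(t : 'I_p * 'I_q) X t.1 t.2 *: delta_mx t.1 t.2.
Proof. by rewrite {1}(matrix_sum_delta X) pair_bigA. Qed.

Definition contractive_form n (b : 'M[C]_n -> 'M[C]_n -> C^o) : Prop :=
  bilin b /\ forall X Y, normc (b X Y) <= hn X * hn Y.

(* The form b as an operator on l_2^n (x) l_2^n, cut into n x n blocks. *)
Definition form_blk n (b : 'M[C]_n -> 'M[C]_n -> C^o) (s t : 'I_n) : 'M[C]_n :=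
  \matrix_(i, j) b (delta_mx s i) (delta_mx j t).

Lemma form_blk_sum n (b : 'M[C]_n -> 'M[C]_n -> C^o) (X Y : 'M[C]_n) : bilin b ->
  \sum_s \sum_t (X *m form_blk b s t *m Y) s t = b X Y.
Proof.
move=> bb; rewrite {2}(matrix_sum_pair X) (bilin_suml _ _ _ bb).
rewrite -(pair_bigA _ (fun s i => X s i *: b (delta_mx s i) Y)) /=; apply: eq_bigr => s _.
transitivity (\sum_t \sum_i \sum_j X s i * (form_blk b s t i j * Y j t)).
  apply: eq_bigr => t _; rewrite -mulmxA mxE; apply: eq_bigr => i _.
  by rewrite mxE mulr_sumr.
rewrite exchange_big /=; apply: eq_bigr => i _.
rewrite {2}(matrix_sum_pair Y) (bilin_sumr _ _ _ bb) scaler_sumr.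
rewrite exchange_big /= pair_bigA /=; apply: eq_bigr => -[j t] _ /=.
by rewrite mxE /GRing.scale /= [b _ _ * _]mulrC.
Qed.

(** If Z is the image of V under the block operator, then b at the entrywise conjugate of Z and V
    equals |Z|^2; contractivity bounds this by |Z| |V|. *)
Lemma opnorm_form_blk n (b : 'M[C]_n -> 'M[C]_n -> C^o) :
  contractive_form b -> opnorm (blk (form_blk b)) <= 1.
Proof.
move=> [bb bc]; apply/opnorm_blkP => // v.
pose V : 'M[C]_n := \matrix_(j, t) v t j 0.
have VE : \sum_t nsq (v t) = nsq V.
  rewrite /nsq [RHS]exchange_big /=; apply: eq_bigr => t _; apply: eq_bigr => j _.
  by rewrite big_ord1 mxE.
pose Z : 'M[C]_n := \matrix_(s, i) b (delta_mx s i) V.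
have ZE : \sum_s nsq (\sum_t form_blk b s t *m v t) = nsq Z.
  rewrite /nsq; apply: eq_bigr => s _; apply: eq_bigr => i _; rewrite big_ord1.
  rewrite mxE (matrix_sum_pair V) (bilin_sumr _ _ _ bb) summxE.
  rewrite -(pair_bigA _ (fun j t => V j t *: b (delta_mx s i) (delta_mx j t))) exchange_big /=.
  congr (normc _ ^+ 2); apply: eq_bigr => t _; rewrite mxE; apply: eq_bigr => j _.
  by rewrite !mxE /GRing.scale /= mulrC.
rewrite ZE VE expr1n mul1r.
pose X : 'M[C]_n := map_mx Num.conj Z.
have nX : nsq X = nsq Z.
  by rewrite /nsq; apply: eq_bigr => s _; apply: eq_bigr => i _; rewrite mxE normc_conjE.
have bXV : b X V = (nsq Z)%:C%C.
  rewrite (matrix_sum_pair X) (bilin_suml _ _ _ bb) /nsq pair_bigA rmorph_sum /=.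
  apply: eq_bigr => -[s i] _ /=; rewrite !mxE /GRing.scale /= mulrC.
  exact: mulr_conj.
have := bc X V; rewrite bXV normc_real ger0_norm ?nsq_ge0 // /hn nX -!/(hn _) => h.
have [Z0|Z0] := eqVneq (hn Z) 0; first by rewrite -sqr_hn Z0 expr0n nsq_ge0.
have Zp : 0 < hn Z by rewrite lt_neqAle eq_sym Z0 hn_ge0.
rewrite -!sqr_hn ler_sqr ?nnegrE ?hn_ge0 //.
by move: h; rewrite -sqr_hn expr2 ler_pM2l.
Qed.

Lemma bilin_mulmx n (b : 'M[C]_n -> 'M[C]_n -> C^o) (P1 P2 Q1 Q2 : 'M[C]_n) : bilin b ->
  bilin (fun x y => b (P1 *m x *m P2) (Q1 *m y *m Q2)).
Proof.
move=> [br bl]; split=> [x a u v|y a u v] /=.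
  by rewrite mulmxDr mulmxDl -scalemxAr -scalemxAl br.
by rewrite mulmxDr mulmxDl -scalemxAr -scalemxAl bl.
Qed.

(** The functional amplifies [Phi u] to n x n blocks, applies it to the contraction [form_blk b],
    and pairs the result with the rows of P and the columns of Q. Those vectors have total norms |P|
    and |Q|. *)
Lemma form_le_norm_cbMn n (b : 'M[C]_n -> 'M[C]_n -> C^o) (P Q : 'M[C]_n)
    (u : 'M[C]_(n * n)) (t : R) : (0 < n)%N -> contractive_form b ->
  (norm_cbMn (Phi u) <= t%:E)%E ->
  normc (tens_lift (fun x y => b (P *m x) (y *m Q)) u) <= hn P * hn Q * t.
Proof.
move=> n0 cb ht; have [bb bc] := cb.
have t0 : 0 <= t by rewrite -lee_fin; apply: le_trans (cbnorm_Mn_ge0 _) ht.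
have bb' : bilin (fun x y => b (P *m x) (y *m Q)).
  have := bilin_mulmx P 1%:M 1%:M Q bb.
  by under [X in bilin X -> _]eq_fun do under eq_fun do rewrite mulmx1 mul1mx.
pose F := \sum_s \sum_t (P *m Phi u (form_blk b s t) *m Q) s t.
have -> : tens_lift (fun x y => b (P *m x) (y *m Q)) u = F.
  have [m [x [y uE]]] := tens_rep u; rewrite /F {1}uE (tens_lift_sum _ _ bb').
  transitivity (\sum_i \sum_s \sum_t (P *m x i *m form_blk b s t *m (y i *m Q)) s t).
    by apply: eq_bigr => i _; rewrite form_blk_sum.
  rewrite exchange_big /=; apply: eq_bigr => s _.
  rewrite exchange_big /=; apply: eq_bigr => r _.
  rewrite uE Phi_sumE mulmx_sumr mulmx_suml summxE; apply: eq_bigr => i _.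
  by rewrite !mulmxA.
pose r s := \sum_t Phi u (form_blk b s t) *m col t Q.
have FE : F = \sum_s (row s P *m r s) 0 0.
  apply: eq_bigr => s _; rewrite /r mulmx_sumr summxE; apply: eq_bigr => k _.
  rewrite mulmxA -row_mul mxE [RHS]mxE; apply: eq_bigr => j _.
  by rewrite [row _ _ _ _]mxE [col _ _ _ _]mxE.
have uZ a x : Phi u (a *: x) = a *: Phi u x by rewrite linearZ.
have /cbnorm_MnP := ht; move=> /(_ uZ t0) /(_ n (form_blk b) n0) hT.
have {}hT : opnorm (blk (fun s k => Phi u (form_blk b s k))) <= t.
  by apply: le_trans hT _; rewrite ler_piMr // opnorm_form_blk.
move/(opnorm_blkP _ t0)/(_ (fun k => col k Q)): hT => hT.
have nQ : \sum_k nsq (col k Q) = nsq Q.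
  rewrite /nsq [RHS]exchange_big /=; apply: eq_bigr => k _; apply: eq_bigr => j _.
  by rewrite big_ord1 mxE.
have nP : \sum_s nsq (row s P) = nsq P.
  by rewrite /nsq; apply: eq_bigr => s _; rewrite big_ord1; apply: eq_bigr => j _; rewrite mxE.
rewrite nQ in hT.
have F1 : normc F <= \sum_s hn (row s P) * hn (r s).
  rewrite FE; apply: le_trans (normc_sum _ _ _) _; apply: ler_sum => s _.
  by apply: le_trans (normc_le_hn _ _ _) (hn_mulmx _ _).
have S0 : 0 <= \sum_s hn (row s P) * hn (r s).
  by apply: sumr_ge0 => s _; rewrite mulr_ge0 ?hn_ge0.
apply: le_trans F1 _; rewrite -ler_sqr ?nnegrE ?mulr_ge0 ?hn_ge0 //.
apply: le_trans (cauchy_real _ _) _; rewrite !exprMn !sqr_hn.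
under eq_bigr => s _ do rewrite sqr_hn.
under [X in _ * X]eq_bigr => s _ do rewrite sqr_hn.
rewrite nP -mulrA ler_wpM2l ?nsq_ge0 //; apply: le_trans hT _.
by rewrite mulrC.
Qed.

(** Taking adjoints turns right factors into left ones and u into u^H, so this is the previous
    estimate for the form b'(X, Y) = conj b(X^H, Y^H), which is again bilinear and contractive. *)
Lemma form_le_norm_cbconj n (b : 'M[C]_n -> 'M[C]_n -> C^o) (P Q : 'M[C]_n)
    (u : 'M[C]_(n * n)) (t : R) : (0 < n)%N -> contractive_form b ->
  (norm_cbconj (Phi u) <= t%:E)%E ->
  normc (tens_lift (fun x y => b (x *m P) (Q *m y)) u) <= hn P * hn Q * t.
Proof.
move=> n0 [[br bl] bc]; rewrite norm_cbconj_Phi // => ht.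
pose b' (X Y : 'M[C]_n) : C^o := (b X^H Y^H)^*.
have b'b : bilin b'.
  split=> [x a u1 v1|y a u1 v1]; rewrite /b' adjD adjZ.
    by rewrite br /GRing.scale /= rmorphD rmorphM /= conjCK.
  by rewrite bl /GRing.scale /= rmorphD rmorphM /= conjCK.
have cb' : contractive_form b'.
  by split=> // X Y; rewrite /b' normc_conjE -(hn_adj X) -(hn_adj Y); exact: bc.
have := form_le_norm_cbMn (P^H) (Q^H) n0 cb' ht; rewrite !hn_adj.
suff -> : normc (tens_lift (fun x y => b' (P^H *m x) (y *m Q^H)) u^H) =
  normc (tens_lift (fun x y => b (x *m P) (Q *m y)) u) by [].
have bb1 : bilin (fun x y => b (x *m P) (Q *m y)).
  have := bilin_mulmx 1%:M P Q 1%:M (conj br bl).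
  by under [X in bilin X -> _]eq_fun do under eq_fun do rewrite mulmx1 mul1mx.
have bb2 : bilin (fun x y => b' (P^H *m x) (y *m Q^H)).
  have := bilin_mulmx P^H 1%:M 1%:M Q^H b'b.
  by under [X in bilin X -> _]eq_fun do under eq_fun do rewrite mulmx1 mul1mx.
have [m [x [y ->]]] := tens_rep u.
rewrite tens_adj.
rewrite (tens_lift_sum _ _ bb1) (tens_lift_sum _ _ bb2).
rewrite -[RHS]normc_conjE rmorph_sum; congr normc; apply: eq_bigr => i _.
by rewrite /b' -!adjM (adjK (x i *m P)) (adjK (Q *m y i)).
Qed.

End ContractiveForms.

(** * Positive matrices and the maps b |-> sum x_i b x_i^H *)

Section PositiveMatrices.
Context {R : realType}.
Local Notation C := R[i].
Local Notation "A ^H" := (map_mx Num.conj A^T).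

Definition unitary n (U : 'M[C]_n) : Prop := U *m U^H = 1%:M /\ U^H *m U = 1%:M.

Definition udiag n (U : 'M[C]_n) (d : 'I_n -> C) : 'M[C]_n :=
  U *m diag_mx (\row_i d i) *m U^H.

Lemma udiagM n (U : 'M[C]_n) d e : unitary U ->
  udiag U d *m udiag U e = udiag U (fun i => d i * e i).
Proof.
move=> [_ UU]; rewrite /udiag -!mulmxA (mulmxA U^H) UU mul1mx (mulmxA (diag_mx _)).
by rewrite mulmx_diag; congr (_ *m (diag_mx _ *m _)); apply/rowP => i; rewrite !mxE.
Qed.

Lemma udiagD n (U : 'M[C]_n) d e : udiag U d + udiag U e = udiag U (fun i => d i + e i).
Proof.
rewrite /udiag -mulmxDl -mulmxDr -raddfD /=.
by congr (_ *m diag_mx _ *m _); apply/rowP => i; rewrite !mxE.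
Qed.

Lemma udiagZ n (U : 'M[C]_n) d c : c *: udiag U d = udiag U (fun i => c * d i).
Proof.
rewrite /udiag scalemxAl scalemxAr -linearZ /=.
by congr (_ *m diag_mx _ *m _); apply/rowP => i; rewrite !mxE.
Qed.

Lemma udiag1 n (U : 'M[C]_n) : unitary U -> udiag U (fun=> 1) = 1%:M.
Proof.
move=> [UU _]; rewrite /udiag (_ : diag_mx _ = 1%:M) ?mulmx1 //.
by apply/matrixP => i j; rewrite !mxE.
Qed.

Lemma udiag_adj n (U : 'M[C]_n) d : (udiag U d)^H = udiag U (fun i => (d i)^*).
Proof.
have E : (diag_mx (\row_i d i))^H = diag_mx (\row_i (d i)^*).
  apply/matrixP => i j; rewrite !mxE eq_sym; case: eqVneq => [->|_]; rewrite ?mulr1n ?mulr0n //.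
  exact: rmorph0.
by rewrite /udiag adjM [in X in _ *m X = _]adjM adjK E mulmxA.
Qed.

Lemma hn_unitaryl n m (U : 'M[C]_n) (X : 'M[C]_(n, m)) : unitary U -> hn (U *m X) = hn X.
Proof.
move=> [_ UU]; rewrite /hn; congr Num.sqrt; apply: complexI; rewrite -!hs_nsq.
by rewrite hs_mull mulmxA UU mul1mx.
Qed.

Lemma unitary_adj n (U : 'M[C]_n) : unitary U -> unitary U^H.
Proof. by move=> [U1 U2]; split; rewrite adjK. Qed.

Lemma hn_unitaryr n m (U : 'M[C]_n) (X : 'M[C]_(m, n)) : unitary U -> hn (X *m U) = hn X.
Proof. by move=> /unitary_adj hU; rewrite -hn_adj adjM hn_unitaryl // hn_adj. Qed.

Definition qf n (A : 'M[C]_n) (v : 'cV[C]_n) : R := complex.Re (hs (A *m v) v).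

Definition psd n (A : 'M[C]_n) : Prop := A^H = A /\ forall v, 0 <= qf A v.

Lemma qfD n (A B : 'M[C]_n) v : qf (A + B) v = qf A v + qf B v.
Proof. by rewrite /qf mulmxDl hsDl raddfD. Qed.

Lemma qfN n (A : 'M[C]_n) v : qf (- A) v = - qf A v.
Proof. by rewrite /qf mulNmx hsNl raddfN. Qed.

Lemma qfZ n (c : R) (A : 'M[C]_n) v : qf (c%:C%C *: A) v = c * qf A v.
Proof. by rewrite /qf -scalemxAl hsZl; case: (hs _ _) => a b /=; rewrite mul0r subr0. Qed.

Lemma qf1 n (v : 'cV[C]_n) : qf 1%:M v = nsq v.
Proof. by rewrite /qf mul1mx hs_nsq. Qed.

Lemma qf_conj n (x A : 'M[C]_n) v : qf (x *m A *m x^H) v = qf A (x^H *m v).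
Proof. by rewrite /qf -!mulmxA hs_mull. Qed.

Lemma qf_udiag n (U : 'M[C]_n) (d : 'I_n -> R) v :
  qf (udiag U (fun i => (d i)%:C%C)) v = \sum_i d i * normc ((U^H *m v) i 0) ^+ 2.
Proof.
rewrite /udiag qf_conj /qf; move: (U^H *m v) => w.
rewrite hsE raddf_sum; apply: eq_bigr => i _; rewrite big_ord1 mul_diag_mx !mxE.
by rewrite -mulrA mulr_conj -rmorphM.
Qed.

Lemma psd0 n : psd (0 : 'M[C]_n).
Proof. by split; [exact: adj0|move=> v; rewrite /qf mul0mx hs0l]. Qed.

Lemma psd1 n : psd (1%:M : 'M[C]_n).
Proof. by split; [exact: adj1|move=> v; rewrite qf1 nsq_ge0]. Qed.

Lemma psdD n (A B : 'M[C]_n) : psd A -> psd B -> psd (A + B).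
Proof.
by move=> [hA pA] [hB pB]; split; [rewrite adjD hA hB|move=> v; rewrite qfD addr_ge0].
Qed.

Lemma psdZ n (c : R) (A : 'M[C]_n) : 0 <= c -> psd A -> psd (c%:C%C *: A).
Proof.
move=> c0 [hA pA]; split; last by move=> v; rewrite qfZ mulr_ge0.
by rewrite adjZ hA; congr (_ *: _); rewrite /Num.conj /= oppr0.
Qed.

Lemma psd_conj n (x A : 'M[C]_n) : psd A -> psd (x *m A *m x^H).
Proof.
move=> [hA pA]; split; last by move=> v; rewrite qf_conj.
by rewrite !adjM adjK hA mulmxA.
Qed.

Lemma psd_sum n (I : finType) (F : I -> 'M[C]_n) : (forall i, psd (F i)) -> psd (\sum_i F i).
Proof.
move=> hF; elim/big_ind: _ => [|x y hx hy|i _]; [exact: psd0|exact: psdD|exact: hF].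
Qed.

Lemma spectral n (A : 'M[C]_n) : A^H = A ->
  exists U (d : 'I_n -> R), unitary U /\ A = udiag U (fun i => (d i)%:C%C).
Proof.
move=> hA.
have hH : A \is hermsymmx.
  by apply/is_hermitianmxP; rewrite expr0 scale1r; exact: esym hA.
have U1 : spectralmx A \is unitarymx := spectral_unitarymx A.
have UU : unitary (spectralmx A)^H.
  have U2 := U1; rewrite -trmxC_unitary in U2.
  move/unitarymxP: U1 => U1; move/unitarymxP: U2 => U2.
  by split; rewrite ?adjK //; move: U2; rewrite adjK.
exists (spectralmx A)^H, (fun i => complex.Re (spectral_diag A 0 i)); split=> //.
rewrite /udiag adjK.
have -> : \row_i (complex.Re (spectral_diag A 0 i))%:C%C = spectral_diag A.
  apply/rowP => i; rewrite mxE.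
  have := hermitian_spectral_diag_real hH; move=> /mxOverP /(_ 0 i).
  by case: (spectral_diag A 0 i) => a b; rewrite complex_real => /eqP /= ->.
have /orthomx_spectralP := hermitian_normalmx hH.
by rewrite invmx_unitary.
Qed.

End PositiveMatrices.

(** * Positive maps and the equations for A and B *)

Section PositiveMaps.
Context {R : realType}.
Local Notation C := R[i].
Local Notation "A ^H" := (map_mx Num.conj A^T).

Lemma psd_factor n (A : 'M[C]_n) : psd A -> exists Z : 'M[C]_n, A = Z *m Z^H.
Proof.
move=> [hA pA]; have [U [d [UU AE]]] := spectral hA.
have d0 i : 0 <= d i.
  have := pA (U *m delta_mx i 0); rewrite AE qf_udiag mulmxA (proj2 UU) mul1mx.
  rewrite (bigD1 i) //= big1 ?addr0 => [|j ji]; last first.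
    by rewrite mxE (negbTE ji) normc0 expr0n mulr0.
  by rewrite mxE !eqxx normc1 expr1n mulr1.
exists (udiag U (fun i => (Num.sqrt (d i))%:C%C)).
rewrite udiag_adj udiagM // AE; congr udiag; apply/funext => i.
by rewrite mulr_conj normc_real ger0_norm ?sqrtr_ge0 // sqr_sqrtr.
Qed.

Lemma hs_psd_ge0 n (A B : 'M[C]_n) : psd A -> psd B -> 0 <= complex.Re (hs A B).
Proof.
move=> [hA pA] /psd_factor[Z ->].
rewrite hsC hs_mulr adjK hsC conjCK.
have -> : hs (A *m Z) Z = \sum_j hs (A *m col j Z) (col j Z).
  rewrite hsE exchange_big /=; apply: eq_bigr => j _; rewrite hsE; apply: eq_bigr => i _.
  by rewrite big_ord1 colE mulmxA -!colE [in RHS]mxE [X in _ = _ * X^*]mxE.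
rewrite raddf_sum; apply: sumr_ge0 => j _; exact: pA.
Qed.

Lemma Re_hs_herm n (A B : 'M[C]_n) : A^H = A -> B^H = B -> hs A B = (complex.Re (hs A B))%:C%C.
Proof.
move=> hA hB; have : hs A B = (hs A B)^*.
  by rewrite -hsC -{1}hA -{1}hB hs_adj.
case: (hs A B) => a b [/eqP]; rewrite -addr_eq0 -mulr2n -mulr_natr mulf_eq0 pnatr_eq0 orbF.
by move=> /eqP ->.
Qed.

(** The map P_x; [cpm (adjf x)] is its Hilbert-Schmidt adjoint, see [hs_cpm]. *)
Definition cpm n m (x : 'I_m -> 'M[C]_n) (b : 'M[C]_n) : 'M[C]_n :=
  \sum_i x i *m b *m (x i)^H.

Definition adjf n m (x : 'I_m -> 'M[C]_n) : 'I_m -> 'M[C]_n := fun i => (x i)^H.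

Lemma adjfK n m (x : 'I_m -> 'M[C]_n) : adjf (adjf x) = x.
Proof. by apply/funext => i; rewrite /adjf adjK. Qed.

Lemma cpm_linear n m (x : 'I_m -> 'M[C]_n) : linear (cpm x).
Proof.
move=> c u v; rewrite /cpm scaler_sumr -big_split; apply: eq_bigr => i _ /=.
by rewrite mulmxDr mulmxDl -scalemxAr -scalemxAl.
Qed.

HB.instance Definition _ n m (x : 'I_m -> 'M[C]_n) :=
  GRing.isLinear.Build C 'M[C]_n 'M[C]_n *:%R (cpm x) (cpm_linear x).

Lemma cpmD n m (x : 'I_m -> 'M[C]_n) u v : cpm x (u + v) = cpm x u + cpm x v.
Proof. exact: linearD. Qed.

Lemma cpmB n m (x : 'I_m -> 'M[C]_n) u v : cpm x (u - v) = cpm x u - cpm x v.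
Proof. exact: linearB. Qed.

Lemma cpmZ n m (x : 'I_m -> 'M[C]_n) c u : cpm x (c *: u) = c *: cpm x u.
Proof. exact: linearZ. Qed.

Lemma hs_cpm n m (x : 'I_m -> 'M[C]_n) a b : hs (cpm x b) a = hs b (cpm (adjf x) a).
Proof.
rewrite /cpm hs_suml hs_sumr; apply: eq_bigr => i _.
by rewrite /adjf hs_mulr -mulmxA hs_mull mulmxA.
Qed.

Lemma cpm_adj n m (x : 'I_m -> 'M[C]_n) b : (cpm x b)^H = cpm x b^H.
Proof.
by rewrite /cpm adj_sum; apply: eq_bigr => i _; rewrite !adjM adjK mulmxA.
Qed.

Lemma psd_cpm n m (x : 'I_m -> 'M[C]_n) b : psd b -> psd (cpm x b).
Proof. by move=> pb; apply: psd_sum => i; exact: psd_conj. Qed.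

Lemma posneg_part n (B : 'M[C]_n) : B^H = B -> exists Bp Bn : 'M[C]_n,
  [/\ B = Bp - Bn, psd Bp, psd Bn & hs Bp Bn = 0].
Proof.
move=> /spectral[U [d [UU ->]]].
pose e := (fun i => (Num.max (d i) 0)%:C%C : C); pose f := (fun i => (Num.max (- d i) 0)%:C%C : C).
have pu (g : 'I_n -> R) : (forall i, 0 <= g i) -> psd (udiag U (fun i => (g i)%:C%C)).
  move=> g0; split.
    by rewrite udiag_adj; congr udiag; apply/funext => i; rewrite /Num.conj /= oppr0.
  by move=> v; rewrite qf_udiag; apply: sumr_ge0 => i _; rewrite mulr_ge0 ?sqr_ge0.
exists (udiag U e), (udiag U f); split.
- rewrite -scaleN1r udiagZ udiagD; congr udiag; apply/funext => i.
  rewrite /e /f mulN1r -rmorphN -rmorphD /=; congr (_%:C%C).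
  by case: (leP (d i) 0) => h; case: (leP (- d i) 0) => h'; lra.
- by apply: pu => i; rewrite le_max lexx orbT.
- by apply: pu => i; rewrite le_max lexx orbT.
- rewrite /hs udiag_adj udiagM // (_ : (fun i => _) = fun=> 0).
    rewrite /udiag (_ : diag_mx _ = 0) ?mulmx0 ?mul0mx ?mxtrace0 //.
    by apply/matrixP => i j; rewrite !mxE mul0rn.
  apply/funext => i; rewrite /e /f /Num.conj /= oppr0 -rmorphM /=.
  case/orP: (le_total (d i) 0) => h; first by rewrite (max_r h) mul0r.
  by rewrite (@max_r _ _ (- d i)) ?mulr0 // oppr_le0.
Qed.

(** No Neumann series is summed. With Q = P_x^H P_x, the map 1 - Q is injective, hence bijective in
    finite dimension, which yields B with B - Q B = 1 + P_x^H 1. Strict contractivity shows that B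
    is selfadjoint and that its negative part is 0. *)
Lemma cp_resolvent n m (x : 'I_m -> 'M[C]_n) (s : R) : 0 <= s < 1 ->
  (forall b, nsq (cpm x b) <= s ^+ 2 * nsq b) ->
  exists A B : 'M[C]_n, [/\ psd A, psd B, A = 1%:M + cpm x B & B = 1%:M + cpm (adjf x) A].
Proof.
move=> /andP[s0 s1] hs2.
have arith (a b c d : R) : 0 <= a -> 0 <= b -> - c = a + (b - d) -> c <= d by lra.
pose Q b := cpm (adjf x) (cpm x b).
have s2 : s ^+ 2 < 1 by rewrite expr_lt1.
have contr b : nsq b <= nsq (cpm x b) -> b = 0.
  move=> h; apply: hn_eq0; apply/eqP; rewrite /hn sqrtr_eq0.
  have := hs2 b; have := nsq_ge0 b; nra.
pose L : 'End('M[C]_n) := (\1 - linfun (cpm (adjf x) \o cpm x))%VF.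
have LE b : L b = b - Q b.
  by rewrite /L add_lfunE opp_lfunE id_lfunE lfunE.
have hsQ b : hs (Q b) b = (nsq (cpm x b))%:C%C.
  by rewrite /Q hs_cpm adjfK hs_nsq.
have L0 : lker L == 0%VS.
  rewrite -subv0; apply/subvP => b; rewrite memv_ker LE subr_eq0 => /eqP bQ.
  suff -> : b = 0 by rewrite mem0v.
  apply: contr; have := hsQ b; rewrite -bQ hs_nsq => /complexI ->; exact: lexx.
pose D := 1%:M + cpm (adjf x) 1%:M.
have [B BE] : exists B, B - Q B = D.
  by exists ((L^-1)%VF D); rewrite -LE lker0_lfunVK.
have pD : psd D by apply: psdD; [exact: psd1|exact/psd_cpm/psd1].
have QB : B = D + Q B by rewrite -BE subrK.
have hB : B^H = B.
  apply/eqP; rewrite -subr_eq0; apply/eqP; apply: contr.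
  have E : B^H - B = Q (B^H - B).
    have -> : Q (B^H - B) = Q B^H - Q B by rewrite /Q !linearB.
    have -> : Q B^H = (Q B)^H by rewrite /Q !cpm_adj.
    by rewrite {1}QB adjD (proj1 pD) {2}QB opprD addrACA subrr add0r.
  by have := hsQ (B^H - B); rewrite -E hs_nsq => /complexI ->; exact: lexx.
have [Bp [Bn [Bpn pBp pBn Bo]]] := posneg_part hB.
(* Pairing B = D + Q B with the negative part gives -|Bn|^2 = <D, Bn> + <Q Bp, Bn> - |P_x Bn|^2. The
   first two terms are nonnegative, so |Bn| <= |P_x Bn|, which forces Bn = 0. *)
have Bn0 : Bn = 0.
  apply: contr.
  have e1 : complex.Re (hs B Bn) = - nsq Bn by rewrite Bpn hsDl hsNl Bo add0r hs_nsq.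
  have e2 : complex.Re (hs (Q B) Bn) = complex.Re (hs (Q Bp) Bn) - nsq (cpm x Bn).
    have -> : Q B = Q Bp - Q Bn by rewrite Bpn /Q !linearB.
    have ReB (z w : C) : complex.Re (z - w) = complex.Re z - complex.Re w by case: z; case: w.
    by rewrite hsDl hsNl hsQ ReB.
  have h1 : 0 <= complex.Re (hs D Bn) by apply: hs_psd_ge0.
  have h2 : 0 <= complex.Re (hs (Q Bp) Bn).
    exact: (hs_psd_ge0 (psd_cpm _ (psd_cpm x pBp)) pBn).
  have : complex.Re (hs B Bn) = complex.Re (hs D Bn) + complex.Re (hs (Q B) Bn).
    by rewrite {1}QB hsDl raddfD.
  rewrite e1 e2; exact: arith h1 h2.
have pB : psd B by rewrite Bpn Bn0 subr0.
exists (1%:M + cpm x B), B; split; [|exact: pB|reflexivity|].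
  exact: (psdD (psd1 n) (psd_cpm x pB)).
have -> : cpm (adjf x) (1%:M + cpm x B) = cpm (adjf x) 1%:M + Q B by rewrite linearD.
by rewrite addrA -/D -QB.
Qed.

End PositiveMaps.

(** * The Schur test and the norm of P_x *)

Section SchurTest.
Context {R : realType}.
Local Notation C := R[i].
Local Notation "A ^H" := (map_mx Num.conj A^T).

(* Trace of (T - h)(T + h) >= 0. *)
Lemma nsq_le_of_psd n (T h : 'M[C]_n) : psd (T - h) -> psd (T + h) -> nsq h <= nsq T.
Proof.
move=> p1 p2; have := hs_psd_ge0 p1 p2.
rewrite hsDl !hsDr !hsNl (hsC h T) !hs_nsq.
have arith (a b c d : R) : 0 <= a + c + (- c - b) -> b <= a by lra.
by case: (hs T h) => a b /=; exact: arith.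
Qed.

Lemma qf_le_hn n (b : 'M[C]_n) v : `|qf b v| <= hn b * nsq v.
Proof.
rewrite /qf; apply: le_trans (Re_le_normc _) _; apply: le_trans (hs_cauchy _ _) _.
rewrite -sqr_hn expr2 mulrA ler_wpM2r ?hn_ge0 //; exact: hn_mulmx.
Qed.

Lemma realZ_adj n (c : R) (A : 'M[C]_n) : (c%:C%C *: A)^H = c%:C%C *: A^H.
Proof. by rewrite adjZ; congr (_ *: _); rewrite /Num.conj /= oppr0. Qed.

(** Log-convexity makes the ratios of consecutive terms nondecreasing. If the first ratio exceeded
    r, the sequence would outgrow every multiple of r^k. *)
Lemma iter_log_convex (a : nat -> R) (r K : R) : (forall k, 0 <= a k) -> 0 <= r ->
  (forall k, a k.+1 ^+ 2 <= a k * a k.+2) -> (forall k, a k <= K * r ^+ k) ->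
  a 1%N <= r * a 0%N.
Proof.
move=> a0 r0 ac aK; rewrite leNgt; apply/negP => h.
have a10 : 0 < a 1%N by apply: le_lt_trans h; rewrite mulr_ge0.
have a00 : 0 < a 0%N.
  rewrite lt_neqAle a0 andbT eq_sym; apply: contraTneq (ac 0%N) => ->.
  by rewrite mul0r -ltNge exprn_gt0.
pose q := a 1%N / a 0%N.
have q0 : 0 < q by rewrite divr_gt0.
have rq : r < q by rewrite ltr_pdivlMr.
have step k : 0 < a k /\ q * a k <= a k.+1.
  elim: k => [|k [ak IH]]; first by rewrite /q divfK ?gt_eqF.
  have ak1 : 0 < a k.+1 by apply: lt_le_trans IH; rewrite mulr_gt0.
  split=> //; have := ac k => h2.
  rewrite -(ler_pM2l ak); apply: le_trans h2; rewrite expr2 mulrCA.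
  by rewrite mulrA ler_pM2r.
have low k : q ^+ k * a 0%N <= a k.
  elim: k => [|k IH]; first by rewrite expr0 mul1r.
  by rewrite exprS -mulrA; apply: le_trans (proj2 (step k)); rewrite ler_pM2l.
have K0 : 0 < K.
  have := le_trans (low 0%N) (aK 0%N); rewrite !expr0 mul1r mulr1; exact: lt_le_trans.
pose t := r / q; have t0 : 0 <= t by rewrite divr_ge0 // ltW.
have t1 : t < 1 by rewrite ltr_pdivrMr // mul1r.
have [k _ /(_ k (leqnn k)) hk] : \forall k \near \oo, t ^+ k < a 0%N / K.
  have := @cvg_expr R t ltac:(by rewrite ger0_norm).
  move=> /(@cvgrPdist_lt R R^o) /(_ (a 0%N / K) ltac:(by rewrite divr_gt0)).
  by apply: filterS => k; rewrite sub0r normrN ger0_norm // exprn_ge0.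
have := le_trans (low k) (aK k); rewrite leNgt => /negP; apply.
move: hk; rewrite /t expr_div_n ltr_pdivrMr ?exprn_gt0 // mulrAC ltr_pdivlMr //.
by rewrite mulrC [a 0%N * _]mulrC.
Qed.

(* For selfadjoint b, the iterates of Q = P^H P stay between multiples of B, so
   their norms are O(c^(2k)); log-convexity of these norms removes the constant. *)
Lemma schur_test n m (x : 'I_m -> 'M[C]_n) (A B : 'M[C]_n) (c : R) : 0 <= c ->
  psd B -> (forall v, nsq v <= qf B v) ->
  psd (c%:C%C *: A - cpm x B) -> psd (c%:C%C *: B - cpm (adjf x) A) ->
  forall b, nsq (cpm x b) <= c ^+ 2 * nsq b.
Proof.
move=> c0 pB B1 pA pB'.
have arith1 (a b k : R) : `|a| <= k -> k <= b -> 0 <= b - a /\ 0 <= b + a.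
  by rewrite ler_norml => /andP[? ?] ?; split; lra.
have half : 2^-1 + 2^-1 = 1 :> R by lra.
pose Q b := cpm (adjf x) (cpm x b).
have QD b b' : Q (b + b') = Q b + Q b' by rewrite /Q !cpmD.
have QN b : Q (- b) = - Q b by rewrite -(scaleN1r b) /Q !cpmZ scaleN1r.
have QZ (r : C) b : Q (r *: b) = r *: Q b by rewrite /Q !cpmZ.
have Qp b : psd b -> psd (Q b) by move=> pb; exact: (psd_cpm _ (psd_cpm x pb)).
have QH b : (Q b)^H = Q b^H by rewrite /Q !cpm_adj.
have Qs b b' : hs (Q b) b' = hs b (Q b') by rewrite /Q !hs_cpm adjfK.
have hsQ b : hs (Q b) b = (nsq (cpm x b))%:C%C by rewrite /Q hs_cpm adjfK hs_nsq.
(* P_x B <= c A and P_x^H A <= c B combine to Q B <= c^2 B, because P_x^H preserves positivity. *)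
have QB : psd ((c ^+ 2)%:C%C *: B - Q B).
  have := psdD (psdZ c0 pB') (psd_cpm (adjf x) pA).
  have -> : cpm (adjf x) (c%:C%C *: A - cpm x B) = c%:C%C *: cpm (adjf x) A - Q B.
    by rewrite /Q cpmB cpmZ.
  by rewrite scalerBr scalerA -rmorphM -expr2 addrA subrK.
have herm b : b^H = b -> hn (Q b) <= c ^+ 2 * hn b.
  move=> hb; pose a k := hn (iter k Q b).
  (* The induction starts from |<b v, v>| <= |b| |v|^2 <= |b| <B v, v>, where B >= 1 enters; each
     application of Q then costs a factor c^2. *)
  have pk k : psd ((hn b * (c ^+ 2) ^+ k)%:C%C *: B - iter k Q b) /\
      psd ((hn b * (c ^+ 2) ^+ k)%:C%C *: B + iter k Q b).
    elim: k => [|k [p1 p2]] /=.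
      rewrite expr0 mulr1; split; split.
      - by rewrite adjD adjN realZ_adj hb (proj1 pB).
      - move=> v; rewrite qfD qfN qfZ.
        by case: (arith1 _ _ _ (qf_le_hn b v) (ler_wpM2l (hn_ge0 b) (B1 v))).
      - by rewrite adjD realZ_adj hb (proj1 pB).
      - move=> v; rewrite qfD qfZ.
        by case: (arith1 _ _ _ (qf_le_hn b v) (ler_wpM2l (hn_ge0 b) (B1 v))).
    have t0 : 0 <= hn b * (c ^+ 2) ^+ k by rewrite mulr_ge0 ?hn_ge0 ?exprn_ge0.
    have pQ := psdZ t0 QB.
    have E : (hn b * (c ^+ 2) ^+ k.+1)%:C%C *: B =
        (hn b * (c ^+ 2) ^+ k)%:C%C *: ((c ^+ 2)%:C%C *: B - Q B) + Q ((hn b * (c ^+ 2) ^+ k)%:C%C *: B).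
      by rewrite QZ -scalerDr subrK scalerA -rmorphM exprSr mulrA.
    have next b' : psd ((hn b * (c ^+ 2) ^+ k)%:C%C *: B + b') ->
        psd ((hn b * (c ^+ 2) ^+ k.+1)%:C%C *: B + Q b').
      by move=> pb; rewrite E -addrA -QD; exact: psdD pQ (Qp _ pb).
    by split; [rewrite -QN; exact: next|exact: next].
  apply: (@iter_log_convex a (c ^+ 2) (hn b * hn B)).
  - by move=> k; exact: hn_ge0.
  - exact: exprn_ge0.
  - move=> k; rewrite /a sqr_hn.
    have := hs_cauchy (iter k Q b) (iter k.+2 Q b).
    by rewrite /= -Qs hs_nsq normc_real ger0_norm ?nsq_ge0.
  - move=> k; have [p1 p2] := pk k; rewrite /a.
    have t0 : 0 <= hn b * (c ^+ 2) ^+ k by rewrite mulr_ge0 ?hn_ge0 ?exprn_ge0.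
    have := nsq_le_of_psd p1 p2; rewrite nsqZ normc_real ger0_norm //.
    rewrite -!sqr_hn -exprMn ler_sqr ?nnegrE ?hn_ge0 ?(mulr_ge0 t0) ?hn_ge0 //.
    by rewrite mulrAC.
have hermP b : b^H = b -> nsq (cpm x b) <= c ^+ 2 * nsq b.
  move=> hb; have := hs_cauchy (Q b) b; rewrite hsQ normc_real ger0_norm ?nsq_ge0 // => h.
  apply: le_trans h _; rewrite -sqr_hn expr2 mulrA ler_wpM2r ?hn_ge0 //.
  exact: herm.
(* A general b is b1 + i b2 with selfadjoint parts. P_x preserves selfadjointness, and the squared
   norms of u and i v add up for selfadjoint u and v. *)
move=> b; pose b1 := (2^-1)%:C%C *: (b + b^H).
pose b2 := (2^-1)%:C%C *: ('i%C *: (b^H - b)).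
have h1 : b1^H = b1 by rewrite /b1 realZ_adj adjD adjK addrC.
have h2 : b2^H = b2.
  rewrite /b2 realZ_adj adjZ adjD adjN adjK -[b^H - b]opprB scalerN.
  by rewrite (_ : ('i%C : C)^* = - 'i%C) ?scaleNr // /Num.conj /=; simpc.
have i2 : ('i%C : C) * 'i%C = -1 by simpc.
have bE : b = b1 + 'i%C *: b2.
  have two : (2^-1)%:C%C + (2^-1)%:C%C = 1 :> C by rewrite -rmorphD /= half.
  have -> : 'i%C *: b2 = (2^-1)%:C%C *: (b - b^H).
    by rewrite /b2 scalerA scalerA mulrAC i2 mulN1r scaleNr -scalerN opprB.
  rewrite /b1 -scalerDr.
  have -> : b + b^H + (b - b^H) = b + b by rewrite addrACA subrr addr0.
  by rewrite scalerDr -scalerDl two scale1r.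
have nE (u v : 'M[C]_n) : u^H = u -> v^H = v -> nsq (u + 'i%C *: v) = nsq u + nsq v.
  move=> hu hv; rewrite nsqD nsqZ hsZr (Re_hs_herm hu hv).
  rewrite /normc /Num.conj /= expr0n expr1n add0r sqrtr1 expr1n mul1r.
  by rewrite mul0r mulr0 subr0 mulr0 addr0.
clearbody b1 b2.
have e1 : cpm x b = cpm x b1 + 'i%C *: cpm x b2 by rewrite {1}bE cpmD cpmZ.
have e2 : nsq b = nsq b1 + nsq b2 by rewrite {1}bE (nE _ _ h1 h2).
have c1 : (cpm x b1)^H = cpm x b1 by rewrite cpm_adj h1.
have c2 : (cpm x b2)^H = cpm x b2 by rewrite cpm_adj h2.
rewrite e1 e2 (nE _ _ c1 c2) mulrDr; exact: lerD (hermP _ h1) (hermP _ h2).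
Qed.

(** Under the isometry that writes a matrix b as a vector, x (x) conj x becomes b -> x b x^H. *)
Lemma min_conj_norm_leP n m (x : 'I_m -> 'M[C]_n) (c : R) : 0 <= c ->
  min_conj_norm x <= c <-> (forall b, nsq (cpm x b) <= c ^+ 2 * nsq b).
Proof.
move=> c0; rewrite /min_conj_norm opnorm_leP //.
pose vec (b : 'M[C]_n) : 'cV[C]_(n * n) :=
  \col_k b (mxtens_unindex k).1 (mxtens_unindex k).2.
have reidx (W : nmodType) (F : 'I_(n * n) -> W) :
    \sum_a F a = \sum_i \sum_k F (mxtens_index (i, k)).
  rewrite pair_bigA /= (reindex (@mxtens_index n n)) /=.
    by apply: eq_bigr => -[].
  by exists (@mxtens_unindex n n) => ? _; rewrite ?mxtens_indexK ?mxtens_unindexK.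
have vecE b i j : vec b (mxtens_index (i, j)) 0 = b i j by rewrite mxE mxtens_indexK.
have nvec b : nsq (vec b) = nsq b.
  rewrite /nsq reidx; apply: eq_bigr => i _; apply: eq_bigr => j _.
  by rewrite big_ord1 vecE.
have mvec b : (\sum_(i < m) x i *t map_mx Num.conj (x i)) *m vec b = vec (cpm x b).
  rewrite mulmx_suml; apply/matrixP => k o; rewrite ord1 -(mxtens_unindexK k).
  case: (mxtens_unindex k) => i j; rewrite vecE /cpm !summxE; apply: eq_bigr => l _.
  rewrite mxE reidx mxE exchange_big /=; apply: eq_bigr => b' _.
  rewrite !mxE mulr_suml; apply: eq_bigr => a _.
  by rewrite tensmxE vecE [map_mx _ _ _ _]mxE mulrAC.
split=> [h b|h v]; first by have := h (vec b); rewrite mvec !nvec.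
have -> : v = vec (\matrix_(i, j) v (mxtens_index (i, j)) 0).
  apply/matrixP => k o; rewrite ord1 -(mxtens_unindexK k).
  by case: (mxtens_unindex k) => i j; rewrite vecE mxE.
by rewrite mvec !nvec.
Qed.

End SchurTest.

(** * The interpolation norm is at most oh *)

Section MatrixPowers.
Context {R : realType}.
Local Notation C := R[i].
Local Notation "A ^H" := (map_mx Num.conj A^T).

Definition mholstrip p q (F : C -> 'M[C]_(p, q)) : Prop :=
  forall i j, holstrip (fun z => F z i j).

Lemma mholstrip_cst p q (A : 'M[C]_(p, q)) : mholstrip (fun=> A).
Proof. by move=> i j; exact: holstrip_cst. Qed.

Lemma mholstripM p q r (F : C -> 'M[C]_(p, q)) (G : C -> 'M[C]_(q, r)) :
  mholstrip F -> mholstrip G -> mholstrip (fun z => F z *m G z).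
Proof.
move=> hF hG i j.
have -> : (fun z => (F z *m G z) i j) = fun z => \sum_k F z i k * G z k j.
  by apply/funext => z; rewrite mxE.
by apply: holstrip_sum => k _; exact: holstripM (hF i k) (hG k j).
Qed.

Lemma mholstripZ p q (c : C -> C) (F : C -> 'M[C]_(p, q)) :
  holstrip c -> mholstrip F -> mholstrip (fun z => c z *: F z).
Proof.
move=> hc hF i j; have -> : (fun z => (c z *: F z) i j) = fun z => c z * F z i j.
  by apply/funext => z; rewrite mxE.
exact: holstripM.
Qed.

Lemma mholstrip_sum p q (I : finType) (F : I -> C -> 'M[C]_(p, q)) :
  (forall k, mholstrip (F k)) -> mholstrip (fun z => \sum_k F k z).
Proof.
move=> hF i j; have -> : (fun z => (\sum_k F k z) i j) = fun z => \sum_k F k z i j.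
  by apply/funext => z; rewrite summxE.
by apply: holstrip_sum => k _; exact: hF.
Qed.

Lemma mholstrip_tens p q (F : C -> 'M[C]_p) (G : C -> 'M[C]_q) :
  mholstrip F -> mholstrip G -> mholstrip (fun z => F z *t G z).
Proof.
move=> hF hG i j.
have -> : (fun z => (F z *t G z) i j) = fun z =>
    F z (mxtens_unindex i).1 (mxtens_unindex j).1 * G z (mxtens_unindex i).2 (mxtens_unindex j).2.
  by apply/funext => z; rewrite mxE.
exact: holstripM (hF _ _) (hG _ _).
Qed.

(* M is the group z |-> A^z. *)
Record is_cpow_mx n (A : 'M[C]_n) (M : C -> 'M[C]_n) : Prop := IsCpowMx {
  cpow_mxD : forall z w, M (z + w) = M z *m M w;
  cpow_mx0 : M 0 = 1%:M;
  cpow_mx1 : M 1 = A;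
  cpow_mx_adj : forall z, (M z)^H = M z^*;
  cpow_mx_hol : mholstrip M;
  cpow_mx_hol1 : mholstrip (fun z => M (1 - z)) }.

Lemma cpow_mx_exists n (A : 'M[C]_n) : psd A -> (forall v, nsq v <= qf A v) ->
  exists M, is_cpow_mx A M.
Proof.
move=> [hA _] A1; have [U [d [UU AE]]] := spectral hA.
(* The eigenvalue is the value of the quadratic form at the unit eigenvector [U e_i], hence at least
   1. Positivity matters because [cpow] is defined through [ln]. *)
have d0 i : 0 < d i.
  have := A1 (U *m delta_mx i 0); rewrite {1}AE qf_udiag mulmxA (proj2 UU) mul1mx.
  rewrite (bigD1 i) //= big1 ?addr0 => [|j ji]; last first.
    by rewrite mxE (negbTE ji) normc0 expr0n mulr0.
  rewrite mxE !eqxx normc1 expr1n mulr1 -sqr_hn hn_unitaryl // sqr_hn.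
  rewrite /nsq (bigD1 i) //= big_ord1 mxE !eqxx normc1 expr1n => h.
  apply: lt_le_trans h; apply: ltr_wpDr => //; apply: sumr_ge0 => j _.
  by apply: sumr_ge0 => k _; exact: sqr_ge0.
have hU (g : 'I_n -> C -> C) : (forall k, holstrip (g k)) -> mholstrip (fun z => udiag U (fun k => g k z)).
  move=> hg; apply: mholstripM; last exact: mholstrip_cst.
  apply: mholstripM; first exact: mholstrip_cst.
  move=> i j; have -> : (fun z => diag_mx (\row_k g k z) i j) = fun z => (i == j)%:R * g i z.
    by apply/funext => z; rewrite !mxE mulr_natl.
  exact: (holstripM (holstrip_cst _) (hg i)).
exists (fun z => udiag U (fun i => cpow (d i) z)); split.
- by move=> z w; rewrite (udiagM _ _ UU); congr udiag; apply/funext => i; exact: cpowD.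
- rewrite -(udiag1 UU); congr udiag; apply/funext => i; exact: cpow0.
- rewrite AE; congr udiag; apply/funext => i; exact: cpow1.
- by move=> z; rewrite udiag_adj; congr udiag; apply/funext => i; exact: conj_cpow.
- by apply: hU => k; exact: holstrip_cpow.
- by apply: (hU (fun k z => cpow (d k) (1 - z))) => k; exact: holstrip_cpow_onem.
Qed.

Lemma cpow_mxN n (A : 'M[C]_n) M z : is_cpow_mx A M -> M z *m M (- z) = 1%:M.
Proof. by move=> hM; rewrite -(cpow_mxD hM) subrr (cpow_mx0 hM). Qed.

(** The condition [z + z^* = 1] means Re z = 1/2; then the adjoint of A^z times A^z is A. *)
Lemma nsq_cpow_mx_half n (A : 'M[C]_n) M z p (v : 'M[C]_(n, p)) : is_cpow_mx A M -> z + z^* = 1 ->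
  (nsq (M z *m v))%:C%C = hs (A *m v) v.
Proof.
move=> hM z1; have hA : A^H = A by rewrite -(cpow_mx1 hM) (cpow_mx_adj hM) rmorph1.
rewrite -hs_nsq hs_mull mulmxA (cpow_mx_adj hM) -(cpow_mxD hM) addrC z1 (cpow_mx1 hM).
by rewrite [RHS]hs_mull hA.
Qed.

Lemma unitary_cpow_mx n (A : 'M[C]_n) M z : is_cpow_mx A M -> z + z^* = 0 -> unitary (M z).
Proof.
move=> hM z0; have zE : z^* = - z by apply/eqP; rewrite -addr_eq0 addrC z0.
split; rewrite (cpow_mx_adj hM) zE; first exact: (cpow_mxN z hM).
by rewrite -(cpow_mxD hM) addNr (cpow_mx0 hM).
Qed.

(** With y = A^(-z) v the left side is <P_x B y, y>, the right side is <A y, y>, and P_x B <= A.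
    This turns the operator inequality into a row or column bound on the boundary of the strip. *)
Lemma cpow_mx_family_le n m (x : 'I_m -> 'M[C]_n) (A B : 'M[C]_n) M N z w :
  is_cpow_mx A M -> is_cpow_mx B N -> psd (A - cpm x B) ->
  z + z^* = 1 -> w + w^* = 1 ->
  forall v : 'cV[C]_n, \sum_i nsq (N w *m (x i)^H *m M (- z) *m v) <= nsq v.
Proof.
move=> hM hN [_ pA] z1 w1 v; pose y := M (- z) *m v.
have vE : nsq v = qf A y.
  rewrite /qf -(nsq_cpow_mx_half y hM z1) /= /y mulmxA (cpow_mxN z hM).
  by rewrite mul1mx.
have -> : \sum_i nsq (N w *m (x i)^H *m M (- z) *m v) = qf (cpm x B) y.
  rewrite /qf /cpm mulmx_suml hs_suml raddf_sum; apply: eq_bigr => i _ /=.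
  by rewrite -[RHS]/(qf _ y) qf_conj -!mulmxA -/y /qf -(nsq_cpow_mx_half _ hN w1).
by have := pA y; rewrite vE qfD qfN subr_ge0.
Qed.

End MatrixPowers.

(** * Coordinates of Phi and comparison of norms *)

Section PhiEntries.
Context {R : realType}.
Local Notation C := R[i].
Local Notation "A ^H" := (map_mx Num.conj A^T).

(** The entries of u are the entries of the images of matrix units. So Phi merely rearranges
    coordinates, which yields both its inverse and the bound of entries by the cb norm. *)
Lemma Phi_entry n (u : 'M[C]_(n * n)) (i j k l : 'I_n) :
  u (mxtens_index (i, k)) (mxtens_index (j, l)) = Phi u (delta_mx j k) i l.
Proof.
have [m [x [y ->]]] := tens_rep u.
rewrite Phi_sumE !summxE; apply: eq_bigr => t _; rewrite tensmxE.
rewrite -mulmxA mxE (bigD1 j) //= big1 ?addr0 => [|a aj]; last first.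
  by rewrite mxE big1 ?mulr0 // => b _; rewrite mxE (negbTE aj) mul0r.
congr (_ * _); rewrite mxE (bigD1 k) //= big1 ?addr0 => [|b bk].
  by rewrite mxE !eqxx mul1r.
by rewrite mxE (negbTE bk) andbF mul0r.
Qed.

Definition Phi_inv n (T : 'End('M[C]_n)) : 'M[C]_(n * n) :=
  \matrix_(r, c) T (delta_mx (mxtens_unindex c).1 (mxtens_unindex r).2)
                    (mxtens_unindex r).1 (mxtens_unindex c).2.

Lemma lfun_delta n (T : 'End('M[C]_n)) a :
  T a = \sum_(t : 'I_n * 'I_n) a t.1 t.2 *: T (delta_mx t.1 t.2).
Proof.
have -> : T a = T (\sum_(t : 'I_n * 'I_n) a t.1 t.2 *: delta_mx t.1 t.2).
  by rewrite -matrix_sum_pair.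
by rewrite linear_sum; apply: eq_bigr => t _; exact: linearZ.
Qed.

Lemma Phi_invK n : cancel (@Phi_inv n) (@Phi R n).
Proof.
move=> T; apply/lfunP => a; rewrite (lfun_delta (Phi _)) (lfun_delta T).
apply: eq_bigr => -[j k] _; congr (_ *: _).
by apply/matrixP => i l; rewrite -Phi_entry mxE !mxtens_indexK.
Qed.

Lemma PhiK n : cancel (@Phi R n) (@Phi_inv n).
Proof.
move=> u; apply/matrixP => r c; rewrite mxE -Phi_entry.
by rewrite -!surjective_pairing !mxtens_unindexK.
Qed.

Lemma nsq_delta p q i j : nsq (delta_mx i j : 'M[C]_(p, q)) = 1.
Proof.
rewrite /nsq (bigD1 i) //= (bigD1 j) //= mxE !eqxx normc1 expr1n.
rewrite big1 ?addr0 => [|l lj]; last by rewrite mxE (negbTE lj) andbF normc0 expr0n.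
rewrite big1 ?addr0 // => k ki; rewrite big1 // => l _.
by rewrite mxE (negbTE ki) normc0 expr0n.
Qed.

Lemma hn_delta p q i j : hn (delta_mx i j : 'M[C]_(p, q)) = 1.
Proof. by rewrite /hn nsq_delta sqrtr1. Qed.

Lemma entry_le_norm_cbMn n (u : 'M[C]_(n * n)) r c :
  ((normc (u r c))%:E <= norm_cbMn (Phi u))%E.
Proof.
rewrite -(mxtens_unindexK r) -(mxtens_unindexK c).
case: (mxtens_unindex r) => i k; case: (mxtens_unindex c) => j l; rewrite Phi_entry.
have t0 : (0 <= norm_cbMn (Phi u))%E := cbnorm_Mn_ge0 _.
have [->|ufin] := eqVneq (norm_cbMn (Phi u)) +oo%E; first by rewrite leey.
have E : (fine (norm_cbMn (Phi u)))%:E = norm_cbMn (Phi u).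
  by apply: fineK; rewrite fin_numE ufin andbT; apply: contraTneq t0 => ->.
rewrite -E in t0 *; set t := fine _ in E t0 *; rewrite lee_fin in t0.
rewrite lee_fin; apply: le_trans (normc_le_opnorm _ _ _) _.
have uZ a x : Phi u (a *: x) = a *: Phi u x by rewrite linearZ.
have /(cbnorm_MnP uZ t0) /(_ 1%N (fun _ _ => delta_mx j k) isT) : (norm_cbMn (Phi u) <= t%:E)%E.
  by rewrite E.
rewrite !opnorm_blk1 => h; apply: le_trans h _; rewrite ler_piMr //.
by apply: opnorm_le => // v; apply: le_trans (hn_mulmx _ _) _; rewrite hn_delta.
Qed.

(** Only the existence of some constant matters, for finiteness and continuity; the crude n^4 is the
    number of pairs of matrix units. *)
Lemma norm_cbMn_le_hn n : exists2 K : R, 0 <= K &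
  forall u : 'M[C]_(n * n), (norm_cbMn (Phi u) <= (K * hn u)%:E)%E.
Proof.
pose T : finType := ('I_n * 'I_n * ('I_n * 'I_n))%type.
exists #|T|%:R => // u.
pose X (t : T) : 'M[C]_n := u (mxtens_index (t.1.1, t.2.1)) (mxtens_index (t.1.2, t.2.2)) *: delta_mx t.1.1 t.1.2.
pose Y (t : T) : 'M[C]_n := delta_mx t.2.1 t.2.2.
have uE : u = \sum_(i < #|T|) (X \o enum_val) i *t (Y \o enum_val) i.
  have -> : \sum_(i < #|T|) (X \o enum_val) i *t (Y \o enum_val) i = \sum_t X t *t Y t.
    by rewrite [RHS](reindex (enum_val : 'I_#|T| -> T)) //=; apply/onW_bij/enum_val_bij.
  rewrite {1}(tens_span u).
  under eq_bigr => i _ do under eq_bigr => j _ do rewrite pair_bigA /=.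
  rewrite pair_bigA /= pair_bigA /=; apply: eq_bigr => -[[i j] [k l]] _.
  by apply/matrixP => a c; rewrite /X /Y /= !mxE mulrA.
have T0 : 0 <= #|T|%:R :> R by [].
have -> : #|T|%:R * hn u = Num.sqrt ((#|T|%:R * nsq u) * #|T|%:R).
  rewrite mulrAC sqrtrM ?mulr_ge0 // -expr2 sqrtr_sqr ger0_norm //.
have mulle (A : 'M[C]_n) (v : 'cV[C]_n) : nsq (A *m v) <= nsq A * nsq v.
  by rewrite -!sqr_hn -exprMn ler_sqr ?nnegrE ?mulr_ge0 ?hn_ge0 ?hn_mulmx.
rewrite {1}uE; apply: norm_cbMn_Phi_le => //; first by rewrite mulr_ge0 ?nsq_ge0.
  move=> v; rewrite -mulrA mulr_natl -[X in _ *+ X]card_ord -sumr_const.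
  apply: ler_sum => k _; apply: le_trans (mulle _ _) _.
  rewrite ler_wpM2r ?nsq_ge0 // nsq_adj /= nsqZ nsq_delta mulr1.
  by rewrite -sqr_hn ler_sqr ?nnegrE ?normc_ge0 ?hn_ge0 ?normc_le_hn.
move=> v; rewrite mulr_natl -[X in _ *+ X]card_ord -sumr_const.
by apply: ler_sum => k _; apply: le_trans (mulle _ _) _; rewrite nsq_delta mul1r.
Qed.

End PhiEntries.

(** * Calderon's space in terms of matrix entries *)

Section CalderonEntries.
Context {R : realType}.
Local Notation C := R[i].
Local Notation "A ^H" := (map_mx Num.conj A^T).

Lemma ecvg0P (T : Type) (F : set_system T) (FF : Filter F) (g : T -> \bar R) :
  (forall t, (0 <= g t)%E) ->
  (g @ F --> 0%E) <-> (forall e : R, 0 < e -> \forall t \near F, (g t < e%:E)%E).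
Proof.
move=> g0; split=> [/fine_cvgP[gf /(@cvgrPdist_lt R R^o) gl] e e0|h].
  have gle := gl e e0; apply: filterS2 gf gle => t tf.
  rewrite sub0r normrN /= ger0_norm ?fine_ge0 // => te.
  by rewrite -(fineK tf) lte_fin.
apply/fine_cvgP; split.
  apply: filterS (h 1 ltr01) => t t1; rewrite fin_numE.
  by apply/andP; split; [apply: contraTneq (g0 t) => ->|apply: contraTneq t1 => ->].
apply/(@cvgrPdist_lt R R^o) => e e0; apply: filterS (h e e0) => t te.
rewrite sub0r normrN /= ger0_norm ?fine_ge0 //.
have tf : g t \is a fin_num.
  by rewrite fin_numE; apply/andP; split; [apply: contraTneq (g0 t) => ->|apply: contraTneq te => ->].
by rewrite -lte_fin fineK.
Qed.

Lemma hn_le_entries p q (X : 'M[C]_(p, q)) (e : R) :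
  (forall i j, normc (X i j) <= e) -> hn X <= (p * q)%:R * e.
Proof.
move=> Xe; rewrite [X]matrix_sum_pair; apply: le_trans (hn_sum _) _.
apply: (@le_trans _ _ (\sum_(t : 'I_p * 'I_q) e)).
  by apply: ler_sum => t _; rewrite hnZ hn_delta mulr1.
by rewrite sumr_const card_prod !card_ord mulr_natl.
Qed.

Lemma PhiB n (u v : 'M[C]_(n * n)) : Phi (u - v) = Phi u - Phi v.
Proof. exact: linearB. Qed.

Lemma PhiZ n c (u : 'M[C]_(n * n)) : Phi (c *: u) = c *: Phi u.
Proof. exact: linearZ. Qed.

Lemma norm_cbconj_ge0 n (T : 'End('M[C]_n)) : (0 < n)%N -> (0 <= norm_cbconj T)%E.
Proof. by move=> n0; rewrite -(Phi_invK T) norm_cbconj_Phi //; exact: cbnorm_Mn_ge0. Qed.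

Lemma entry_le_norm_cbconj n (u : 'M[C]_(n * n)) r c : (0 < n)%N ->
  ((normc (u r c))%:E <= norm_cbconj (Phi u))%E.
Proof.
move=> n0; rewrite norm_cbconj_Phi //; have := entry_le_norm_cbMn u^H c r.
by rewrite !mxE normc_conjE.
Qed.

Lemma norm_couple_le_hn n : (0 < n)%N -> exists2 K : R, 0 <= K & forall u : 'M[C]_(n * n),
  (norm_cbMn (Phi u) <= (K * hn u)%:E)%E /\ (norm_cbconj (Phi u) <= (K * hn u)%:E)%E.
Proof.
move=> n0; have [K K0 hK] := norm_cbMn_le_hn (R := R) n; exists K => // u; split=> //.
by rewrite norm_cbconj_Phi //; have := hK u^H; rewrite hn_adj.
Qed.

Local Notation N0 n := (@norm_cbMn R n).
Local Notation N1 n := (@norm_cbconj R n).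

Lemma sumnorm_ge0 n (T : 'End('M[C]_n)) : (0 < n)%N -> (0 <= sumnorm (N0 n) (N1 n) T)%E.
Proof.
move=> n0; apply: le_ereal_inf_tmp => _ [a _ <-].
by rewrite adde_ge0 ?norm_cbconj_ge0 //; exact: cbnorm_Mn_ge0.
Qed.

Lemma entry_le_sumnorm n (u : 'M[C]_(n * n)) r c : (0 < n)%N ->
  ((normc (u r c))%:E <= sumnorm (N0 n) (N1 n) (Phi u))%E.
Proof.
move=> n0; apply: le_ereal_inf_tmp => _ [a _ <-].
rewrite -(Phi_invK a) -PhiB; set v := Phi_inv a.
have h0 := entry_le_norm_cbMn v r c; have h1 := entry_le_norm_cbconj (u - v) r c n0.
apply: le_trans (leeD h0 h1); rewrite -EFinD lee_fin.
clearbody v; have -> : u r c = v r c + (u - v) r c by rewrite !mxE subrKC.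
exact: normcD_le.
Qed.

Lemma sumnorm_le_hn n : (0 < n)%N -> exists2 K : R, 0 <= K & forall u : 'M[C]_(n * n),
  (sumnorm (N0 n) (N1 n) (Phi u) <= (K * hn u)%:E)%E.
Proof.
move=> n0; have [K K0 hK] := norm_couple_le_hn n0; exists K => // u.
apply: (@le_trans _ _ (norm_cbMn (Phi u) + norm_cbconj (Phi u - Phi u)%R)%E).
  by apply: ereal_inf_lbound; exists (Phi u).
have [hu _] := hK u; have [_ h0] := hK 0.
have z0 : Phi u - Phi u = Phi 0 by rewrite -PhiB subrr.
by rewrite hn0 mulr0 -z0 in h0; apply: le_trans (leeD hu h0) _; rewrite adde0.
Qed.

Lemma cvg_norm_entries n (F : set_system C) (FF : Filter F) (N : 'End('M[C]_n) -> \bar R)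
    (K : R) (g : C -> 'M[C]_(n * n)) : 0 <= K -> (forall T, (0 <= N T)%E) ->
  (forall u, (N (Phi u) <= (K * hn u)%:E)%E) ->
  (forall r c (e : R), 0 < e -> \forall t \near F, normc (g t r c) < e) ->
  N (Phi (g t)) @[t --> F] --> 0%E.
Proof.
move=> K0 N_ge0 hN hg; apply/ecvg0P => // e e0.
pose Q : R := (n * n * (n * n))%:R; pose e' := e / (K * Q + 1).
have Q0 : 0 <= Q by rewrite ler0n.
have KQ : 0 <= K * Q by rewrite mulr_ge0.
have e'0 : 0 < e' by rewrite divr_gt0 //; lra.
have := filter_forall FF (fun r => filter_forall FF (fun c => hg r c e' e'0)).
apply: filterS => t ht; apply: le_lt_trans (hN _) _; rewrite lte_fin.
have h : hn (g t) <= Q * e' by apply: hn_le_entries => i j; exact/ltW/ht.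
apply: (@le_lt_trans _ _ (K * (Q * e'))); first by rewrite ler_wpM2l.
rewrite mulrA /e' mulrCA gtr_pMr // ltr_pdivrMr; lra.
Qed.

(** In finite dimension every norm involved is bounded by a multiple of [hn], so each condition of
    [calderon_space] follows from its scalar version for the entries. Decay is asked on the two
    boundary lines only. *)
Lemma calderon_of_entries n (u : C -> 'M[C]_(n * n)) : (0 < n)%N -> mholstrip u ->
  (forall r c (e : R), 0 < e -> exists T : R, forall s t : R, s = 0 \/ s = 1 -> T <= `|t| ->
     normc (u (Complex s t) r c) < e) ->
  calderon_space (N0 n) (N1 n) (fun z => Phi (u z)).
Proof.
move=> n0 hu decay.
have [K K0 hK] := norm_couple_le_hn n0; have [K' K'0 hK'] := sumnorm_le_hn n0.
have bdy s (N : 'End('M[C]_n) -> \bar R) : s = 0 \/ s = 1 -> (forall T, (0 <= N T)%E) ->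
    (forall v, (N (Phi v) <= (K * hn v)%:E)%E) -> boundary_cond N s (fun z => Phi (u z)).
  move=> hs N_ge0 hN.
  have st t : @strip R (vline s t) by rewrite /strip /vline /=; case: hs => ->; rewrite lexx ler01.
  have cvgR (F : set_system R) (FF : Filter F) (g : R -> 'M[C]_(n * n)) :
      (forall r c (e : R), 0 < e -> \forall t \near F, normc (g t r c) < e) ->
      N (Phi (g t)) @[t --> F] --> 0%E.
    (* [cvg_norm_entries] speaks of filters on [C]; a filter on [R] is transported to the real
       axis. *)
    move=> hg; pose F' : set_system C := (fun t : R => t%:C%C) @ F.
    have FF' : Filter F' by exact: fmap_filter.
    exact: (@cvg_norm_entries n F' FF' N K (fun z => g (complex.Re z)) K0 N_ge0 hN hg).
  split.
  - by move=> t; apply: le_lt_trans (hN _) _; rewrite ltry.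
  - move=> t; under eq_fun do rewrite -PhiB; apply: cvgR => r c e e0.
    have [_ /(_ _ (st t) e e0)[d d0 hd] _] := hu r c.
    exists d => // t' /= tt'.
    rewrite !mxE; apply: hd; first exact: st.
    apply: le_lt_trans (normc_le_ReIm _) _ => /=.
    by rewrite subrr normr0 add0r distrC.
  - apply: cvgR => r c e e0; have [T hT] := decay r c e e0.
    near=> t; apply: hT => //; apply: le_trans (ler_norm _).
    by near: t; apply: nbhs_pinfty_ge; exact: num_real.
  - apply: cvgR => r c e e0; have [T hT] := decay r c e e0.
    near=> t; apply: hT => //; rewrite -normrN; apply: le_trans (ler_norm _).
    by rewrite lerNr; near: t; apply: nbhs_ninfty_le; exact: num_real.
split.
- have /choice[M hM] : forall p : 'I_(n * n) * 'I_(n * n),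
      exists M : R, forall z, @strip R z -> normc (u z p.1 p.2) <= M.
    by move=> p; have [] := hu p.1 p.2.
  exists (K' * ((n * n * (n * n))%:R * \sum_p `|M p|)) => z hz.
  apply: le_trans (hK' _) _; rewrite lee_fin ler_wpM2l //; apply: hn_le_entries => r c.
  apply: le_trans (hM (r, c) z hz) _; apply: le_trans (ler_norm _) _.
  by rewrite (bigD1 (r, c)) //= lerDl; apply: sumr_ge0.
- move=> z hz; under eq_fun do rewrite -PhiB.
  apply: (@cvg_norm_entries n _ _ _ K') => //; first by move=> T; exact: sumnorm_ge0.
  move=> r c e e0; have [_ /(_ _ hz e e0)[d d0 hd] _] := hu r c.
  by apply/nbhsc_normP; exists d => // w wz hw; rewrite !mxE; exact: hd.
- move=> z hz.
  pose L : 'M[C]_(n * n) := \matrix_(r, c) 'D_1 ((fun w => u w r c) : C^o -> C^o) z.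
  exists (Phi L).
  have -> : (fun h : C => sumnorm (N0 n) (N1 n) (h^-1 *: (Phi (u (z + h)) - Phi (u z)) - Phi L)) =
      (fun h : C => sumnorm (N0 n) (N1 n) (Phi (h^-1 *: (u (z + h) - u z) - L))).
    by apply/funext => h; rewrite PhiB PhiZ PhiB.
  apply: (@cvg_norm_entries n _ _ _ K') => //; first by move=> T; exact: sumnorm_ge0.
  move=> r c e e0; have [_ _ /(_ z hz)] := hu r c.
  move=> /(@cvgc_normP R C^o _ (dnbhs_filter (0 : C^o))) /(_ e e0).
  apply: filterS => h; rewrite /= /GRing.scale /= mulr1 !mxE [h + z]addrC.
  exact: id.
- by apply: bdy; [left|move=> T; exact: cbnorm_Mn_ge0|move=> v; case: (hK v)].
- by apply: bdy; [right|move=> T; exact: norm_cbconj_ge0|move=> v; case: (hK v)].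
Unshelve. all: by end_near. Qed.

(** Each entry is a linear functional dominated by the norm of the sum space, so boundedness,
    continuity and differentiability pass to it. *)
Lemma entries_of_calderon n (f : C -> 'End('M[C]_n)) : (0 < n)%N ->
  calderon_space (N0 n) (N1 n) f -> mholstrip (fun z => Phi_inv (f z)).
Proof.
move=> n0 [[M hM] cf df _ _] r c.
have Sge0 T := sumnorm_ge0 T n0.
have key T : ((normc (Phi_inv T r c))%:E <= sumnorm (N0 n) (N1 n) T)%E.
  by rewrite -{2}(Phi_invK T); exact: entry_le_sumnorm.
have invB (T T' : 'End('M[C]_n)) : Phi_inv (T - T') r c = Phi_inv T r c - Phi_inv T' r c.
  rewrite -{1}(Phi_invK T) -{1}(Phi_invK T') -PhiB PhiK.
  by move: (Phi_inv T) (Phi_inv T') => A B; rewrite !mxE.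
have invZ (a : C) (T : 'End('M[C]_n)) : Phi_inv (a *: T) r c = a * Phi_inv T r c.
  rewrite -{1}(Phi_invK T) -PhiZ PhiK.
  by move: (Phi_inv T) => A; rewrite mxE.
split.
- by exists M => z hz; rewrite -lee_fin; apply: le_trans (key _) (hM z hz).
- move=> z hz e e0; have /ecvg0P h := cf z hz.
  have := h (fun t => Sge0 _) e e0 => /nbhsc_normP[d d0 hd].
  exists d => // w hw wz; have := hd w wz hw => h'.
  by rewrite -lte_fin -invB; apply: le_lt_trans (key _) h'.
- move=> z hz; have [l hl] := df z hz.
  apply/cvg_ex; exists (Phi_inv l r c).
  apply/(@cvgc_normP R C^o _ (dnbhs_filter (0 : C^o))) => e e0.
  have /ecvg0P h := hl; have := h (fun t => Sge0 _) e e0.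
  apply: filterS => h1 h2; rewrite -lte_fin; apply: le_lt_trans h2.
  rewrite /= /GRing.scale /= mulr1 [h1 + z]addrC -invB -invZ -invB.
  exact: key.
Qed.

End CalderonEntries.

(** * The interpolating function *)

Section UpperBound.
Context {R : realType}.
Local Notation C := R[i].
Local Notation "A ^H" := (map_mx Num.conj A^T).
Local Notation N0 n := (@norm_cbMn R n).
Local Notation N1 n := (@norm_cbconj R n).

Lemma cp_powers n m (x : 'I_m -> 'M[C]_n) (s : R) : 0 <= s < 1 ->
  (forall b, nsq (cpm x b) <= s ^+ 2 * nsq b) ->
  exists A B M N, [/\ is_cpow_mx A M, is_cpow_mx B N, psd (A - cpm x B) & psd (B - cpm (adjf x) A)].
Proof.
move=> s01 hx; have [A [B [pA pB AE BE]]] := cp_resolvent s01 hx.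
have ge1 (D E : 'M[C]_n) : D = 1%:M + E -> psd E -> (forall v, nsq v <= qf D v) /\ psd (D - E).
  move=> -> [hE pE]; split; last by rewrite addrK; exact: psd1.
  by move=> v; rewrite qfD qf1 lerDl.
have [A1 pA1] := ge1 _ _ AE (psd_cpm x pB).
have [B1 pB1] := ge1 _ _ BE (psd_cpm _ pA).
have [M hM] := cpow_mx_exists pA A1; have [N hN] := cpow_mx_exists pB B1.
by exists A, B, M, N.
Qed.

Definition halfC : C := (2^-1)%:C%C.

Lemma halfC_double : halfC + halfC = 1.
Proof.
have h : 2^-1 + 2^-1 = 1 :> R by lra.
by rewrite /halfC -rmorphD /= h.
Qed.

Lemma sandwich_power_hol n (X A B : 'M[C]_n) M N : is_cpow_mx A M -> is_cpow_mx B N ->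
  mholstrip (fun z => M (z - halfC) *m X *m N (halfC - z)).
Proof.
move=> hM hN.
(* The group law shifts the exponents to z and 1 - z, the two for which [is_cpow_mx] supplies
   regularity. *)
have -> : (fun z => M (z - halfC) *m X *m N (halfC - z)) =
    (fun z => M z *m M (- halfC) *m X *m (N (1 - z) *m N (- halfC))).
  apply/funext => z; rewrite (cpow_mxD hM) -(cpow_mxD hN); congr (_ *m N _).
  by rewrite -halfC_double addrAC addrK.
apply: mholstripM; apply: mholstripM; try exact: mholstrip_cst.
- by apply: mholstripM; [exact: (cpow_mx_hol hM)|exact: mholstrip_cst].
- exact: (cpow_mx_hol1 hN).
Qed.

Lemma sandwich_power_hol' n (X A B : 'M[C]_n) M N : is_cpow_mx A M -> is_cpow_mx B N ->
  mholstrip (fun z => M (halfC - z) *m X *m N (z - halfC)).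
Proof.
move=> hM hN.
have -> : (fun z => M (halfC - z) *m X *m N (z - halfC)) =
    (fun z => M (1 - z) *m M (- halfC) *m X *m (N z *m N (- halfC))).
  apply/funext => z; rewrite (cpow_mxD hN) -(cpow_mxD hM); congr (M _ *m _ *m _).
  by rewrite -halfC_double addrAC addrK.
apply: mholstripM; apply: mholstripM; try exact: mholstrip_cst.
- by apply: mholstripM; [exact: (cpow_mx_hol1 hM)|exact: mholstrip_cst].
- exact: (cpow_mx_hol hN).
Qed.

Lemma halfC_line0 (t : R) : let w := halfC - vline 0 t in w + w^* = 1.
Proof.
by rewrite /halfC /vline /Num.conj /=; simpc; congr Complex; lra.
Qed.

Lemma halfC_line1 (t : R) : let w := vline 1 t - halfC in w + w^* = 1.
Proof.
by rewrite /halfC /vline /Num.conj /=; simpc; congr Complex; lra.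
Qed.

Lemma conj_sum1 (w : C) : w + w^* = 1 -> w^* + (w^*)^* = 1.
Proof. by rewrite conjCK addrC. Qed.

Lemma conj_oppB (a b : C) : - (a - b)^* = (b - a)^*.
Proof. by rewrite -rmorphN /= opprB. Qed.

(** The function of the overview is bounded but need not tend to 0 along the boundary lines; the
    factor [damp] repairs this without changing the value at 1/2, at the cost of a factor 1 + e. *)
Lemma calderon_interpolant n m (x y : 'I_m -> 'M[C]_n) (s k e : R) : (0 < n)%N ->
  0 <= s < 1 -> 0 <= k -> 0 < e ->
  (forall b, nsq (cpm x b) <= s ^+ 2 * nsq b) ->
  (forall b, nsq (cpm y b) <= s ^+ 2 * nsq b) ->
  exists2 f, calderon_space (N0 n) (N1 n) f &
    f halfC = Phi (k%:C%C *: \sum_i x i *t y i) /\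
    (calderon_norm (N0 n) (N1 n) f <= (k * (1 + e))%:E)%E.
Proof.
move=> n0 s01 k0 e0 hx hy.
pose d := Num.min 1 e.
have d0 : 0 < d by rewrite lt_min ltr01.
have d1 : d <= 1 by rewrite ge_min lexx.
have de : d <= e by rewrite ge_min lexx orbT.
have d01 : 0 <= d <= 1 by rewrite ltW.
have dle : (1 - d / 4)^-1 <= 1 + e.
  rewrite -[X in X <= _]mul1r ler_pdivrMr; last lra.
  have : d * e <= e by rewrite ger_pMl.
  lra.
have [A [B [M [N [hM hN pA pB]]]]] := cp_powers s01 hx.
have [A' [B' [M' [N' [hM' hN' pA' pB']]]]] := cp_powers s01 hy.
pose f i z := M (z - halfC) *m x i *m N (halfC - z).
pose g i z := M' (halfC - z) *m y i *m N' (z - halfC).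
pose c z := damp d z * k%:C%C.
pose G z := \sum_i f i z *t g i z.
pose F z := c z *: G z.
have hG : mholstrip G.
  apply: mholstrip_sum => i; apply: mholstrip_tens; first exact: sandwich_power_hol hM hN.
  exact: sandwich_power_hol' hM' hN'.
have hc : holstrip c by apply: holstripM; [exact: holstrip_damp|exact: holstrip_cst].
have hF : mholstrip F by exact: mholstripZ.
have st s' t : s' = 0 \/ s' = 1 -> @strip R (Complex s' t).
  by move=> hs; rewrite /strip /=; case: hs => ->; rewrite lexx ler01.
have cle z : @strip R z -> normc (c z) <= k * (1 + e).
  move=> hz; rewrite /c normcM normc_real ger0_norm // mulrC ler_wpM2l //.
  exact: le_trans (normc_damp_le_cst d01 hz) dle.
have FE z : F z = \sum_i (c z *: f i z) *t g i z.
  rewrite /F /G scaler_sumr; apply: eq_bigr => i _.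
  by apply/matrixP => a b; rewrite !mxE mulrA.
have scaled (v : 'cV[C]_n) (h : 'I_m -> 'M[C]_n) (a : C) : \sum_i nsq (h i *m v) <= nsq v ->
    \sum_i nsq ((a *: h i) *m v) <= normc a ^+ 2 * nsq v.
  move=> hh; rewrite (eq_bigr (fun i => normc a ^+ 2 * nsq (h i *m v))); last first.
    by move=> i _; rewrite -scalemxAl nsqZ.
  by rewrite -mulr_sumr ler_wpM2l ?sqr_ge0.
have same (h1 h2 : 'I_m -> 'M[C]_n) (v : 'cV[C]_n) : (forall i, h1 i = h2 i) ->
    \sum_i nsq (h1 i *m v) <= nsq v -> \sum_i nsq (h2 i *m v) <= nsq v.
  by move=> hh; under eq_bigr => i _ do rewrite hh.
have sqrt1 (a : C) : Num.sqrt (normc a ^+ 2 * 1) = normc a.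
  by rewrite mulr1 sqrtr_sqr ger0_norm ?normc_ge0.
exists (fun z => Phi (F z)); last split.
- apply: calderon_of_entries => // r q e1 e10.
  have [[K hK] _ _] := hG r q.
  pose K' := `|K| * k.
  have K'0 : 0 <= K' by rewrite mulr_ge0.
  have de1 : 0 < d * e1 by rewrite mulr_gt0.
  exists (1 + K' / (d * e1)) => s' t hs ht; set T := 1 + _ in ht.
  have hz := st s' t hs; have T1 : 1 <= T by rewrite lerDl divr_ge0 // ltW.
  rewrite mxE /c -mulrA !normcM normc_real (ger0_norm k0).
  have b1 : k * normc (G (Complex s' t) r q) <= K'.
    rewrite mulrC ler_wpM2r //; apply: le_trans (hK _ hz) _; exact: ler_norm.
  have b2 : normc (damp d (Complex s' t)) <= (d * T)^-1.
    apply: le_trans (normc_damp_le d01 hz) _ => /=.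
    have Tsq : T <= t ^+ 2 by rewrite -real_normK ?num_real // expr2; nra.
    have : d * T <= d * t ^+ 2 by rewrite ler_pM2l.
    have : 0 < d * T by rewrite mulr_gt0 //; lra.
    by move=> *; rewrite lef_pV2 ?posrE; lra.
  apply: (@le_lt_trans _ _ ((d * T)^-1 * K')).
    by apply: ler_pM; rewrite ?normc_ge0 ?mulr_ge0 ?normc_ge0.
  have T0 : 0 < T by lra.
  rewrite mulrC ltr_pdivrMr ?mulr_gt0 //.
  have -> : e1 * (d * T) = d * e1 + K' by rewrite /T; field; rewrite !gt_eqF.
  by rewrite ltrDr.
- congr Phi; rewrite /F /c damp_half mul1r; congr (_ *: _); apply: eq_bigr => i _.
  by rewrite /f /g !subrr (cpow_mx0 hM) (cpow_mx0 hN) (cpow_mx0 hM') (cpow_mx0 hN') !mul1mx !mulmx1.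
- rewrite /calderon_norm ge_max; apply/andP; split; apply: ge_ereal_sup => _ [t _ <-].
  (* On Re z = 0 the exponent 1/2 - z has real part 1/2. Then A - P_x B >= 0 bounds the row of the
     f_i, and B' - P_y^H A' >= 0 the column of the g_i. *)
  + apply: (@le_trans _ _ (normc (c (vline 0 t)))%:E); last first.
      by rewrite lee_fin; apply: cle; apply: st; left.
    rewrite -[X in (_ <= X%:E)%E]sqrt1 FE; apply: norm_cbMn_Phi_le; rewrite ?sqr_ge0 ?ler01 //.
      move=> v; have -> : normc (c (vline 0 t)) = normc (c (vline 0 t))^* by rewrite normc_conjE.
      rewrite (eq_bigr (fun i => nsq (((c (vline 0 t))^* *: (f i (vline 0 t))^H) *m v))); last first.
        by move=> i _; rewrite adjZ.
      apply: scaled; have w1 := conj_sum1 (halfC_line0 t).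
      apply: same (cpow_mx_family_le hM hN pA w1 w1 v) => i.
      rewrite /f adjM adjM (cpow_mx_adj hM) (cpow_mx_adj hN) mulmxA.
      by rewrite conj_oppB.
    move=> v; rewrite mul1r; have w1 := halfC_line0 t.
    apply: same (cpow_mx_family_le hN' hM' pB' w1 w1 v) => i.
    by rewrite /g /adjf adjK opprB.
  (* On Re z = 1 the norm is that of the adjoint tensor, so rows and columns change roles and the
     two other inequalities, for B - P_x^H A and A' - P_y B', are the ones that apply. *)
  + apply: (@le_trans _ _ (normc (c (vline 1 t)))%:E); last first.
      by rewrite lee_fin; apply: cle; apply: st; right.
    rewrite norm_cbconj_Phi // -[X in (_ <= X%:E)%E]sqrt1 FE.
    have -> : (\sum_i (c (vline 1 t) *: f i (vline 1 t)) *t g i (vline 1 t))^H =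
        \sum_i (c (vline 1 t) *: f i (vline 1 t))^H *t (g i (vline 1 t))^H.
      by rewrite adj_sum; apply: eq_bigr => i _; rewrite trmx_tens map_mxT.
    apply: norm_cbMn_Phi_le; rewrite ?sqr_ge0 ?ler01 //.
      move=> v; rewrite (eq_bigr (fun i => nsq ((c (vline 1 t) *: f i (vline 1 t)) *m v))); last first.
        by move=> i _; rewrite adjK.
      apply: scaled; have w1 := halfC_line1 t.
      apply: same (cpow_mx_family_le hN hM pB w1 w1 v) => i.
      by rewrite /f /adjf adjK opprB.
    move=> v; rewrite mul1r; have w1 := conj_sum1 (halfC_line1 t).
    apply: same (cpow_mx_family_le hM' hN' pA' w1 w1 v) => i.
    rewrite /g adjM adjM (cpow_mx_adj hM') (cpow_mx_adj hN') mulmxA.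
    by rewrite conj_oppB.
Qed.

End UpperBound.

(** * oh is at most the interpolation norm *)

Section GramForm.
Context {R : realType}.
Local Notation C := R[i].
Local Notation "A ^H" := (map_mx Num.conj A^T).

(** Bessel's inequality for an orthogonal system that may contain zero vectors: their terms drop out
    because division by 0 gives 0. *)
Lemma bessel p q m (Z : 'I_m -> 'M[C]_(p, q)) (d : 'I_m -> R) (X : 'M[C]_(p, q)) :
  (forall k l, hs (Z k) (Z l) = (d k)%:C%C *+ (k == l)) ->
  \sum_k normc (hs X (Z k)) ^+ 2 / d k <= nsq X.
Proof.
move=> hZ; set S := \sum_k _.
pose c k := hs X (Z k) * ((d k)^-1)%:C%C; pose P := \sum_k c k *: Z k.
have XP : hs X P = S%:C%C.
  rewrite hs_sumr rmorph_sum; apply: eq_bigr => k _.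
  rewrite hsZr /c rmorphM /= rmorphM /= -mulr_conj.
  rewrite mulrC mulrA; congr (_ * _).
  by rewrite /Num.conj /= oppr0.
have PP : hs P P = S%:C%C.
  rewrite {1}/P hs_suml rmorph_sum; apply: eq_bigr => k _.
  rewrite hsZl hs_sumr (bigD1 k) //= big1 ?addr0 => [|l lk]; last first.
    by rewrite hsZr hZ eq_sym (negbTE lk) mulr0n mulr0.
  rewrite hsZr hZ eqxx mulr1n /c.
  rewrite rmorphM /= rmorphM /= -mulr_conj.
  have -> : ((d k)^-1)%:C%C^* = ((d k)^-1)%:C%C by rewrite /Num.conj /= oppr0.
  have E : ((d k)^-1)%:C%C * ((d k)^-1)%:C%C * (d k)%:C%C = ((d k)^-1)%:C%C :> C.
    rewrite -!rmorphM /=; congr (_%:C%C).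
    have [->|d0] := eqVneq (d k) 0; first by rewrite mulr0 invr0.
    by rewrite mulfVK.
  by rewrite -[in RHS]E; move: (_%:C%C) (_%:C%C) (_^*) => e f g; ring.
have := nsq_ge0 (X - P).
rewrite nsqD hsNr XP -[nsq (- P)]sqr_hn hnN sqr_hn.
have -> : nsq P = S by apply: complexI; rewrite -hs_nsq PP.
rewrite raddfN /=; lra.
Qed.

(* Opposite Gram matrices G and G^T: diagonalising G yields orthogonal systems
   Z, V spanning the two families, paired by the form with diagonal d^-1. *)
Lemma gram_form n m (X Y : 'I_m -> 'M[C]_n) :
  (forall i j, hs (X i) (X j) = hs (Y j) (Y i)) ->
  exists b, contractive_form b /\ forall i, b (X i) (Y i) = (nsq (X i))%:C%C.
Proof.
move=> hG.
pose G : 'M[C]_m := \matrix_(i, j) hs (X i) (X j).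
have GH : G^H = G by apply/matrixP => i j; rewrite !mxE -hsC.
have [U [d [[UU UU'] GE]]] := spectral GH.
pose Z k := \sum_i (U i k)^* *: X i; pose V k := \sum_i U i k *: Y i.
have UGU : U^H *m G *m U = diag_mx (\row_k (d k)%:C%C).
  by rewrite GE /udiag !mulmxA UU' mul1mx -mulmxA UU' mulmx1.
have gram k l : (U^H *m G *m U) k l = (d k)%:C%C *+ (k == l) by rewrite UGU !mxE.
have gramE k l : (U^H *m G *m U) k l = \sum_i \sum_j (U i k)^* * (U j l * hs (X i) (X j)).
  rewrite mxE exchange_big; apply: eq_bigr => j _ /=.
  rewrite mxE mulr_suml; apply: eq_bigr => i _; rewrite !mxE; ring.
have ZZ k l : hs (Z k) (Z l) = (d k)%:C%C *+ (k == l).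
  rewrite -gram gramE hs_suml; apply: eq_bigr => i _; rewrite hsZl hs_sumr mulr_sumr.
  by apply: eq_bigr => j _; rewrite hsZr conjCK.
have VV k l : hs (V k) (V l) = (d k)%:C%C *+ (k == l).
  have -> : (d k)%:C%C *+ (k == l) = (d l)%:C%C *+ (l == k).
    by rewrite eq_sym; case: eqVneq => [->|].
  rewrite -gram gramE exchange_big hs_suml; apply: eq_bigr => i _ /=.
  rewrite hsZl hs_sumr mulr_sumr.
  by apply: eq_bigr => j _; rewrite hsZr -hG; ring.
have UUE i j : \sum_k U i k * (U j k)^* = (i == j)%:R.
  by have /matrixP/(_ i j) := UU; rewrite !mxE => <-; apply: eq_bigr => k _; rewrite !mxE.
have XE i : X i = \sum_k U i k *: Z k.
  transitivity (\sum_k \sum_j (U i k * (U j k)^*) *: X j); last first.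
    by apply: eq_bigr => k _; rewrite /Z scaler_sumr; apply: eq_bigr => j _; rewrite scalerA.
  rewrite exchange_big (bigD1 i) //= -scaler_suml UUE eqxx scale1r big1 ?addr0 // => j ji.
  by rewrite -scaler_suml UUE eq_sym (negbTE ji) scale0r.
have YE i : Y i = \sum_k (U i k)^* *: V k.
  transitivity (\sum_k \sum_j (U j k * (U i k)^*) *: Y j); last first.
    by apply: eq_bigr => k _; rewrite /V scaler_sumr; apply: eq_bigr => j _; rewrite scalerA mulrC.
  rewrite exchange_big (bigD1 i) //= -scaler_suml UUE eqxx scale1r big1 ?addr0 // => j ji.
  by rewrite -scaler_suml UUE (negbTE ji) scale0r.
have XZ i k : hs (X i) (Z k) = U i k * (d k)%:C%C.
  rewrite XE hs_suml (bigD1 k) //= big1 ?addr0 => [|l lk]; rewrite hsZl ZZ ?eqxx ?mulr1n //.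
  by rewrite (negbTE lk) mulr0n mulr0.
have YV i k : hs (Y i) (V k) = (U i k)^* * (d k)%:C%C.
  rewrite YE hs_suml (bigD1 k) //= big1 ?addr0 => [|l lk]; rewrite hsZl VV ?eqxx ?mulr1n //.
  by rewrite (negbTE lk) mulr0n mulr0.
(* Where [d k] is 0 its inverse is 0 too, and so are Z k and V k; nothing is lost. *)
pose b (x y : 'M[C]_n) : C^o := \sum_k hs x (Z k) * hs y (V k) * ((d k)^-1)%:C%C.
have d0 k : 0 <= d k.
  have := ZZ k k; rewrite hs_nsq eqxx mulr1n => /complexI <-; exact: nsq_ge0.
exists b; split; last first.
  move=> i; rewrite -hs_nsq {3}XE hs_sumr; apply: eq_bigr => k _.
  rewrite hsZr XZ YV; have [->|dk] := eqVneq (d k) 0; first by rewrite rmorph0 !(mulr0, mul0r).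
  have : (d k)%:C%C * ((d k)^-1)%:C%C = 1 :> C by rewrite -rmorphM /= divff.
  move: (_%:C%C) (_%:C%C) (_^*) => e f g ef.
  by rewrite -!mulrA ef mulr1; ring.
split.
  split=> [x a u v|y a u v]; rewrite /b scaler_sumr -big_split; apply: eq_bigr => k _.
    rewrite /= hsDl hsZl; move: (hs x _) (hs u _) (hs v _) (_%:C%C) => e f g h.
    by rewrite -[RHS]/(a * (e * f * h) + e * g * h); ring.
  rewrite /= hsDl hsZl; move: (hs y _) (hs u _) (hs v _) (_%:C%C) => e f g h.
  by rewrite -[RHS]/(a * (f * e * h) + g * e * h); ring.
(* The weight is shared equally between both factors, so that Cauchy-Schwarz leaves one Bessel
   inequality for Z and one for V. *)
move=> x y; pose s k : C := (Num.sqrt (d k)^-1)%:C%C.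
have ss k : s k * s k = ((d k)^-1)%:C%C.
  by rewrite /s -rmorphM /= -expr2 sqr_sqrtr ?invr_ge0.
have -> : b x y = \sum_k (hs x (Z k) * s k) * (hs y (V k) * s k).
  by apply: eq_bigr => k _; rewrite -ss mulrACA.
have bnd (W : 'I_m -> 'M[C]_n) (z : 'M[C]_n) :
    (forall k l, hs (W k) (W l) = (d k)%:C%C *+ (k == l)) ->
    Num.sqrt (\sum_k normc (hs z (W k) * s k) ^+ 2) <= hn z.
  move=> hW; rewrite /hn; apply: ler_wsqrtr.
  rewrite (eq_bigr (fun k => normc (hs z (W k)) ^+ 2 / d k)); first exact: bessel hW.
  move=> k _; rewrite normcM exprMn; congr (_ * _).
  by rewrite normc_real real_normK ?num_real // sqr_sqrtr ?invr_ge0.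
apply: le_trans (cauchy_fin _ _) _.
by apply: ler_pM; rewrite ?sqrtr_ge0 ?bnd.
Qed.

End GramForm.

(** * Three lines applied to the dual functionals *)

Section DualEstimate.
Context {R : realType}.
Local Notation C := R[i].
Local Notation "A ^H" := (map_mx Num.conj A^T).

Lemma mholstrip_bilin n (b : 'M[C]_n -> 'M[C]_n -> C^o) (F G : C -> 'M[C]_n) :
  bilin b -> mholstrip F -> mholstrip G -> holstrip (fun z => b (F z) (G z)).
Proof.
move=> bb hF hG.
have -> : (fun z => b (F z) (G z)) = fun z => \sum_(s : 'I_n * 'I_n) \sum_(t : 'I_n * 'I_n)
    F z s.1 s.2 * (G z t.1 t.2 * b (delta_mx s.1 s.2) (delta_mx t.1 t.2)).
  apply/funext => z; rewrite {1}(matrix_sum_pair (F z)) (bilin_suml _ _ _ bb).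
  apply: eq_bigr => s _; rewrite {1}(matrix_sum_pair (G z)) (bilin_sumr _ _ _ bb).
  by rewrite scaler_sumr; apply: eq_bigr => t _.
apply: holstrip_sum => s _; apply: holstrip_sum => t _; apply: holstripM; first exact: hF.
by apply: holstripM; [exact: hG|exact: holstrip_cst].
Qed.

Lemma mholstrip_tens_lift n (b : C -> 'M[C]_n -> 'M[C]_n -> C^o) (u : C -> 'M[C]_(n * n)) :
  (forall x y, holstrip (fun z => b z x y)) -> mholstrip u ->
  holstrip (fun z => tens_lift (b z) (u z)).
Proof.
move=> hb hu; rewrite /tens_lift.
do 4!apply: holstrip_sum => ? _.
by apply: holstripM; [exact: hu|exact: hb].
Qed.

Lemma tens_lift_scale n (b : 'M[C]_n -> 'M[C]_n -> C^o) (c : C) (u : 'M[C]_(n * n)) :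
  tens_lift b (c *: u) = c * tens_lift b u.
Proof.
have t0 : tens_lift b 0 = 0.
  by have := tens_lift_linear b (-1) 0 0; rewrite scaler0 addr0 scaleN1r addNr.
by have := tens_lift_linear b c u 0; rewrite t0 !addr0.
Qed.

Lemma contractive_unitary n (b : 'M[C]_n -> 'M[C]_n -> C^o) (U V U' V' : 'M[C]_n) :
  contractive_form b -> unitary U -> unitary V -> unitary U' -> unitary V' ->
  contractive_form (fun x y => b (U *m x *m V) (U' *m y *m V')).
Proof.
move=> [bb bc] hU hV hU' hV'; split; first exact: bilin_mulmx.
move=> X Y; apply: le_trans (bc _ _) _.
by rewrite (hn_unitaryr _ hV) (hn_unitaryr _ hV') (hn_unitaryl _ hU) (hn_unitaryl _ hU').
Qed.

(* On the lines Re z = 0 and Re z = 1 the imaginary powers are unitary and are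
   absorbed in the form b, which leaves b (A x) (y B') and b (x B) (A' y). *)
Lemma dual_estimate n m (x y : 'I_m -> 'M[C]_n) (A B A' B' : 'M[C]_n) (k t a : R)
    (f : C -> 'End('M[C]_n)) : (0 < n)%N ->
  [/\ psd A, psd B, psd A' & psd B'] ->
  (forall v, [/\ nsq v <= qf A v, nsq v <= qf B v, nsq v <= qf A' v & nsq v <= qf B' v]) ->
  [/\ hn A <= a, hn B <= a, hn A' <= a & hn B' <= a] ->
  (forall i j, hs (A *m x i *m B) (x j) = hs (A' *m y j *m B') (y i)) ->
  calderon_space (@norm_cbMn R n) (@norm_cbconj R n) f ->
  (calderon_norm (@norm_cbMn R n) (@norm_cbconj R n) f <= t%:E)%E ->
  f halfC = Phi (k%:C%C *: \sum_i x i *t y i) ->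
  k * complex.Re (\sum_i hs (A *m x i *m B) (x i)) <= a ^+ 2 * t.
Proof.
move=> n0 [pA pB pA' pB'] ge1 [nA nB nA' nB'] gram hf ft fh.
have [M hM] := cpow_mx_exists pA (fun v => let: And4 h _ _ _ := ge1 v in h).
have [N hN] := cpow_mx_exists pB (fun v => let: And4 _ h _ _ := ge1 v in h).
have [M' hM'] := cpow_mx_exists pA' (fun v => let: And4 _ _ h _ := ge1 v in h).
have [N' hN'] := cpow_mx_exists pB' (fun v => let: And4 _ _ _ h := ge1 v in h).
have halfK : (halfC : C)^* = halfC by rewrite /halfC /Num.conj /= oppr0.
have hs_half (D E : 'M[C]_n) K L (z w : 'M[C]_n) : is_cpow_mx D K -> is_cpow_mx E L ->
    hs (K halfC *m z *m L halfC) (K halfC *m w *m L halfC) = hs (D *m z *m E) w.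
  move=> hK hL; rewrite -(cpow_mx1 hK) -(cpow_mx1 hL) -halfC_double (cpow_mxD hK) (cpow_mxD hL).
  rewrite -!mulmxA [RHS]hs_mull (cpow_mx_adj hK) halfK !mulmxA.
  by rewrite [RHS]hs_mulr (cpow_mx_adj hL) halfK.
pose X i := M halfC *m x i *m N halfC; pose Y i := M' halfC *m y i *m N' halfC.
have XY i j : hs (X i) (X j) = hs (Y j) (Y i) 
  by rewrite (hs_half _ _ _ _ _ _ hM hN) (hs_half _ _ _ _ _ _ hM' hN') gram.
have [b [cb bXY]] := gram_form XY; have [bb _] := cb.
have a0 : 0 <= a := le_trans (hn_ge0 _) nA.
pose psi z x y := b (M (1 - z) *m x *m N z) (M' z *m y *m N' (1 - z)).
pose u z := Phi_inv (f z).
pose xi z := tens_lift (psi z) (u z).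
have hxi : holstrip xi.
  apply: mholstrip_tens_lift; last exact: entries_of_calderon n0 hf.
  move=> z w; apply: mholstrip_bilin => //.
    apply: mholstripM; last exact: (cpow_mx_hol hN).
    by apply: mholstripM; [exact: (cpow_mx_hol1 hM)|exact: mholstrip_cst].
  apply: mholstripM; last exact: (cpow_mx_hol1 hN').
  by apply: mholstripM; [exact: (cpow_mx_hol hM')|exact: mholstrip_cst].
pose bt (r : R) x y := b (M (Complex 0 (- r)) *m x *m N (Complex 0 r))
  (M' (Complex 0 r) *m y *m N' (Complex 0 (- r))).
have cbt r : contractive_form (bt r).
  have im0 s : Complex 0 s + (Complex 0 s)^* = 0 :> C by apply/eqP; rewrite eq_complex /=; apply/andP; split; apply/eqP; lra.
  by apply: contractive_unitary => //;
    [apply: (unitary_cpow_mx hM)|apply: (unitary_cpow_mx hN)|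
     apply: (unitary_cpow_mx hM')|apply: (unitary_cpow_mx hN')]; exact: im0.
have lt r : (norm_cbMn (Phi (u (Complex 0%R r))) <= t%:E)%E.
  rewrite /u Phi_invK; apply: le_trans ft; rewrite /calderon_norm le_max; apply/orP; left.
  by apply: ereal_sup_ubound; exists r.
have rt r : (norm_cbconj (Phi (u (Complex 1%R r))) <= t%:E)%E.
  rewrite /u Phi_invK; apply: le_trans ft; rewrite /calderon_norm le_max; apply/orP; right.
  by apply: ereal_sup_ubound; exists r.
have t0 : 0 <= t by rewrite -lee_fin; apply: le_trans (lt 0); exact: cbnorm_Mn_ge0.
have aa (p q : R) : 0 <= p -> 0 <= q -> p <= a -> q <= a -> p * q * t <= a ^+ 2 * t.
  by move=> p0 q0 pa qa; rewrite ler_wpM2r // expr2; exact: ler_pM.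
have eqx (g h : 'M[C]_n -> 'M[C]_n -> C^o) : (forall z w, g z w = h z w) -> g = h.
  by move=> gh; apply/funext => z; apply/funext => w.
have split1 (D : 'M[C]_n) K (z w : C) : is_cpow_mx D K -> z = 1 + w ->
    K z = D *m K w /\ K z = K w *m D.
  move=> hK ->; split; first by rewrite (cpow_mxD hK) (cpow_mx1 hK).
  by rewrite addrC (cpow_mxD hK) (cpow_mx1 hK).
have e1 r : 1 - Complex 0 r = 1 + Complex 0 (- r) :> C by apply/eqP; rewrite eq_complex /=; apply/andP; split; apply/eqP; lra.
have e2 r : 1 - Complex 1 r = Complex 0 (- r) :> C by apply/eqP; rewrite eq_complex /=; apply/andP; split; apply/eqP; lra.
have e3 r : Complex 1 r = 1 + Complex 0 r :> C by apply/eqP; rewrite eq_complex /=; apply/andP; split; apply/eqP; lra.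
have xi0 r : normc (xi (Complex 0 r)) <= a ^+ 2 * t.
  rewrite /xi (_ : psi _ = fun x y => bt r (A *m x) (y *m B')).
    apply: le_trans (form_le_norm_cbMn _ _ n0 (cbt r) (lt r)) _.
    by apply: aa; rewrite ?hn_ge0.
  apply: eqx => z w; rewrite /psi /bt.
  have [_ ->] := split1 _ _ _ _ hM (e1 r); have [-> _] := split1 _ _ _ _ hN' (e1 r).
  by rewrite !mulmxA.
have xi1 r : normc (xi (Complex 1 r)) <= a ^+ 2 * t.
  rewrite /xi (_ : psi _ = fun x y => bt r (x *m B) (A' *m y)).
    apply: le_trans (form_le_norm_cbconj _ _ n0 (cbt r) (rt r)) _.
    by apply: aa; rewrite ?hn_ge0.
  apply: eqx => z w; rewrite /psi /bt e2.
  have [-> _] := split1 _ _ _ _ hN (e3 r); have [_ ->] := split1 _ _ _ _ hM' (e3 r).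
  by rewrite !mulmxA.
have := three_lines hxi xi0 xi1; apply: le_trans.
have bpsi z : bilin (psi z) by exact: bilin_mulmx.
have half1 : 1 - halfC = halfC :> C by rewrite -halfC_double addrK.
rewrite -/halfC /xi /u fh PhiK tens_lift_scale (tens_lift_sum _ _ (bpsi halfC)).
(* At 1/2 all powers are square roots, and [bXY] gives |A^(1/2) x_i B^(1/2)|^2 = <A x_i B, x_i>. *)
have -> : \sum_i psi halfC (x i) (y i) = \sum_i hs (A *m x i *m B) (x i).
  apply: eq_bigr => i _; rewrite /psi half1.
  by have := bXY i; rewrite /X /Y => ->; rewrite -hs_nsq (hs_half _ _ _ _ _ _ hM hN).
apply: le_trans (Re_le_normc _).
by case: (\sum_i _) => p q /=; rewrite mul0r subr0 ler_norm.
Qed.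

End DualEstimate.

(** * Dependence of A and B on the family x *)

Section Perturbation.
Context {R : realType}.
Local Notation C := R[i].
Local Notation "A ^H" := (map_mx Num.conj A^T).

Definition resolvent n m (x : 'I_m -> 'M[C]_n) (A B : 'M[C]_n) : Prop :=
  [/\ psd A, psd B, A = 1%:M + cpm x B & B = 1%:M + cpm (adjf x) A].

Definition retr n (A : 'M[C]_n) : R := complex.Re (\tr A).

Definition shift n m (x dx : 'I_m -> 'M[C]_n) (t : R) : 'I_m -> 'M[C]_n :=
  fun i => x i + t%:C%C *: dx i.

Definition cpm_diff n m (x dx : 'I_m -> 'M[C]_n) (b : 'M[C]_n) : 'M[C]_n :=
  \sum_i (dx i *m b *m (x i)^H + x i *m b *m (dx i)^H).

Lemma retrD n (A B : 'M[C]_n) : retr (A + B) = retr A + retr B.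
Proof. by rewrite /retr mxtraceD raddfD. Qed.

Lemma hs1 n (A : 'M[C]_n) : hs A 1%:M = \tr A.
Proof. by rewrite /hs adj1 mulmx1. Qed.

Lemma retr_hs n (A : 'M[C]_n) : retr A = complex.Re (hs A 1%:M).
Proof. by rewrite hs1. Qed.

Lemma retr_psd_ge0 n (A : 'M[C]_n) : psd A -> 0 <= retr A.
Proof. by move=> pA; rewrite retr_hs; apply: hs_psd_ge0 pA (psd1 _). Qed.

Lemma resolvent_adj n m (x : 'I_m -> 'M[C]_n) A B : resolvent x A B -> resolvent (adjf x) B A.
Proof.
by case=> pA pB AE BE; split; [exact: pB|exact: pA|exact: BE|rewrite adjfK; exact: AE]. Qed.

Lemma resolvent_ge1 n m (x : 'I_m -> 'M[C]_n) A B : resolvent x A B ->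
  forall v, nsq v <= qf A v.
Proof. by case=> _ pB -> _ v; rewrite qfD qf1 lerDl; have [_] := psd_cpm x pB. Qed.

(** Since A <= a, one has 1 >= A / a and so P_x B = A - 1 <= (1 - 1/a) A, and likewise P_x^H A <= (1
    - 1/a) B. The Schur test converts these into a norm bound. *)
Lemma resolvent_contr n m (x : 'I_m -> 'M[C]_n) A B (a : R) : resolvent x A B ->
  1 <= a -> hn A <= a -> hn B <= a ->
  forall b, nsq (cpm x b) <= (1 - a^-1) ^+ 2 * nsq b.
Proof.
move=> hAB a1 nA nB; have [pA pB AE BE] := hAB.
have a0 : 0 < a by apply: lt_le_trans a1.
have ai1 : a^-1 <= 1 by rewrite invf_le1.
have ai0 : 0 <= a^-1 by rewrite invr_ge0 ltW.
have key (D E : 'M[C]_n) : psd D -> hn D <= a -> D = 1%:M + E ->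
    psd ((1 - a^-1)%:C%C *: D - E).
  move=> [hD pD] nD DE; have -> : E = D - 1%:M by rewrite DE addrC addKr.
  split; first by rewrite adjD adjN adjD adjN adj1 realZ_adj hD.
  move=> v; rewrite qfD qfN qfD qfN qfZ qf1.
  have qle : qf D v <= a * nsq v.
    apply: le_trans (ler_norm _) _; apply: le_trans (qf_le_hn _ _) _.
    by rewrite ler_wpM2r // nsq_ge0.
  have : a^-1 * qf D v <= nsq v by rewrite mulrC ler_pdivrMr // mulrC.
  lra.
apply: (@schur_test _ _ _ _ A B).
- by rewrite subr_ge0.
- exact: pB.
- exact: resolvent_ge1 (resolvent_adj hAB).
- exact: key pA nA AE.
- exact: key pB nB BE.
Qed.

Lemma hn_contr n m (x : 'I_m -> 'M[C]_n) (s : R) b : 0 <= s ->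
  nsq (cpm x b) <= s ^+ 2 * nsq b -> hn (cpm x b) <= s * hn b.
Proof.
by move=> s0 h; rewrite -ler_sqr ?nnegrE ?mulr_ge0 ?hn_ge0 // exprMn !sqr_hn.
Qed.

Lemma adjf_shift n m (x dx : 'I_m -> 'M[C]_n) t :
  adjf (shift x dx t) = shift (adjf x) (adjf dx) t.
Proof. by apply/funext => i; rewrite /adjf /shift adjD realZ_adj. Qed.

Lemma cpm_shift n m (x dx : 'I_m -> 'M[C]_n) t b :
  cpm (shift x dx t) b = cpm x b + (t%:C%C *: cpm_diff x dx b + (t ^+ 2)%:C%C *: cpm dx b).
Proof.
have arith (a p q r : 'M[C]_n) : a + q + (p + r) = a + (p + q + r).
  by rewrite -!addrA [q + _]addrCA.
rewrite /cpm /cpm_diff !scaler_sumr -!big_split; apply: eq_bigr => i _ /=.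
rewrite /shift adjD realZ_adj expr2 rmorphM /=.
rewrite mulmxDl -!scalemxAl mulmxDl !mulmxDr -!scalemxAr -!scalemxAl scalerA scalerDr.
exact: arith.
Qed.

(** A Lipschitz constant for t -> P_(x + t dx) at t = 0, valid for |t| <= 1; see
    [hn_cpm_diff_le]. *)
Definition shift_const n m (x dx : 'I_m -> 'M[C]_n) : R :=
  \sum_i (2 * (hn (dx i) * hn (x i)) + hn (dx i) ^+ 2).

Lemma shift_const_ge0 n m (x dx : 'I_m -> 'M[C]_n) : 0 <= shift_const x dx.
Proof. by apply: sumr_ge0 => i _; rewrite addr_ge0 ?sqr_ge0 // !mulr_ge0 ?hn_ge0. Qed.

Lemma shift_const_adj n m (x dx : 'I_m -> 'M[C]_n) :
  shift_const (adjf x) (adjf dx) = shift_const x dx.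
Proof. by apply: eq_bigr => i _; rewrite /adjf !hn_adj. Qed.

Lemma hn_sandwich_le n (x y b : 'M[C]_n) : hn (x *m b *m y) <= hn x * hn y * hn b.
Proof.
apply: le_trans (hn_mulmx _ _) _; rewrite mulrAC ler_wpM2r ?hn_ge0 //; exact: hn_mulmx.
Qed.

Lemma hn_cpm_diff_le n m (x dx : 'I_m -> 'M[C]_n) t b : `|t| <= 1 ->
  hn (t%:C%C *: cpm_diff x dx b + (t ^+ 2)%:C%C *: cpm dx b) <= `|t| * (shift_const x dx * hn b).
Proof.
move=> t1; apply: le_trans (hnD _ _) _; rewrite !hnZ !normc_real normrX.
have h0 := hn_ge0 (cpm dx b).
have tt : `|t| ^+ 2 * hn (cpm dx b) <= `|t| * hn (cpm dx b).
  by rewrite ler_wpM2r // expr2 ler_piMr.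
apply: le_trans (lerD (lexx _) tt) _; rewrite -mulrDr ler_wpM2l ?normr_ge0 //.
apply: le_trans (lerD (hn_sum _) (hn_sum _)) _.
rewrite -big_split /shift_const mulr_suml; apply: ler_sum => i _ /=.
have h1 := hnD (dx i *m b *m (x i)^H) (x i *m b *m (dx i)^H).
have h2 := hn_sandwich_le (dx i) (x i)^H b.
have h3 := hn_sandwich_le (x i) (dx i)^H b.
have h4 := hn_sandwich_le (dx i) (dx i)^H b.
rewrite !hn_adj in h2 h3 h4; rewrite expr2.
by move: h1 h2 h3 h4; move: (hn (_ + _)) (hn (_ *m _)) (hn (_ *m _)) (hn (_ *m _)) => a1 a2 a3 a4; lra.
Qed.

Lemma Re_cpm_diff n m (x dx : 'I_m -> 'M[C]_n) (A B : 'M[C]_n) : A^H = A -> B^H = B ->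
  complex.Re (hs A (cpm_diff x dx B)) = 2 * complex.Re (\sum_i hs (A *m dx i *m B) (x i)).
Proof.
move=> hA hB; rewrite hs_sumr !raddf_sum mulr_sumr; apply: eq_bigr => i _ /=.
have Re_conj (z : C) : complex.Re z^* = complex.Re z by case: z.
have e1 : hs A (dx i *m B *m (x i)^H) = (hs (A *m dx i *m B) (x i))^*.
  by rewrite -hsC -hs_mulr hs_mull hA mulmxA.
have e2 : hs A (x i *m B *m (dx i)^H) = hs (A *m dx i *m B) (x i).
  by rewrite [RHS]hs_mulr hB [RHS]hs_mulr.
by rewrite hsDr raddfD /= e1 e2 Re_conj mulr2n mulrDl mul1r.
Qed.

(** The contraction constant 1 - 1/a of P_x leaves room for a perturbation of size 1/(2a), so the
    shifted family still has constant 1 - 1/(2a) and its own pair (At, Bt). *)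
Lemma resolvent_lipschitz n m (x dx : 'I_m -> 'M[C]_n) (A B : 'M[C]_n) (a t : R) :
  resolvent x A B -> 1 <= a -> hn A <= a -> hn B <= a ->
  `|t| <= 1 -> 2 * a * (shift_const x dx * `|t|) <= 1 ->
  exists At Bt, [/\ resolvent (shift x dx t) At Bt,
    hn (At - A) <= 4 * a ^+ 2 * (shift_const x dx * `|t|) &
    hn (Bt - B) <= 4 * a ^+ 2 * (shift_const x dx * `|t|)].
Proof.
move=> hAB a1 nA nB t1; set e := _ * `|t| => he.
have e0 : 0 <= e by rewrite mulr_ge0 ?shift_const_ge0.
have a0 : 0 < a by apply: lt_le_trans a1.
pose s := 1 - a^-1; pose s' := 1 - (2 * a)^-1.
have ai1 : a^-1 <= 1 by rewrite invf_le1.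
have s0 : 0 <= s by rewrite subr_ge0.
have ai : (2 * a)^-1 = a^-1 / 2 by rewrite invfM mulrC.
have aip : 0 < a^-1 by rewrite invr_gt0.
have s'01 : 0 <= s' < 1 by rewrite /s' ai; apply/andP; split; lra.
have [s'0 _] := andP s'01.
have es : s + e <= s'.
  have : e <= a^-1 / 2 by rewrite -ai -[_^-1]mul1r ler_pdivlMr ?mulr_gt0 // mulrC.
  rewrite /s /s' ai; lra.
have contr (y dy : 'I_m -> 'M[C]_n) : (forall b, nsq (cpm y b) <= s ^+ 2 * nsq b) ->
    shift_const y dy * `|t| = e ->
    (forall b, hn (cpm (shift y dy t) b) <= s' * hn b) /\
    (forall b, hn (cpm (shift y dy t) b - cpm y b) <= e * hn b).
  move=> hy ye.
  have hd b : hn (cpm (shift y dy t) b - cpm y b) <= e * hn b.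
    rewrite cpm_shift addrC addKr; apply: le_trans (hn_cpm_diff_le y dy b t1) _.
    by rewrite mulrA [`|t| * _]mulrC ye.
  split=> // b; rewrite -[cpm (shift _ _ _) b](subrK (cpm y b)).
  apply: le_trans (hnD _ _) _; apply: le_trans (lerD (hd b) (hn_contr s0 (hy b))) _.
  by rewrite -mulrDl [e + s]addrC ler_wpM2r ?hn_ge0.
have [c1 d1] := contr x dx (resolvent_contr hAB a1 nA nB) erefl.
have [c2 d2] := contr _ (adjf dx) (resolvent_contr (resolvent_adj hAB) a1 nB nA)
  (congr1 (fun z => z * _) (shift_const_adj x dx)).
rewrite -adjf_shift in c2 d2.
have sq b : nsq (cpm (shift x dx t) b) <= s' ^+ 2 * nsq b.
  by rewrite -!sqr_hn -exprMn ler_sqr ?nnegrE ?mulr_ge0 ?hn_ge0.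
have [At [Bt [pAt pBt AtE BtE]]] := cp_resolvent s'01 sq.
have [pA pB AE BE] := hAB.
have step (D E D' E' : 'M[C]_n) (y y' : 'I_m -> 'M[C]_n) :
    D' = 1%:M + cpm y' E' -> D = 1%:M + cpm y E -> hn E <= a ->
    (forall b, hn (cpm y' b) <= s' * hn b) -> (forall b, hn (cpm y' b - cpm y b) <= e * hn b) ->
    hn (D' - D) <= s' * hn (E' - E) + e * a.
  move=> -> -> nE c d.
  have -> : 1%:M + cpm y' E' - (1%:M + cpm y E) = cpm y' (E' - E) + (cpm y' E - cpm y E).
    by rewrite cpmB opprD addrACA subrr add0r addrA subrK.
  apply: le_trans (hnD _ _) _; apply: lerD => //.
  by apply: le_trans (d _) _; rewrite ler_wpM2l.
have i1 := step _ _ _ _ _ _ AtE AE nB c1 d1.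
have i2 := step _ _ _ _ _ _ BtE BE nA c2 d2.
exists At, Bt; split; first by split; [exact: pAt|exact: pBt|exact: AtE|exact: BtE].
all: have p1 := hn_ge0 (At - A); have p2 := hn_ge0 (Bt - B).
all: move: i1 i2 p1 p2; move: (hn _) (hn _) => p q i1 i2 p0 q0.
(* Adding p <= s' q + e a and q <= s' p + e a; since 1 - s' = 1/(2a), this is p + q <= 4 a^2 e. *)
all: have sum : (1 - s') * (p + q) <= 2 * (e * a) by lra.
all: have E1 : 1 - s' = (2 * a)^-1 by rewrite /s'; lra.
all: rewrite E1 mulrC ler_pdivrMr ?mulr_gt0 // in sum.
all: have E2 : 2 * (e * a) * (2 * a) = 4 * a ^+ 2 * e by ring.
all: by rewrite E2 in sum; lra.
Qed.

(* With v = (A, B), e = (1, 1) and the selfadjoint M_x (a, b) = (P_x b, P_x^H a),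
   so that (1 - M_x) v = e, this is <e, v_t - v> = <v, (M_y - M_x) v_t>. *)
Lemma resolvent_trace_diff n m (x y : 'I_m -> 'M[C]_n) (A B At Bt : 'M[C]_n) :
  resolvent x A B -> resolvent y At Bt ->
  retr At + retr Bt - (retr A + retr B) =
  complex.Re (hs A (cpm y Bt)) - complex.Re (hs A (cpm x Bt)) +
  (complex.Re (hs B (cpm (adjf y) At)) - complex.Re (hs B (cpm (adjf x) At))).
Proof.
move=> [_ _ AE BE] [_ _ AtE BtE].
have arith (a' b' a b p q r s : R) : a' = a + p - q -> b' = b + r - s ->
    a' + b' - (a + b) = p - s + (r - q) by move=> -> ->; ring.
have hs1m (D E Dt : 'M[C]_n) (z : 'I_m -> 'M[C]_n) : D = 1%:M + cpm z E ->
    hs (1%:M : 'M[C]_n) Dt = hs D Dt - hs E (cpm (adjf z) Dt).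
  by move=> DE; rewrite -hs_cpm -hsNl -hsDl DE addrK.
have e1 := hs1m _ _ At _ AE; have := hs1m _ _ Bt _ BE; rewrite adjfK => e2.
have re1 (D : 'M[C]_n) : retr D = complex.Re (hs 1%:M D).
  by rewrite retr_hs hsC; case: (hs _ _).
have ReB (z w : C) : complex.Re (z - w) = complex.Re z - complex.Re w by case: z; case: w.
have hs1D (D X Dt : 'M[C]_n) : Dt = 1%:M + X -> hs D Dt = \tr D + hs D X.
  by move=> ->; rewrite hsDr hs1.
have trE (Dt D E X Y : 'M[C]_n) : hs (1%:M : 'M[C]_n) Dt = hs D Dt - hs E Y -> Dt = 1%:M + X ->
    retr Dt = retr D + complex.Re (hs D X) - complex.Re (hs E Y).
  by move=> h1 h2; rewrite re1 h1 (hs1D _ _ _ h2) ReB raddfD.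
have tA := trE _ _ _ _ _ e1 AtE; have tB := trE _ _ _ _ _ e2 BtE.
exact: arith tA tB.
Qed.

End Perturbation.

(** * First variation of the trace of A + B *)

Section FirstVariation.
Context {R : realType}.
Local Notation C := R[i].
Local Notation "A ^H" := (map_mx Num.conj A^T).

(** By [Re_cpm_diff] this is half of the derivative of Re <A, P_x B> along dx with A and B frozen.
    The derivative of tr (A + B) is four times it, as P_x and P_x^H contribute equally. *)
Definition variation n m (x dx : 'I_m -> 'M[C]_n) (A B : 'M[C]_n) : R :=
  complex.Re (\sum_i hs (A *m dx i *m B) (x i)).

Lemma cpm_diffD n m (x dx : 'I_m -> 'M[C]_n) b c :
  cpm_diff x dx (b + c) = cpm_diff x dx b + cpm_diff x dx c.
Proof.
rewrite /cpm_diff -big_split; apply: eq_bigr => i _ /=.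
by rewrite !mulmxDr !mulmxDl addrACA.
Qed.

Lemma variation_adj n m (x dx : 'I_m -> 'M[C]_n) (A B : 'M[C]_n) : A^H = A -> B^H = B ->
  variation (adjf x) (adjf dx) B A = variation x dx A B.
Proof.
move=> hA hB; rewrite /variation !raddf_sum; apply: eq_bigr => i _ /=.
have -> : B *m adjf dx i *m A = (A *m dx i *m B)^H by rewrite !adjM hA hB mulmxA.
by rewrite /adjf hs_adj hsC; case: (hs _ _).
Qed.

(** The increment of P_x acts on Bt = B + (Bt - B): the part at B gives the exact first and second
    order terms, and the rest is small because both the increment and Bt - B are of order t. *)
Lemma pairing_shift_le n m (x dx : 'I_m -> 'M[C]_n) (A B Bt : 'M[C]_n) (t : R) :
  A^H = A -> B^H = B -> `|t| <= 1 ->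
  complex.Re (hs A (cpm (shift x dx t) Bt)) - complex.Re (hs A (cpm x Bt)) <=
  t * (2 * variation x dx A B) + t ^+ 2 * (hn A * hn (cpm dx B)) +
  hn A * (`|t| * (shift_const x dx * hn (Bt - B))).
Proof.
move=> hA hB t1; pose D b := t%:C%C *: cpm_diff x dx b + (t ^+ 2)%:C%C *: cpm dx b.
have arith (z p q : R) : p <= q -> z + p - z <= q by lra.
have lin (a d : C) (p q r s : 'M[C]_n) :
    a *: (p + q) + d *: (r + s) = (a *: p + d *: r) + (a *: q + d *: s).
  by rewrite (scalerDr a) (scalerDr d) addrACA.
have DD (b c : 'M[C]_n) : D (b + c) = D b + D c.
  by rewrite /D cpm_diffD cpmD; exact: lin.
have ReD (z w : C) : complex.Re (z + w) = complex.Re z + complex.Re w by case: z; case: w.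
have ReZ (r : R) (z : C) : complex.Re (r%:C%C * z) = r * complex.Re z.
  by case: z => z1 z2 /=; rewrite mul0r subr0.
have conjr (r : R) : r%:C%C^* = r%:C%C :> C by rewrite /Num.conj /= oppr0.
have -> : cpm (shift x dx t) Bt = cpm x Bt + (D B + D (Bt - B)).
  have {1}-> : Bt = B + (Bt - B) by rewrite addrC subrK.
  by rewrite cpm_shift -/(D _) DD; congr (cpm x _ + _); rewrite addrC subrK.
rewrite hsDr ReD; apply: arith => //; rewrite hsDr ReD; apply: lerD; last first.
  apply: le_trans (ler_norm _) _; apply: le_trans (Re_le_normc _) _.
  apply: le_trans (hs_cauchy _ _) _; rewrite ler_wpM2l ?hn_ge0 //.
  exact: hn_cpm_diff_le.
rewrite /D hsDr ReD !hsZr !conjr !ReZ; apply: lerD.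
  by rewrite Re_cpm_diff.
rewrite ler_wpM2l ?sqr_ge0 //.
apply: le_trans (ler_norm _) _; apply: le_trans (Re_le_normc _) _; exact: hs_cauchy.
Qed.

(** Only an upper bound is established: it is to be compared with a minimum, for t of both signs. *)
Lemma resolvent_perturb n m (x dx : 'I_m -> 'M[C]_n) (A B : 'M[C]_n) : resolvent x A B ->
  exists2 t0 : R, 0 < t0 <= 2^-1 & exists2 K : R, 0 <= K & forall t : R, `|t| <= t0 ->
  exists At Bt, resolvent (shift x dx t) At Bt /\
    retr At + retr Bt <= retr A + retr B + t * (4 * variation x dx A B) + K * t ^+ 2.
Proof.
have arith (p q : R) : 1 <= p -> 0 <= q -> 2 <= 2 * p * (q + 1).
  move=> p1 q0; have pq : 0 <= p * q by rewrite mulr_ge0 //; lra.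
  by rewrite mulrDr mulr1 -mulrA; lra.
have arith2 (p q r : R) : 0 <= p -> 0 <= r -> r * (2 * p * (q + 1)) <= 1 -> 2 * p * (q * r) <= 1.
  move=> p0 r0; have pr : 0 <= p * r by rewrite mulr_ge0.
  have -> : r * (2 * p * (q + 1)) = 2 * p * (q * r) + 2 * (p * r) by ring.
  lra.
have arith3 (L L0 p q v t u1 u2 w1 w2 e1 e2 k : R) : L - L0 = p + q ->
    p <= t * (2 * v) + u1 + w1 -> q <= t * (2 * v) + u2 + w2 ->
    u1 <= e1 -> u2 <= e2 -> w1 <= k -> w2 <= k ->
    L <= L0 + t * (4 * v) + (e1 + e2 + (k + k)).
  have -> : t * (4 * v) = t * (2 * v) + t * (2 * v) by ring.
  lra.
have quad (a c t p q : R) : 0 <= a -> 0 <= c -> 0 <= p -> p <= a -> 0 <= q ->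
    q <= 4 * a ^+ 2 * (c * `|t|) -> p * (`|t| * (c * q)) <= t ^+ 2 * (a * (c * (4 * a ^+ 2 * c))).
  move=> a0 c0 p0 pa q0 qle; have tt : `|t| * `|t| = t ^+ 2 by rewrite -expr2 real_normK ?num_real.
  have -> : t ^+ 2 * (a * (c * (4 * a ^+ 2 * c))) = a * (`|t| * (c * (4 * a ^+ 2 * (c * `|t|)))).
    by rewrite -tt; ring.
  by rewrite ler_pM ?mulr_ge0 // ler_wpM2l // ler_wpM2l.
have arith4 (p q r s : R) : (p + q + 2 * r) * s = s * p + s * q + (s * r + s * r) by ring.
move=> hAB; pose a := 1 + hn A + hn B; pose c := shift_const x dx.
have c0 : 0 <= c := shift_const_ge0 x dx.
have [a1 nA nB] : [/\ 1 <= a, hn A <= a & hn B <= a].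
  by have := hn_ge0 A; have := hn_ge0 B; rewrite /a => *; split; lra.
have [[hA _] [hB _] _ _] := hAB.
(* For |t| <= 1/T both smallness conditions of [resolvent_lipschitz] hold. *)
have T2 := arith _ _ a1 c0; set T := 2 * a * (c + 1) in T2.
have T0 : 0 < T by apply: lt_le_trans T2.
exists T^-1; first by rewrite invr_gt0 T0 lef_pV2 ?posrE.
pose K := a * hn (cpm dx B) + a * hn (cpm (adjf dx) A) + 2 * (a * (c * (4 * a ^+ 2 * c))).
have a0 : 0 <= a by lra.
exists K => [|t ht].
  by rewrite /K !addr_ge0 ?mulr_ge0 ?hn_ge0.
have tT : `|t| * T <= 1 by rewrite -ler_pdivlMr ?mul1r.
have hc : 2 * a * (c * `|t|) <= 1 by apply: arith2 tT.
have t1 : `|t| <= 1.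
  by apply: le_trans ht _; rewrite invf_le1 //; apply: le_trans T2; rewrite ler1n.
have [At [Bt [hABt dA dB]]] := resolvent_lipschitz hAB a1 nA nB t1 hc.
exists At, Bt; split; first exact: hABt.
have E := resolvent_trace_diff hAB hABt; rewrite adjf_shift in E.
have i1 := pairing_shift_le x dx Bt hA hB t1.
have i2 := pairing_shift_le (adjf x) (adjf dx) At hB hA t1.
rewrite variation_adj // shift_const_adj in i2.
have j1 := quad _ _ _ _ _ a0 c0 (hn_ge0 A) nA (hn_ge0 _) dB.
have j2 := quad _ _ _ _ _ a0 c0 (hn_ge0 B) nB (hn_ge0 _) dA.
have k1 : t ^+ 2 * (hn A * hn (cpm dx B)) <= t ^+ 2 * (a * hn (cpm dx B)).
  by rewrite ler_wpM2l ?sqr_ge0 // ler_wpM2r ?hn_ge0.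
have k2 : t ^+ 2 * (hn B * hn (cpm (adjf dx) A)) <= t ^+ 2 * (a * hn (cpm (adjf dx) A)).
  by rewrite ler_wpM2l ?sqr_ge0 // ler_wpM2r ?hn_ge0.
have -> : K * t ^+ 2 = t ^+ 2 * (a * hn (cpm dx B)) + t ^+ 2 * (a * hn (cpm (adjf dx) A)) +
    (t ^+ 2 * (a * (c * (4 * a ^+ 2 * c))) + t ^+ 2 * (a * (c * (4 * a ^+ 2 * c)))).
  exact: arith4.
exact: arith3 E i1 i2 k1 k2 j1 j2.
Qed.

End FirstVariation.

(** * Stationarity at a minimising representation *)

Section Minimizer.
Context {R : realType}.
Local Notation C := R[i].
Local Notation "A ^H" := (map_mx Num.conj A^T).

(** Testing t = - D / T, with T larger than L and than |D| / t1, turns the hypothesis into - D^2 (T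
    - L) / T^2 >= 0. *)
Lemma stationary (D L t1 : R) : 0 <= L -> 0 < t1 ->
  (forall t, `|t| <= t1 -> 0 <= t * D + L * t ^+ 2) -> D = 0.
Proof.
move=> L0 t10 h; pose T := 1 + L + `|D| / t1.
have D0 : 0 <= `|D| / t1 by rewrite divr_ge0 // ltW.
have T0 : 0 < T by rewrite /T; lra.
have ht : `|- D / T| <= t1.
  rewrite normrM normrN normfV (gtr0_norm T0) ler_pdivrMr //.
  rewrite /T mulrDr [t1 * (_ / _)]mulrC divfK ?gt_eqF //.
  by rewrite lerDr mulr_ge0 //; lra.
have := h _ ht; rewrite exprMn sqrrN.
have -> : - D / T * D + L * (D ^+ 2 * T^-1 ^+ 2) = - (D ^+ 2 * ((T - L) / T ^+ 2)).
  by field; rewrite gt_eqF.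
rewrite oppr_ge0 => h1; apply/eqP; rewrite -sqrf_eq0 eq_le sqr_ge0 andbT.
have p0 : 0 < (T - L) / T ^+ 2 by rewrite divr_gt0 ?exprn_gt0 // /T; lra.
by rewrite -(pmulr_lle0 _ p0).
Qed.

Definition feasible n m (u : 'M[C]_(n * n)) (x y : 'I_m -> 'M[C]_n) (A B A' B' : 'M[C]_n) :=
  [/\ u = \sum_i x i *t y i, resolvent x A B & resolvent y A' B'].

Definition minimal n m (u : 'M[C]_(n * n)) (x y : 'I_m -> 'M[C]_n) (A B A' B' : 'M[C]_n) :=
  feasible u x y A B A' B' /\ forall x2 y2 A2 B2 A2' B2',
    @feasible n m u x2 y2 A2 B2 A2' B2' ->
    retr A + retr B + (retr A' + retr B') <= retr A2 + retr B2 + (retr A2' + retr B2').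

(** The second family moves by h(t) = - t + O(t^2), which lets exact reparametrisations such as 1 /
    (1 + t) be used. To first order the objective changes by 4 t times the difference of the two
    variations, which must therefore vanish. *)
Lemma minimal_variation n m (u : 'M[C]_(n * n)) (x y dx dy : 'I_m -> 'M[C]_n) A B A' B'
    (h : R -> R) : minimal u x y A B A' B' ->
  (forall t, `|t| <= 2^-1 -> `|h t + t| <= 2 * t ^+ 2 /\
     u = \sum_i shift x dx t i *t shift y dy (h t) i) ->
  variation x dx A B = variation y dy A' B'.
Proof.
move=> [[_ hx hy] hmin] hh.
have [t0 /andP[t00 t02] [K K0 hK]] := resolvent_perturb dx hx.
have [t0' /andP[t00' t02'] [K' K0' hK']] := resolvent_perturb dy hy.
set P := variation x dx A B in hK *; set Q := variation y dy A' B' in hK' *.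
have arith (v v' p q t s k k' l : R) : v + v' <= v + t * (4 * p) + k + (v' + s * (4 * q) + k') ->
    s * (4 * q) + t * (4 * q) + k + k' <= l -> 0 <= t * (4 * (p - q)) + l by lra.
have arith2 (p k k' l l' : R) : p <= l -> k' <= l' -> p + k + k' <= k + l' + l by lra.
have t10 : 0 < Num.min t0 (t0' / 2) by rewrite lt_min t00 divr_gt0.
have L0 : 0 <= K + 4 * K' + 8 * `|Q| by rewrite !addr_ge0 // mulr_ge0.
suff : 4 * (P - Q) = 0 by lra.
apply: (stationary L0 t10) => t; rewrite le_min => /andP[ht ht'].
have t12 : `|t| <= 2^-1 by apply: le_trans ht t02.
have [hts ut] := hh _ t12; set s := h t in hts ut.
have t2 : t ^+ 2 <= `|t| / 2.
  by rewrite -real_normK ?num_real // expr2 ler_wpM2l.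
have hs2 : `|s| <= 2 * `|t|.
  have -> : s = (s + t) - t by rewrite addrK.
  apply: le_trans (ler_normB _ _) _; lra.
have [At [Bt [fx vx]]] := hK _ ht.
have [At' [Bt' [fy vy]]] : exists At Bt, resolvent (shift y dy s) At Bt /\
    retr At + retr Bt <= retr A' + retr B' + s * (4 * Q) + K' * s ^+ 2.
  by apply: hK'; apply: le_trans hs2 _; rewrite mulrC -ler_pdivlMr.
have feas : feasible u (shift x dx t) (shift y dy s) At Bt At' Bt' by split.
have vmin := le_trans (hmin _ _ _ _ _ _ feas) (lerD vx vy).
apply: (arith _ _ _ _ _ _ _ _ _ vmin).
have s2 : K' * s ^+ 2 <= 4 * K' * t ^+ 2.
  have -> : 4 * K' * t ^+ 2 = K' * (2 * `|t|) ^+ 2 by rewrite exprMn real_normK ?num_real //; ring.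
  by rewrite ler_wpM2l // -(real_normK (num_real s)) ler_sqr ?nnegrE ?mulr_ge0.
have q2 : s * (4 * Q) + t * (4 * Q) <= 8 * `|Q| * t ^+ 2.
  rewrite -mulrDl; apply: le_trans (ler_norm _) _; rewrite normrM normrM.
  have -> : 8 * `|Q| * t ^+ 2 = 2 * t ^+ 2 * (4 * `|Q|) by ring.
  by rewrite [`|4|]ger0_norm // ler_wpM2r // mulr_ge0.
by rewrite [leRHS]mulrDl [X in _ <= X + _]mulrDl; exact: arith2.
Qed.

(* Replacing x_j by x_j + t c x_i and y_i by y_i - t c y_j preserves the tensor
   sum x_k (x) y_k; for i = j one uses (1 + t) x_i and y_i / (1 + t) instead. *)
Lemma minimal_gram n m (u : 'M[C]_(n * n)) (x y : 'I_m -> 'M[C]_n) A B A' B' :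
  minimal u x y A B A' B' ->
  forall i j, hs (A *m x i *m B) (x j) = hs (A' *m y j *m B') (y i).
Proof.
move=> hmin i j; have [[uE hx hy] _] := hmin.
have [[hA _] [hB _] _ _] := hx; have [[hA' _] [hB' _] _ _] := hy.
pose dx (c : C) k := if k == j then c *: x i else 0.
pose dy (c : C) k := if k == i then c *: y j else 0.
have varE (z : 'I_m -> 'M[C]_n) (D E : 'M[C]_n) (c : C) k l :
    variation z (fun q => if q == l then c *: z k else 0) D E =
    complex.Re (c * hs (D *m z k *m E) (z l)).
  rewrite /variation (bigD1 l) //= eqxx big1 ?addr0 => [|q /negbTE ->].
    by rewrite -scalemxAr -scalemxAl hsZl.
  by rewrite mulmx0 mul0mx hs0l.
(* For i = j only the real direction is varied; the imaginary parts vanish anyway by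
   selfadjointness. *)
have herm (z D E : 'M[C]_n) : D^H = D -> E^H = E -> complex.Im (hs (D *m z *m E) z) = 0.
  move=> hD hE; have : hs (D *m z *m E) z = (hs (D *m z *m E) z)^*.
    by rewrite -hsC hs_mulr hE hs_mull hD mulmxA.
  case: (hs _ _) => p q [] /= qq; lra.
have [ij|ij] := eqVneq i j.
  subst j.
  suff : variation x (dx 1) A B = variation y (dy 1) A' B'.
    rewrite !varE !mul1r; move: (herm (x i) A B hA hB) (herm (y i) A' B' hA' hB').
    by case: (hs _ _) (hs _ _) => p q [p' q'] /= -> -> ->.
  apply: (minimal_variation (h := fun t => - t / (1 + t)) hmin) => t ht.
  have t1 : 0 < 1 + t by move: ht; rewrite ler_norml => /andP[]; lra.
  split.
    have -> : - t / (1 + t) + t = t ^+ 2 / (1 + t) by field; rewrite gt_eqF.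
    rewrite normrM ger0_norm ?sqr_ge0 // mulrC ler_wpM2r ?sqr_ge0 //.
    rewrite normfV gtr0_norm // -[X in _ <= X]invrK lef_pV2 ?posrE ?invr_gt0 //.
    by move: ht; rewrite ler_norml => /andP[]; lra.
  rewrite uE; apply: eq_bigr => k _; rewrite /shift /dx /dy.
  case: eqVneq => [->|_]; last by rewrite !scaler0 !addr0.
  have e1 : (1 + t) * (1 + - t / (1 + t)) = 1 by field; rewrite gt_eqF.
  have := congr1 (fun r => r%:C%C : C) e1; rewrite rmorphM rmorphD (rmorphD _ 1) rmorph1 /=.
  move: (t%:C%C) ((_ / _)%:C%C) => a b E; apply/matrixP => p q; rewrite !mxE !mul1r.
  move: (x i _ _) (y i _ _) => f g; transitivity ((1 + a) * (1 + b) * (f * g)); last ring.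
  by rewrite E mul1r.
have key (c : C) : complex.Re (c * hs (A *m x i *m B) (x j)) =
    complex.Re (c * hs (A' *m y j *m B') (y i)).
  rewrite -!varE; apply: (minimal_variation (h := fun t => - t) hmin) => t _.
  split; first by rewrite addNr normr0 mulr_ge0 ?sqr_ge0.
  have dxE k p q : dx c k p q = if k == j then c * x i p q else 0.
    by rewrite /dx; case: eqP => _; rewrite mxE.
  have dyE k p q : dy c k p q = if k == i then c * y j p q else 0.
    by rewrite /dy; case: eqP => _; rewrite mxE.
  have tN : (- t)%:C%C = - t%:C%C :> C by rewrite rmorphN.
  have shE (z dz : 'I_m -> 'M[C]_n) (s : R) k p q :
    shift z dz s k p q = z k p q + s%:C%C * dz k p q by rewrite /shift !mxE.
  apply/matrixP => p q; rewrite uE !summxE.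
  (* The term k = j gains r c f_i g_j and the term k = i loses it. A term quadratic in r would need
     i = j. *)
  have cancel (f g : 'I_m -> C) (r : C) : \sum_k f k * g k = \sum_k
      (f k + r * (if k == j then c * f i else 0)) * (g k - r * (if k == i then c * g j else 0)).
    rewrite [RHS](eq_bigr (fun k => f k * g k + ((if k == j then r * (c * f i) * g j else 0) -
      (if k == i then r * (c * f i) * g j else 0)))).
      by rewrite big_split /= sumrB -!big_mkcond /= !big_pred1_eq subrr addr0.
    move=> k _; case: eqVneq => [->|_]; case: eqVneq => [kE|_]; last ring.
    - by rewrite kE eqxx in ij.
    - ring.
    - by rewrite kE; ring.
  have tensE (X Y : 'M[C]_n) (a b : 'I_(n * n)) : (X *t Y) a b =
      X (mxtens_unindex a).1 (mxtens_unindex b).1 * Y (mxtens_unindex a).2 (mxtens_unindex b).2.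
    by rewrite mxE.
  rewrite [LHS](eq_bigr (fun k => x k (mxtens_unindex p).1 (mxtens_unindex q).1 *
    y k (mxtens_unindex p).2 (mxtens_unindex q).2)) => [|k _]; last by rewrite tensE.
  rewrite (cancel _ _ t%:C%C); apply: eq_bigr => k _.
  by rewrite tensE [X in _ = X * _]shE [X in _ = _ * X]shE (dxE k) (dyE k) tN mulNr.
(* The direction c = 1 compares real parts and c = i imaginary parts. *)
move: (key 1) (key 'i%C); case: (hs _ _) (hs _ _) => p q [p' q'] /=.
rewrite !mul1r !mul0r !subr0 !sub0r => -> e; congr Complex; lra.
Qed.

End Minimizer.

(** * Continuity and closedness in real coordinates *)

Section Compactness.
Context {R : realType}.
Local Notation C := R[i].
Local Notation "A ^H" := (map_mx Num.conj A^T).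

(** The minimum is taken over real row vectors, where compactness and the extreme value theorem are
    applied; complex quantities are thus viewed as pairs of real functions of such a vector. *)
Definition rvcont N (g : 'rV[R]_N -> C) : Prop :=
  continuous (fun v => complex.Re (g v)) /\ continuous (fun v => complex.Im (g v)).

Lemma rvcont_cst N (c : C) : @rvcont N (fun=> c).
Proof. by split; exact: cst_continuous. Qed.

Lemma rvcontD N (f g : 'rV[R]_N -> C) : rvcont f -> rvcont g -> rvcont (fun v => f v + g v).
Proof.
move=> [f1 f2] [g1 g2].
have -> : (fun v => f v + g v) = fun v => Complex (complex.Re (f v) + complex.Re (g v))
    (complex.Im (f v) + complex.Im (g v)).
  by apply/funext => v; case: (f v) (g v) => a b [].
by split=> v; [exact: cvgD (f1 v) (g1 v)|exact: cvgD (f2 v) (g2 v)].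
Qed.

Lemma rvcontM N (f g : 'rV[R]_N -> C) : rvcont f -> rvcont g -> rvcont (fun v => f v * g v).
Proof.
move=> [f1 f2] [g1 g2].
have -> : (fun v => f v * g v) = fun v =>
    Complex (complex.Re (f v) * complex.Re (g v) - complex.Im (f v) * complex.Im (g v))
      (complex.Re (f v) * complex.Im (g v) + complex.Im (f v) * complex.Re (g v)).
  by apply/funext => v; case: (f v) (g v) => a b [].
split=> v; first exact: cvgB (cvgM (f1 v) (g1 v)) (cvgM (f2 v) (g2 v)).
exact: cvgD (cvgM (f1 v) (g2 v)) (cvgM (f2 v) (g1 v)).
Qed.

Lemma rvcont_conj N (f : 'rV[R]_N -> C) : rvcont f -> rvcont (fun v => (f v)^*).
Proof.
move=> [f1 f2].
have -> : (fun v => (f v)^*) = fun v => Complex (complex.Re (f v)) (- complex.Im (f v)).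
  by apply/funext => v; case: (f v).
by split=> v; [exact: f1|exact: cvgN (f2 v)].
Qed.

Lemma rvcont_sum N (I : finType) (f : I -> 'rV[R]_N -> C) :
  (forall i, rvcont (f i)) -> rvcont (fun v => \sum_i f i v).
Proof.
move=> hf; elim: (index_enum I) => [|i r IH].
  by under eq_fun do rewrite big_nil; exact: rvcont_cst.
by under eq_fun do rewrite big_cons; exact: rvcontD.
Qed.

Definition mcont N p q (G : 'rV[R]_N -> 'M[C]_(p, q)) : Prop :=
  forall i j, rvcont (fun v => G v i j).

Lemma mcont_cst N p q (A : 'M[C]_(p, q)) : @mcont N p q (fun=> A).
Proof. by move=> i j; exact: rvcont_cst. Qed.

Lemma mcontD N p q (F G : 'rV[R]_N -> 'M[C]_(p, q)) : mcont F -> mcont G ->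
  mcont (fun v => F v + G v).
Proof.
move=> hF hG i j; have -> : (fun v => (F v + G v) i j) = fun v => F v i j + G v i j.
  by apply/funext => v; rewrite mxE.
exact: rvcontD.
Qed.

Lemma mcontM N p q r (F : 'rV[R]_N -> 'M[C]_(p, q)) (G : 'rV[R]_N -> 'M[C]_(q, r)) :
  mcont F -> mcont G -> mcont (fun v => F v *m G v).
Proof.
move=> hF hG i j.
have -> : (fun v => (F v *m G v) i j) = fun v => \sum_k F v i k * G v k j.
  by apply/funext => v; rewrite mxE.
by apply: rvcont_sum => k; exact: rvcontM (hF i k) (hG k j).
Qed.

Lemma mcont_adj N p q (F : 'rV[R]_N -> 'M[C]_(p, q)) : mcont F -> mcont (fun v => (F v)^H).
Proof.
move=> hF i j; have -> : (fun v => (F v)^H i j) = fun v => (F v j i)^*.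
  by apply/funext => v; rewrite !mxE.
exact: rvcont_conj.
Qed.

Lemma mcont_sum N p q (I : finType) (F : I -> 'rV[R]_N -> 'M[C]_(p, q)) :
  (forall k, mcont (F k)) -> mcont (fun v => \sum_k F k v).
Proof.
move=> hF i j; have -> : (fun v => (\sum_k F k v) i j) = fun v => \sum_k F k v i j.
  by apply/funext => v; rewrite summxE.
by apply: rvcont_sum => k; exact: hF.
Qed.

Lemma mcont_tens N p q (F : 'rV[R]_N -> 'M[C]_p) (G : 'rV[R]_N -> 'M[C]_q) :
  mcont F -> mcont G -> mcont (fun v => F v *t G v).
Proof.
move=> hF hG i j.
have -> : (fun v => (F v *t G v) i j) = fun v =>
    F v (mxtens_unindex i).1 (mxtens_unindex j).1 * G v (mxtens_unindex i).2 (mxtens_unindex j).2.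
  by apply/funext => v; rewrite mxE.
exact: rvcontM (hF _ _) (hG _ _).
Qed.

Lemma mcont_cpm N n m (X : 'rV[R]_N -> 'I_m -> 'M[C]_n) (B : 'rV[R]_N -> 'M[C]_n) :
  (forall i, mcont (fun v => X v i)) -> mcont B -> mcont (fun v => cpm (X v) (B v)).
Proof.
move=> hX hB; apply: mcont_sum => i; apply: mcontM; last exact: mcont_adj.
exact: mcontM.
Qed.

Lemma continuous_retr N n (F : 'rV[R]_N -> 'M[C]_n) : mcont F -> continuous (fun v => retr (F v)).
Proof.
by move=> hF; have [] := rvcont_sum (fun i => hF i i).
Qed.

Lemma closed_ccont_eq N (f g : 'rV[R]_N -> C) : rvcont f -> rvcont g ->
  closed [set v | f v = g v].
Proof.
move=> [f1 f2] [g1 g2].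
have -> : [set v | f v = g v] =
    (fun v => complex.Re (f v) - complex.Re (g v)) @^-1` [set x | x = 0] `&`
    (fun v => complex.Im (f v) - complex.Im (g v)) @^-1` [set x | x = 0].
  apply/seteqP; split=> v /=; first by move=> ->; rewrite !subrr.
  by move=> []; case: (f v) (g v) => a b [c d] /= /subr0_eq -> /subr0_eq ->.
apply: closedI; apply: preimage_closed; try exact: closed_eq.
- by move=> v _; exact: cvgB (f1 v) (g1 v).
- by move=> v _; exact: cvgB (f2 v) (g2 v).
Qed.

Lemma closed_mcont_eq N p q (F G : 'rV[R]_N -> 'M[C]_(p, q)) : mcont F -> mcont G ->
  closed [set v | F v = G v].
Proof.
move=> hF hG.
have -> : [set v | F v = G v] =
    \bigcap_(t in [set: 'I_p * 'I_q]) [set v | F v t.1 t.2 = G v t.1 t.2].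
  apply/seteqP; split=> v /= h; first by move=> t _ /=; rewrite h.
  by apply/matrixP => i j; exact: (h (i, j) Logic.I).
by apply: closed_bigI => t _; exact: closed_ccont_eq (hF _ _) (hG _ _).
Qed.

Lemma closed_psd N n (F : 'rV[R]_N -> 'M[C]_n) : mcont F -> closed [set v | psd (F v)].
Proof.
move=> hF.
have -> : [set v | psd (F v)] = [set v | (F v)^H = F v] `&`
    \bigcap_(w in [set: 'cV[C]_n]) ((fun v => qf (F v) w) @^-1` [set x | 0 <= x]).
  apply/seteqP; split=> v /= [h1 h2]; split=> // w; first by move=> _; exact: h2.
  exact: (h2 w).
apply: closedI; first by apply: closed_mcont_eq => //; exact: mcont_adj.
apply: closed_bigI => w _; apply: preimage_closed; last exact: closed_ge.
move=> v _.
have h : mcont (fun v => (F v *m w) *m w^H).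
  by apply: mcontM; [apply: mcontM => //|]; exact: mcont_cst.
exact: (continuous_retr h).
Qed.

End Compactness.

(** * Existence of a minimising representation *)

Section MinimizerExistence.
Context {R : realType}.
Local Notation C := R[i].
Local Notation "A ^H" := (map_mx Num.conj A^T).

Definition decode (K : finType) n (v : 'rV[R]_#|{: K * 'I_n * 'I_n * bool}|) (k : K) : 'M[C]_n :=
  \matrix_(i, j) Complex (v 0 (enum_rank (k, i, j, false))) (v 0 (enum_rank (k, i, j, true))).

Definition encode (K : finType) n (w : K -> 'M[C]_n) : 'rV[R]_#|{: K * 'I_n * 'I_n * bool}| :=
  \row_t let: (k, i, j, b) := enum_val t in
    if b then complex.Im (w k i j) else complex.Re (w k i j).

Lemma encodeK (K : finType) n (w : K -> 'M[C]_n) : decode (encode w) = w.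
Proof.
apply/funext => k; apply/matrixP => i j; rewrite !mxE !enum_rankK.
by case: (w k i j).
Qed.

Lemma mcont_decode (K : finType) n (k : K) : mcont (fun v => @decode K n v k).
Proof.
move=> i j; split.
  have -> : (fun v => complex.Re (@decode K n v k i j)) = fun v => v 0 (enum_rank (k, i, j, false)).
    by apply/funext => v; rewrite mxE.
  exact: coord_continuous.
have -> : (fun v => complex.Im (@decode K n v k i j)) = fun v => v 0 (enum_rank (k, i, j, true)).
  by apply/funext => v; rewrite mxE.
exact: coord_continuous.
Qed.

Lemma norm_le_decode (K : finType) n (c : R) v :
  0 <= c -> (forall k, hn (@decode K n v k) <= c) -> `|v| <= c.
Proof.
move=> c0 h; rewrite /Num.norm /= mx_normrE; apply/bigmax_leP; split=> // -[i t] _ /=.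
rewrite ord1 -(enum_valK t); case: (enum_val t) => -[[k p] q] b.
apply: le_trans (le_trans (normc_le_hn (decode v k) p q) (h k)); rewrite mxE.
by case: b; [exact: (Im_le_normc (Complex _ _))|exact: (Re_le_normc (Complex _ _))].
Qed.

Lemma hn_le_retr n (A : 'M[C]_n) : psd A -> hn A <= retr A.
Proof.
move=> /psd_factor[Z ->]; apply: le_trans (hn_mulmx _ _) _.
by rewrite hn_adj -expr2 sqr_hn /retr -[\tr _]/(hs Z Z) hs_nsq.
Qed.

(** Substituting B gives A = 1 + P_x 1 + P_x P_x^H A with positive terms, and the trace of P_x 1 is
    the sum of all |x_j|^2. *)
Lemma nsq_le_retr n m (x : 'I_m -> 'M[C]_n) A B i : resolvent x A B -> nsq (x i) <= retr A.
Proof.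
move=> [pA pB AE BE]; rewrite AE BE cpmD !retrD addrCA.
have h1 := retr_psd_ge0 (psdD (psd1 n) (psd_cpm x (psd_cpm (adjf x) pA))).
rewrite retrD in h1; suff : nsq (x i) <= retr (cpm x 1%:M) by move: h1; lra.
rewrite /retr /cpm (raddf_sum mxtrace) raddf_sum (bigD1 i) //=.
have E j : \tr (x j *m 1%:M *m (x j)^H) = (nsq (x j))%:C%C by rewrite mulmx1 -hs_nsq.
rewrite E lerDl; apply: sumr_ge0 => j _; rewrite E; exact: nsq_ge0.
Qed.

Lemma closed_resolvent N n m (x : 'rV[R]_N -> 'I_m -> 'M[C]_n) (A B : 'rV[R]_N -> 'M[C]_n) :
  (forall i, mcont (fun v => x v i)) -> mcont A -> mcont B ->
  closed [set v | resolvent (x v) (A v) (B v)].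
Proof.
move=> hx hA hB.
have -> : [set v | resolvent (x v) (A v) (B v)] = [set v | psd (A v)] `&` [set v | psd (B v)] `&`
    [set v | A v = 1%:M + cpm (x v) (B v)] `&` [set v | B v = 1%:M + cpm (adjf (x v)) (A v)].
  apply/seteqP; split=> v /=; first by move=> [h1 h2 h3 h4]; split; [split; [split|]|].
  by move=> [[[h1 h2] h3] h4]; split.
apply: closedI; [apply: closedI; [apply: closedI; exact: closed_psd|]|].
- by apply: closed_mcont_eq => //; apply: mcontD; [exact: mcont_cst|exact: mcont_cpm].
- apply: closed_mcont_eq => //; apply: mcontD; first exact: mcont_cst.
  by apply: mcont_cpm => // i; exact: mcont_adj.
Qed.

(* tr (A + B) dominates the norms of A, B and the x_i, so the sublevel sets of
   the objective are compact. *)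
Lemma exists_minimal n m (u : 'M[C]_(n * n)) (x y : 'I_m -> 'M[C]_n) A B A' B' :
  feasible u x y A B A' B' ->
  exists x y A B A' B', @minimal R n m u x y A B A' B'.
Proof.
have arith (a b c d o N : R) : 0 <= a -> 0 <= b -> 0 <= c -> 0 <= d -> a + b + (c + d) <= o ->
    1 + o < N -> [/\ 1 + a <= N, 1 + c <= N, a <= N, b <= N & c <= N /\ d <= N].
  by move=> *; do !split; lra.
(* Labels of the unknown matrices: the first component selects x, A, B or y, A', B'; then [inl i] is
   the i-th member of the family, [inr false] is A and [inr true] is B. *)
move=> feas; pose K : finType := (bool * ('I_m + bool))%type.
pose T := 'rV[R]_#|{: K * 'I_n * 'I_n * bool}|.
pose X (s : bool) (v : T) (i : 'I_m) := @decode K n v (s, inl i).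
pose D (s b : bool) (v : T) := @decode K n v (s, inr b).
pose obj (v : T) := retr (D false false v) + retr (D false true v) +
  (retr (D true false v) + retr (D true true v)).
pose F : set T := [set v | feasible u (X false v) (X true v)
  (D false false v) (D false true v) (D true false v) (D true true v)].
pose code (x y : 'I_m -> 'M[C]_n) (A B A' B' : 'M[C]_n) : T := encode (fun k : K =>
  match k with (false, inl i) => x i | (true, inl i) => y i
  | (false, inr false) => A | (false, inr true) => B
  | (true, inr false) => A' | (true, inr true) => B' end).
have codeF x1 y1 A1 B1 A1' B1' : feasible u x1 y1 A1 B1 A1' B1' ->
    F (code x1 y1 A1 B1 A1' B1') /\ obj (code x1 y1 A1 B1 A1' B1') =
      retr A1 + retr B1 + (retr A1' + retr B1').
  by move=> h; rewrite /F /obj /= /X /D /code encodeK.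
have mX s i : mcont (fun v => X s v i) by exact: mcont_decode.
have mD s b : mcont (D s b) by exact: mcont_decode.
have cobj : continuous obj.
  have cr s b := continuous_retr (mD s b).
  move=> v; exact: cvgD (cvgD (cr _ _ v) (cr _ _ v)) (cvgD (cr _ _ v) (cr _ _ v)).
have [F0 objE] := codeF _ _ _ _ _ _ feas.
set v0 := code _ _ _ _ _ _ in F0 objE.
pose S := F `&` obj @^-1` [set r | r <= obj v0].
have S0 : S v0 by split=> //=.
have clF : closed F.
  have -> : F = [set v | u = \sum_i X false v i *t X true v i] `&`
      [set v | resolvent (X false v) (D false false v) (D false true v)] `&`
      [set v | resolvent (X true v) (D true false v) (D true true v)].
    apply/seteqP; split=> v /=; first by move=> [h1 h2 h3]; split; [split|].
    by move=> [[h1 h2] h3]; split.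
  apply: closedI; [apply: closedI|]; last by exact: closed_resolvent.
    by apply: closed_mcont_eq; [exact: mcont_cst|apply: mcont_sum => i; exact: mcont_tens].
  exact: closed_resolvent.
have clS : closed S.
  apply: closedI => //; apply: preimage_closed; last exact: closed_le.
  by move=> v _; exact: cobj.
have bS : bounded_set S.
  have o0 : 0 <= obj v0.
    have [_ [p1 p2 _ _] [p3 p4 _ _]] := F0.
    by rewrite !addr_ge0 ?retr_psd_ge0.
  exists (1 + obj v0); split; first exact: num_real.
  move=> M hM v [Fv /= vle]; apply: norm_le_decode; first lra.
  have [_ hx hy] := Fv; have [p1 p2 _ _] := hx; have [p3 p4 _ _] := hy.
  have t1 := retr_psd_ge0 p1; have t2 := retr_psd_ge0 p2.
  have t3 := retr_psd_ge0 p3; have t4 := retr_psd_ge0 p4.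
  have n1 := hn_le_retr p1; have n2 := hn_le_retr p2.
  have n3 := hn_le_retr p3; have n4 := hn_le_retr p4.
  have sq (Z : 'M[C]_n) (r : R) : nsq Z <= r -> 0 <= r -> hn Z <= 1 + r.
    move=> Zr r0; rewrite -ler_sqr ?nnegrE ?hn_ge0 ?addr_ge0 // sqr_hn; apply: le_trans Zr _.
    by have := sqr_ge0 r; rewrite sqrrD expr1n mul1r mulr2n; lra.
  have nx i := sq _ _ (nsq_le_retr i hx) t1; have ny i := sq _ _ (nsq_le_retr i hy) t3.
  have [a1 a2 a3 a4 [a5 a6]] := arith _ _ _ _ _ _ t1 t2 t3 t4 vle hM.
  case=> -[] [i|[]].
  - exact: le_trans (ny i) a2.
  - exact: le_trans n4 a6.
  - exact: le_trans n3 a5.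
  - exact: le_trans (nx i) a1.
  - exact: le_trans n2 a4.
  - exact: le_trans n1 a3.
have cS : compact S := bounded_closed_compact bS clS.
have [v vS hv] := EVT_min_rV (ex_intro _ v0 S0) cS (continuous_subspaceT cobj).
have {}vS : S v := set_mem vS.
exists (X false v), (X true v), (D false false v), (D false true v), (D true false v), (D true true v).
split; first by case: vS.
move=> x2 y2 A2 B2 A2' B2' h2; have [Fc <-] := codeF _ _ _ _ _ _ h2.
(* A feasible point outside the compact sublevel set has a value above [obj v0], so it cannot beat
   the minimum over that set. *)
have [le0|/ltW le0] := leP (obj (code x2 y2 A2 B2 A2' B2')) (obj v0).
  by apply: hv; exact: mem_set.
by apply: le_trans le0; case: vS.
Qed.

End MinimizerExistence.

(** * Balanced representations and the final limit *)

Section LowerBound.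
Context {R : realType}.
Local Notation C := R[i].
Local Notation "A ^H" := (map_mx Num.conj A^T).

Lemma nsq_cpm_scale n m (x : 'I_m -> 'M[C]_n) (r : R) b :
  nsq (cpm (fun i => r%:C%C *: x i) b) = (r ^+ 2) ^+ 2 * nsq (cpm x b).
Proof.
have -> : cpm (fun i => r%:C%C *: x i) b = (r ^+ 2)%:C%C *: cpm x b.
  rewrite /cpm scaler_sumr; apply: eq_bigr => i _.
  by rewrite realZ_adj -scalemxAl -scalemxAr -scalemxAl scalerA expr2 rmorphM.
by rewrite nsqZ normc_real ger0_norm ?sqr_ge0.
Qed.

Lemma min_conj_norm_ge0 n m (x : 'I_m -> 'M[C]_n) : 0 <= min_conj_norm x.
Proof. exact: opnorm_ge0. Qed.

Lemma min_conj_norm_contr n m (x : 'I_m -> 'M[C]_n) b :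
  nsq (cpm x b) <= min_conj_norm x ^+ 2 * nsq b.
Proof. exact: (min_conj_norm_leP x (min_conj_norm_ge0 x)).1. Qed.

Lemma scaled_tens n m (x y : 'I_m -> 'M[C]_n) (r s : R) :
  \sum_i (r%:C%C *: x i) *t (s%:C%C *: y i) = (r * s)%:C%C *: \sum_i x i *t y i.
Proof.
rewrite scaler_sumr; apply: eq_bigr => i _; apply/matrixP => p q.
by rewrite !mxE rmorphM /= mulrACA.
Qed.

Lemma oh_ge0 n (u : 'M[C]_(n * n)) : (0 <= oh u)%E.
Proof.
by apply: le_ereal_inf_tmp => _ [m [x [y [_ ->]]]]; rewrite lee_fin mulr_ge0 ?sqrtr_ge0.
Qed.

Lemma oh_fin n (u : 'M[C]_(n * n)) : exists2 o : R, 0 <= o & oh u = o%:E.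
Proof.
have [m [x [y uE]]] := tens_rep u.
have h : (oh u <= (Num.sqrt (min_conj_norm x) * Num.sqrt (min_conj_norm y))%:E)%E.
  by apply: ereal_inf_lbound; exists m, x, y.
have h0 := oh_ge0 u; case: (oh u) h h0 => [r _ r0|h _|_ h]; [|by []|by []].
by exists r; rewrite // -lee_fin.
Qed.

Lemma oh_le n m (x y : 'I_m -> 'M[C]_n) (l c : R) : 0 <= l -> 0 <= c ->
  (forall b, nsq (cpm x b) <= c ^+ 2 * nsq b) -> (forall b, nsq (cpm y b) <= c ^+ 2 * nsq b) ->
  (oh (l%:C%C *: \sum_i x i *t y i) <= (l * c)%:E)%E.
Proof.
move=> l0 c0 hx hy; pose r := Num.sqrt l.
have rr : r ^+ 2 = l by rewrite sqr_sqrtr.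
have N (z : 'I_m -> 'M[C]_n) : (forall b, nsq (cpm z b) <= c ^+ 2 * nsq b) ->
    min_conj_norm (fun i => r%:C%C *: z i) <= l * c.
  move=> hz; apply/min_conj_norm_leP => [|b]; first by rewrite mulr_ge0.
  by rewrite nsq_cpm_scale rr exprMn -[leRHS]mulrA ler_wpM2l ?sqr_ge0.
apply: le_trans (_ : _ <= (Num.sqrt (min_conj_norm (fun i => r%:C%C *: x i)) *
  Num.sqrt (min_conj_norm (fun i => r%:C%C *: y i)))%:E)%E _.
  apply: ereal_inf_lbound; exists m, (fun i => r%:C%C *: x i), (fun i => r%:C%C *: y i).
  by split=> //; rewrite scaled_tens -expr2 rr.
have lc : 0 <= l * c by rewrite mulr_ge0.
rewrite lee_fin -[leRHS](sqr_sqrtr lc) expr2.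
by apply: ler_pM; rewrite ?sqrtr_ge0 // ler_wsqrtr // N.
Qed.

Lemma between_factor (p q L : R) : 0 <= p -> 0 <= q -> p * q < L ->
  exists a : R, [/\ 0 < a, p < a & a * q < L].
Proof.
move=> p0 q0 pq; have [q00|qn0] := eqVneq q 0.
  rewrite q00 mulr0 in pq; exists (p + 1); rewrite q00 mulr0.
  by split; [lra|lra|exact: pq].
have qp : 0 < q by rewrite lt_neqAle eq_sym qn0.
have h : p < L / q by rewrite ltr_pdivlMr.
exists ((p + L / q) / 2); split; [lra|lra|].
by rewrite -ltr_pdivlMr //; lra.
Qed.

(** The definition of [oh] bounds only the product p q of the two norms by l^2. Dividing x by sqrt a
    and scaling y by sqrt a / l, with p < a and a q < l^2, makes both norms less than 1. *)
Lemma balanced_rep n (u : 'M[C]_(n * n)) (l : R) : (oh u < l%:E)%E ->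
  exists m (x y : 'I_m -> 'M[C]_n) (s : R), [/\ 0 <= s < 1, u = l%:C%C *: \sum_i x i *t y i,
    forall b, nsq (cpm x b) <= s ^+ 2 * nsq b & forall b, nsq (cpm y b) <= s ^+ 2 * nsq b].
Proof.
move=> /ereal_inf_lt[_ [m [x [y [uE ->]]]]]; rewrite lte_fin.
set p := min_conj_norm x; set q := min_conj_norm y => pql.
have p0 : 0 <= p := min_conj_norm_ge0 x; have q0 : 0 <= q := min_conj_norm_ge0 y.
have hp : forall b, nsq (cpm x b) <= p ^+ 2 * nsq b := min_conj_norm_contr x.
have hq : forall b, nsq (cpm y b) <= q ^+ 2 * nsq b := min_conj_norm_contr y.
clearbody p q.
have l0 : 0 < l by apply: le_lt_trans pql; rewrite mulr_ge0 ?sqrtr_ge0.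
have pq : p * q < l ^+ 2.
  rewrite -(sqr_sqrtr p0) -(sqr_sqrtr q0) -exprMn ltr_sqr ?nnegrE ?mulr_ge0 ?sqrtr_ge0 //.
  exact: ltW.
have [a [a0 pa aq]] := between_factor p0 q0 pq.
pose r := (Num.sqrt a)^-1; pose t := Num.sqrt a / l.
have sa0 : 0 < Num.sqrt a by rewrite sqrtr_gt0.
have rt : l * (r * t) = 1 by rewrite /r /t; field; rewrite !gt_eqF.
have r2 : r ^+ 2 = a^-1 by rewrite /r exprVn sqr_sqrtr // ltW.
have t2 : t ^+ 2 = a / l ^+ 2 by rewrite /t exprMn exprVn sqr_sqrtr // ltW.
exists m, (fun i => r%:C%C *: x i), (fun i => t%:C%C *: y i), (Num.max (p / a) (a * q / l ^+ 2)).
have px : p / a < 1 by rewrite ltr_pdivrMr ?mul1r.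
have qy : a * q / l ^+ 2 < 1 by rewrite ltr_pdivrMr ?mul1r // exprn_gt0.
have px0 : 0 <= p / a by rewrite divr_ge0 // ltW.
have qy0 : 0 <= a * q / l ^+ 2 by rewrite divr_ge0 ?sqr_ge0 ?mulr_ge0 // ltW.
split.
- by rewrite le_max px0 /= gt_max px qy.
- by rewrite scaled_tens scalerA -rmorphM rt rmorph1 scale1r.
- move=> b; rewrite nsq_cpm_scale r2; have h := hp b.
  apply: (@le_trans _ _ ((p / a) ^+ 2 * nsq b)).
    by rewrite [p / a]mulrC exprMn -[leRHS]mulrA ler_wpM2l ?sqr_ge0.
  by rewrite ler_wpM2r ?nsq_ge0 // ler_sqr ?nnegrE ?le_max ?px0 // lexx.
- move=> b; rewrite nsq_cpm_scale t2; have h := hq b.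
  apply: (@le_trans _ _ ((a * q / l ^+ 2) ^+ 2 * nsq b)).
    have -> : a * q / l ^+ 2 = a / l ^+ 2 * q by rewrite mulrAC.
    by rewrite [X in _ <= X * _]exprMn -[leRHS]mulrA ler_wpM2l ?sqr_ge0.
  by rewrite ler_wpM2r ?nsq_ge0 // ler_sqr ?nnegrE ?le_max ?px0 ?qy0 ?lexx ?orbT.
Qed.

(** Pairing A = 1 + P_x B with A. The second term is the same for A and B by [variation_adj], and at
    a minimum also for A' and B' by the Gram identity. *)
Lemma resolvent_energy n m (x : 'I_m -> 'M[C]_n) A B : resolvent x A B ->
  nsq A = retr A + variation x x A B.
Proof.
move=> [[hA _] [hB _] AE _].
have -> : nsq A = complex.Re (hs A A) by rewrite hs_nsq.
have ReD (z w : C) : complex.Re (z + w) = complex.Re z + complex.Re w by case: z; case: w.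
have hs1D (X Dt : 'M[C]_n) : Dt = 1%:M + X -> hs A Dt = \tr A + hs A X.
  by move=> ->; rewrite hsDr hs1.
rewrite (hs1D _ _ AE) ReD; congr (_ + complex.Re _).
rewrite hs_sumr; apply: eq_bigr => i _.
by rewrite [RHS]hs_mulr hB [RHS]hs_mulr.
Qed.

Lemma retr_le_hn n (A : 'M[C]_n) : retr A <= hn A * hn (1%:M : 'M[C]_n).
Proof.
rewrite retr_hs; apply: le_trans (ler_norm _) _; apply: le_trans (Re_le_normc _) _.
exact: hs_cauchy.
Qed.

Lemma resolvent_hn_ge1 n m (x : 'I_m -> 'M[C]_n) A B : (0 < n)%N -> resolvent x A B -> 1 <= hn A.
Proof.
move=> n0 hAB; pose v : 'cV[C]_n := delta_mx (Ordinal n0) 0.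
have nv : nsq v = 1 by exact: nsq_delta.
have := le_trans (resolvent_ge1 hAB v) (le_trans (ler_norm _) (qf_le_hn A v)).
by rewrite nv mulr1.
Qed.

Lemma oh_le_calderon_norm n (u : 'M[C]_(n * n)) (f : C -> 'End('M[C]_n)) : (0 < n)%N ->
  calderon_space (@norm_cbMn R n) (@norm_cbconj R n) f -> f halfC = Phi u ->
  (oh u <= calderon_norm (@norm_cbMn R n) (@norm_cbconj R n) f)%E.
Proof.
move=> n0 hf fu; have [ o o0 oE] := oh_fin u; rewrite oE.
pose k := hn (1%:M : 'M[C]_n); have k0 : 0 <= k := hn_ge0 _.
have est (t l : R) : (calderon_norm (@norm_cbMn R n) (@norm_cbconj R n) f <= t%:E)%E -> o < l ->
    l - k * (l - o) <= t.
  move=> ft ol; have l0 : 0 < l by apply: le_lt_trans ol.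
  have := balanced_rep (u := u) (l := l); rewrite oE lte_fin => /(_ ol).
  move=> [m [x0 [y0 [s [s01 uE hx0 hy0]]]]].
  have [A0 [B0 [pA0 pB0 A0E B0E]]] := cp_resolvent s01 hx0.
  have [A1 [B1 [pA1 pB1 A1E B1E]]] := cp_resolvent s01 hy0.
  have [x [y [A [B [A' [B' hmin]]]]]] : exists x y A B A' B',
      @minimal R n m (\sum_i x0 i *t y0 i) x y A B A' B'.
    by apply: (@exists_minimal _ _ _ _ x0 y0 A0 B0 A1 B1); split=> //; split.
  have gram := minimal_gram hmin; have [[u'E hx hy] _] := hmin.
  rewrite u'E in uE.
  pose v := variation x x A B.
  have vy : variation y y A' B' = v.
    by rewrite /v /variation; congr complex.Re; apply: eq_bigr => i _; rewrite gram.
  have [[hA _] [hB _] _ _] := hx; have [[hA' _] [hB' _] _ _] := hy.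
  have eA := resolvent_energy hx; have eB := resolvent_energy (resolvent_adj hx).
  have eA' := resolvent_energy hy; have eB' := resolvent_energy (resolvent_adj hy).
  rewrite variation_adj // in eB; rewrite variation_adj // in eB'.
  rewrite vy in eA' eB'; rewrite -/v in eA eB.
  (* All four matrices D satisfy |D|^2 = tr D + v with the same v, and tr D <= |D| sqrt n; so the
     largest norm a satisfies a^2 - a sqrt n <= v. *)
  have [a [a1 nA nB nA' [nB' av]]] : exists a : R, [/\ 1 <= a, hn A <= a, hn B <= a, hn A' <= a &
      hn B' <= a /\ a ^+ 2 - a * k <= v].
    have one (D : 'M[C]_n) : nsq D = retr D + v -> hn D ^+ 2 - hn D * k <= v.
      by rewrite sqr_hn => ->; have := retr_le_hn D; rewrite -/k; lra.
    have mx (P : R -> Prop) (p q : R) : P p -> P q -> P (Num.max p q).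
      by move=> Pp Pq; rewrite /Num.max; case: ifP.
    exists (Num.max (Num.max (hn A) (hn B)) (Num.max (hn A') (hn B'))).
    split; rewrite ?le_max ?lexx ?orbT ?(resolvent_hn_ge1 n0 hx) //; split=> //.
    by apply: (mx (fun r => r ^+ 2 - r * k <= v)); apply: (mx (fun r => r ^+ 2 - r * k <= v)); exact: one.
  have a0 : 0 < a by apply: lt_le_trans a1.
  have ge1 w : [/\ nsq w <= qf A w, nsq w <= qf B w, nsq w <= qf A' w & nsq w <= qf B' w].
    split; [exact: resolvent_ge1 hx w|exact: resolvent_ge1 (resolvent_adj hx) w|
      exact: resolvent_ge1 hy w|exact: resolvent_ge1 (resolvent_adj hy) w].
  have psds : [/\ psd A, psd B, psd A' & psd B'].
    by have [p1 p2 _ _] := hx; have [p3 p4 _ _] := hy; split.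
  have fE : f halfC = Phi (l%:C%C *: \sum_i x i *t y i) by rewrite fu uE.
  have dual := dual_estimate n0 psds ge1 (And4 nA nB nA' nB') gram hf ft fE.
  rewrite -/(variation x x A B) -/v in dual.
  have ai1 : a^-1 <= 1 by rewrite invf_le1.
  have ai0 : 0 < a^-1 by rewrite invr_gt0.
  have := @oh_le _ _ x y l (1 - a^-1) (ltW l0).
  rewrite subr_ge0 -uE oE lee_fin => /(_ ai1 (resolvent_contr hx a1 nA nB)
    (resolvent_contr hy a1 nA' nB')) ole.
  have h1 : l * (a ^+ 2 - a * k) <= a ^+ 2 * t by apply: le_trans dual; rewrite ler_pM2l.
  have h2 : l - l * (a^-1 * k) <= t.
    have a20 : 0 < a ^+ 2 by rewrite exprn_gt0.
    rewrite -(ler_pM2l a20); apply: le_trans h1; rewrite le_eqVlt; apply/orP; left; apply/eqP.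
    by field; rewrite gt_eqF.
  have h3 : k * (l / a) <= k * (l - o) by rewrite ler_wpM2l //; move: ole; rewrite mulrBr mulr1; lra.
  have e : l * (a^-1 * k) = k * (l / a) by ring.
  by move: h2 h3; rewrite e; lra.
have lower t : (calderon_norm (@norm_cbMn R n) (@norm_cbconj R n) f <= t%:E)%E -> o <= t.
  move=> ft; rewrite leNgt; apply/negP => to.
  (* With this d the bound [est] at l = o + d reads o - (o - t)/2 + 2 d <= t, which contradicts t <
     o. *)
  pose d := (o - t) / (2 * (k + 1)); have k1 : 0 < 2 * (k + 1) by lra.
  have d0 : 0 < d by rewrite divr_gt0 // subr_gt0.
  have od : o < o + d by rewrite ltrDl.
  have := est t (o + d) ft od.
  have -> : o + d - k * (o + d - o) = o - (o - t) / 2 + 2 * d.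
    by rewrite /d; field; rewrite gt_eqF //; lra.
  lra.
(* The value +oo is trivial; -oo would make o at most o - 1. *)
case E : (calderon_norm _ _ f) => [t| |]; last 2 first.
- exact: leey.
- by exfalso; have := lower (o - 1); rewrite E => /(_ (leNye _)); lra.
- by rewrite lee_fin; apply: lower; rewrite E.
Qed.

End LowerBound.

Lemma interp_norm_le_oh (R : realType) n (u : 'M[R[i]]_(n * n)) (l e : R) : (0 < n)%N ->
  (oh u < l%:E)%E -> 0 < e -> exists2 f,
    calderon_space (@norm_cbMn R n) (@norm_cbconj R n) f & f halfC = Phi u /\
      (calderon_norm (@norm_cbMn R n) (@norm_cbconj R n) f <= (l * (1 + e))%:E)%E.
Proof.
move=> n0 ul e0; have [m [x [y [s [s01 uE hx hy]]]]] := balanced_rep ul.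
have l0 : 0 <= l by rewrite -lee_fin; apply: le_trans (oh_ge0 u) (ltW ul).
rewrite uE; exact: calderon_interpolant n0 s01 l0 e0 hx hy.
Qed.

Theorem mainTheorem12 (R : realType) (n : nat) (hn : (1 <= n)%N) :
  [/\ forall x y a : 'M[R[i]]_n, Phi (x *t y) a = x *m a *m y,
      linear (@Phi R n),
      set_bij [set: 'M[R[i]]_(n * n)]
        (interp_space (@norm_cbMn R n) (@norm_cbconj R n) (2^-1)) (@Phi R n) &
      forall u : 'M[R[i]]_(n * n),
        interp_norm (@norm_cbMn R n) (@norm_cbconj R n) (2^-1) (Phi u) = oh u].
Proof.
split.
- exact: Phi_tens.
- exact: tens_lift_linear.
- split.
  + move=> u _; have [r _ oE] := oh_fin u.
    have ul : (oh u < (r + 1)%:E)%E by rewrite oE lte_fin ltrDl.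
    by have [f hf [fu _]] := interp_norm_le_oh hn ul ltr01; exists f.
  + by move=> u v _ _ /(congr1 (@Phi_inv R n)); rewrite !PhiK.
  (* Every linear map on M_n is some Phi u, so the interpolation space is all of End(M_n). *)
  + by move=> T _; exists (Phi_inv T) => //; exact: Phi_invK.
- move=> u; apply/le_anti/andP; split; last first.
    apply: le_ereal_inf_tmp => _ [f [hf fu] <-]; exact: oh_le_calderon_norm.
  have [r r0 oE] := oh_fin u; rewrite oE; apply/lee_addgt0Pr => e e0.
  (* Half of e separates l from oh(u); the other half pays for the damping, as l (1 + e/(2 l)) = l +
     e/2. *)
  pose l := r + e / 2; have l0 : 0 < l by rewrite /l; lra.
  have ul : (oh u < l%:E)%E by rewrite oE lte_fin /l; lra.
  have el : 0 < e / 2 / l by rewrite !divr_gt0.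
  have [f hf [fu fle]] := interp_norm_le_oh hn ul el.
  apply: (@le_trans _ _ (calderon_norm (@norm_cbMn R n) (@norm_cbconj R n) f)).
    by apply: ereal_inf_lbound; exists f.
  apply: le_trans fle _; rewrite -EFinD lee_fin.
  have -> : l * (1 + e / 2 / l) = l + e / 2 by field; rewrite gt_eqF.
  by rewrite /l; lra.
Qed.
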